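(* Let $T>0$, $M=[T/\Delta t]$, and let $k\ge0$ be an integer. There exist a positive integer $m_k$ and positive constants $c$ and $C$, independent of $h$, $\Delta t$, $T$ and $\varepsilon$, such that if $\Delta t\le c\,\varepsilon^{1/2}$, then the numerical solution $(\phi^n)$ of the scheme described in the context satisfies $$\max_{1\le n\le M-1}\|\phi^{n+1}_{\bf F}-2\phi^n_{\bf F}+\phi^{n-1}_{\bf F}\|_{H^k}\le\hat Q_{k,\varepsilon}\,\Delta t^2,\qquad \hat Q_{k,\varepsilon}:=C\varepsilon^{-m_k}.$$
   Context: Grid and operators. $\Omega=(0,L)^3$ with periodic boundary conditions; $N=2K+1$ is odd, $h=L/N$, $x_i=y_i=z_i=(i-\tfrac12)h$. $\mathcal V_{\rm per}$ is the space of real grid functions $f=(f_{i,j,k})_{(i,j,k)\in\mathbb Z^3}$ that are $N$-periodic in each index; $\langle f,g\rangle=h^3\sum_{i,j,k=1}^N f_{i,j,k}g_{i,j,k}$, $\|f\|_2^2=\langle f,f\rangle$, $\|f\|_4^4=\langle f^4,1\rangle$. $(D_x^2f)_{i,j,k}=(f_{i+1,j,k}-2f_{i,j,k}+f_{i-1,j,k})/h^2$ (similarly $D_y^2,D_z^2$), and the long stencil fourth order operators are $\mathcal D^2_{x,(4)}=D_x^2(1-\frac{h^2}{12}D_x^2)$ (similarly in $y,z$), $\Delta_{h,(4)}=\mathcal D^2_{x,(4)}+\mathcal D^2_{y,(4)}+\mathcal D^2_{z,(4)}$, with $\|\nabla_{h,(4)}f\|_2^2=\langle f,-\Delta_{h,(4)}f\rangle$.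 For $f\in\mathcal V_{\rm per}$ with discrete Fourier expansion $f_{i,j,k}=\sum_{\ell,m,n=-K}^K\hat f^N_{\ell,m,n}e^{2\pi\mathrm i(\ell x_i+my_j+nz_k)/L}$, its continuous extension is $f_{\bf F}(x,y,z)=\sum_{\ell,m,n=-K}^K\hat f^N_{\ell,m,n}e^{2\pi\mathrm i(\ell x+my+nz)/L}$. $\|\cdot\|_{H^m}$ is the usual Sobolev norm on $\Omega$. Numerical scheme. $\Phi$ is the exact ($\Omega$-periodic) solution of the Cahn-Hilliard equation $\phi_t=\Delta(\varepsilon^{-1}(\phi^3-\phi)-\varepsilon\Delta\phi)$ with sufficiently smooth initial datum $\phi_0$, and $\Phi_N(\cdot,t)$ is the truncation of the Fourier series of $\Phi(\cdot,t)$ to modes $-K\le\ell,m,n\le K$. With time step $\Delta t>0$, interface parameter $0<\varepsilon<1$ and a fixed constant $A\ge\frac1{16}$, set $\phi^0_{i,j,k}=\Phi_N(x_i,y_j,z_k,0)$, $\mu_h^0=\varepsilon^{-1}((\phi^0)^3-\phi^0)-\varepsilon\Delta_{h,(4)}\phi^0$, $\phi^{-1}=\phi^0-\Delta t\,\Delta_{h,(4)}\mu_h^0$, and for $n\ge0$ let $\phi^{n+1}\in\mathcal V_{\rm per}$ be the (unique) solution of $$\frac{\frac32\phi^{n+1}-2\phi^n+\frac12\phi^{n-1}}{\Delta t}=\Delta_{h,(4)}\mu^{n+1},$$ $$\mu^{n+1}=\varepsilon^{-1}\left((\phi^{n+1})^3-2\phi^n+\phi^{n-1}\right)-\varepsilon\Delta_{h,(4)}\phi^{n+1}-A\varepsilon^{-2}\Delta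 t\,\Delta_{h,(4)}(\phi^{n+1}-\phi^n).$$ The initial data are assumed regular enough that $E_h(\phi^0)+\frac{\Delta t}{4}\|\nabla_{h,(4)}\mu_h^0\|_2^2+\frac{\Delta t^2}{2}\|\Delta_{h,(4)}\mu_h^0\|_2^2\le\tilde C_0$ with $\tilde C_0$ independent of $h$, where $E_h(\phi)=\varepsilon^{-1}(\frac14\|\phi\|_4^4-\frac12\|\phi\|_2^2)+\frac\varepsilon2\|\nabla_{h,(4)}\phi\|_2^2$. Constants may depend on $k$, $L$, $A$, $\tilde C_0$ and Sobolev norms of $\phi_0$. *)

(* Defs.v *)
From HB Require Import structures.
From mathcomp Require Import all_boot all_order all_algebra.
From mathcomp Require Import all_classical all_reals all_analysis.
From mathcomp.real_closed Require Import complex.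
From mathcomp Require Import ring lra.

Set Implicit Arguments.
Unset Strict Implicit.
Unset Printing Implicit Defensive.

Import Order.TTheory GRing.Theory Num.Theory.
Import numFieldNormedType.Exports.
Local Open Scope classical_set_scope.
Local Open Scope ring_scope.

Section Functions.
Variable R : realType.
Implicit Types (f : R -> R -> R -> R) (L : R).

Definition periodic3 L f : Prop := forall x y z : R,
  [/\ f (x + L) y z = f x y z, f x (y + L) z = f x y z
    & f x y (z + L) = f x y z].

Definition partial_x f : R -> R -> R -> R :=
  fun x y z => derive1 (fun t => f t y z) x.
Definition partial_y f : R -> R -> R -> R :=
  fun x y z => derive1 (fun t => f x t z) y.
Definition partial_z f : R -> R -> R -> R :=
  fun x y z => derive1 (fun t => f x y t) z.

Definition continuous3 f : Prop :=
  continuous (fun p : R * R * R => f p.1.1 p.1.2 p.2).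

Definition derivable3 f : Prop := forall x y z : R,
  [/\ derivable (fun t => f t y z) x 1, derivable (fun t => f x t z) y 1
    & derivable (fun t => f x y t) z 1].

Fixpoint class_C (s : nat) f : Prop :=
  if s is s'.+1 then
    [/\ continuous3 f, derivable3 f, class_C s' (partial_x f),
        class_C s' (partial_y f) & class_C s' (partial_z f)]
  else continuous3 f.

(* Lebesgue integral over the box (0, L)^3, in iterated form; it is only
   applied to continuous functions, where Fubini's theorem holds *)
Definition integral3 L f : R :=
  \int[lebesgue_measure]_(x in `]0, L[)
    \int[lebesgue_measure]_(y in `]0, L[)
      \int[lebesgue_measure]_(z in `]0, L[) f x y z.

Definition partial (a b c : nat) f : R -> R -> R -> R :=
  iter a partial_x (iter b partial_y (iter c partial_z f)).

(* norm of H^m((0, L)^3), for functions of class C^m *)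
Definition sobolev_norm L (m : nat) f : R :=
  Num.sqrt (\sum_(a < m.+1) \sum_(b < m.+1) \sum_(c < m.+1 | (a + b + c <= m)%N)
    integral3 L (fun x y z => partial a b c f x y z ^+ 2)).

End Functions.

Section Fourier.
Variable R : realType.
Implicit Types (L x y z : R) (K : nat) (l m n : int).

Definition expi (t : R) : R[i] := Complex (cos t) (sin t).

Definition wave L l m n x y z : R[i] :=
  expi (2 * pi * (l%:~R * x + m%:~R * y + n%:~R * z) / L).

Definition fourier_coef L (f : R -> R -> R -> R) l m n : R[i] :=
  Complex
    (L ^- 3 * integral3 L (fun x y z => f x y z * complex.Re (wave L l m n x y z)^*%C))
    (L ^- 3 * integral3 L (fun x y z => f x y z * complex.Im (wave L l m n x y z)^*%C)).

Definition mode K (l : 'I_(2 * K + 1)) : int := l%:Z - K%:Z.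

Definition trig_sum K L (a : int -> int -> int -> R[i]) x y z : R[i] :=
  \sum_(l < 2 * K + 1) \sum_(m < 2 * K + 1) \sum_(n < 2 * K + 1)
    a (mode l) (mode m) (mode n) * wave L (mode l) (mode m) (mode n) x y z.

(* The sum is real for a real-valued f, the modes being symmetric; Re only
   changes its type. *)
Definition fourier_truncation K L (f : R -> R -> R -> R) : R -> R -> R -> R :=
  fun x y z => complex.Re (trig_sum K L (fourier_coef L f) x y z).

End Fourier.

Section Grid.
Variable R : realType.

Definition grid_fun := int -> int -> int -> R.

Implicit Types (f g : grid_fun) (L h : R) (K : nat).

Definition mesh K L : R := L / (2 * K + 1)%:R.

Definition node K L (i : int) : R := (i%:~R - 2^-1) * mesh K L.

Definition Vper K f : Prop := let N : int := (2 * K + 1)%:Z in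
  forall i j k : int,
  [/\ f (i + N) j k = f i j k, f i (j + N) k = f i j k
    & f i j (k + N) = f i j k].

Definition inner K L f g : R :=
  mesh K L ^+ 3 * \sum_(1 <= i < (2 * K + 1).+1)
    \sum_(1 <= j < (2 * K + 1).+1) \sum_(1 <= k < (2 * K + 1).+1)
      f i%:Z j%:Z k%:Z * g i%:Z j%:Z k%:Z.

Definition norm2_sq K L f : R := inner K L f f.
Definition norm4_4 K L f : R :=
  inner K L (fun i j k => f i j k ^+ 4) (fun _ _ _ => 1).

Definition D2x h f : grid_fun := fun i j k =>
  (f (i + 1) j k - 2 * f i j k + f (i - 1) j k) / h ^+ 2.
Definition D2y h f : grid_fun := fun i j k =>
  (f i (j + 1) k - 2 * f i j k + f i (j - 1) k) / h ^+ 2.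
Definition D2z h f : grid_fun := fun i j k =>
  (f i j (k + 1) - 2 * f i j k + f i j (k - 1)) / h ^+ 2.

(* long stencil operators D^2 (1 - h^2/12 D^2) *)
Definition long_stencil (D2 : R -> grid_fun -> grid_fun) h f : grid_fun :=
  D2 h (fun i j k => f i j k - h ^+ 2 / 12 * D2 h f i j k).

Definition lap4 K L f : grid_fun := let h := mesh K L in fun i j k =>
  long_stencil D2x h f i j k + long_stencil D2y h f i j k
  + long_stencil D2z h f i j k.

Definition grad4_norm2_sq K L f : R :=
  inner K L f (fun i j k => - lap4 K L f i j k).

(* Discrete Fourier coefficients of f; see trig_sum_dft_coef below. *)
Definition dft_coef K L f (l m n : int) : R[i] :=
  ((2 * K + 1)%:R ^- 3) * \sum_(1 <= i < (2 * K + 1).+1)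
    \sum_(1 <= j < (2 * K + 1).+1) \sum_(1 <= k < (2 * K + 1).+1)
      Complex (f i%:Z j%:Z k%:Z) 0
      * (wave L l m n (node K L i%:Z) (node K L j%:Z) (node K L k%:Z))^*%C.

(* the continuous extension f_F; as above, the sum is real *)
Definition extension K L f : R -> R -> R -> R :=
  fun x y z => complex.Re (trig_sum K L (dft_coef K L f) x y z).

Definition energy K L (eps : R) f : R :=
  eps^-1 * (norm4_4 K L f / 4 - norm2_sq K L f / 2)
  + eps / 2 * grad4_norm2_sq K L f.

Definition mu_init K L (eps : R) f : grid_fun := fun i j k =>
  eps^-1 * (f i j k ^+ 3 - f i j k) - eps * lap4 K L f i j k.

(* mu^{n+1} as a function of phi^{n+1}, phi^n and phi^{n-1} *)
Definition mu_next K L (A eps dt : R) (u v w : grid_fun) : grid_fun :=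
  fun i j k =>
    eps^-1 * (u i j k ^+ 3 - 2 * v i j k + w i j k) - eps * lap4 K L u i j k
    - A * eps ^- 2 * dt * lap4 K L (fun i j k => u i j k - v i j k) i j k.

Definition initial_grid K L (phi0 : R -> R -> R -> R) : grid_fun :=
  fun i j k =>
    fourier_truncation K L phi0 (node K L i) (node K L j) (node K L k).

(* phi n is the grid function at time level n >= -1 (values of phi at levels
   below -1 are irrelevant) *)
Record numerical_solution K L (A eps dt : R) (phi0 : R -> R -> R -> R)
    (phi : int -> grid_fun) : Prop := {
  sol_periodic : forall n : nat, Vper K (phi n%:Z);
  sol_init : forall i j k, phi 0 i j k = initial_grid K L phi0 i j k;
  sol_ghost : forall i j k, phi (- 1) i j k =
    phi 0 i j k - dt * lap4 K L (mu_init K L eps (phi 0)) i j k;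
  sol_step : forall (n : nat) i j k,
    (3 / 2 * phi (n%:Z + 1) i j k - 2 * phi n%:Z i j k
     + 1 / 2 * phi (n%:Z - 1) i j k) / dt =
    lap4 K L (mu_next K L A eps dt (phi (n%:Z + 1)) (phi n%:Z) (phi (n%:Z - 1)))
      i j k }.

Definition initial_energy K L (eps dt : R) f : R :=
  energy K L eps f
  + dt / 4 * grad4_norm2_sq K L (mu_init K L eps f)
  + dt ^+ 2 / 2 * norm2_sq K L (lap4 K L (mu_init K L eps f)).

End Grid.

Section Interpolation.
Variable R : realType.
Implicit Types (t : R).

Lemma expiD t t' : expi (t + t') = expi t * expi t'.
Proof.
by rewrite /expi cosD sinD; apply/eqP; rewrite eq_complex /= addrC [X in _ && X]eq_sym; apply/andP; split; apply/eqP; ring.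
Qed.

Lemma expi0 : expi (0 : R) = 1.
Proof. by rewrite /expi cos0 sin0. Qed.

Lemma expi_conj t : (expi t)^*%C = expi (- t).
Proof. by rewrite /expi cosN sinN. Qed.

Lemma expiX t (n : nat) : expi t ^+ n = expi (n%:R * t).
Proof.
elim: n => [|n IH]; first by rewrite mul0r expi0 expr0.
by rewrite exprS IH -expiD; congr expi; rewrite -natr1; ring.
Qed.

Lemma expi_2pi : expi (2 * pi : R) = 1.
Proof. by rewrite /expi mulrC mulr_natr cos2pi sin2pi. Qed.

Lemma expi_eq1 t : `|t| < 2 * pi -> expi t = 1 -> t = 0.
Proof.
move=> ht [hc hs]; apply/eqP/negPn/negP => t0.
have s0 : sin (`|t| / 2) = 0.
  have : cos `|t| = 1 by case: (ger0P t) => _ //; rewrite cosN.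
  rewrite [in cos _](_ : `|t| = (`|t| / 2) *+ 2); last by rewrite -mulr_natr; field.
  have := cos2Dsin2 (`|t| / 2); rewrite cos_mulr2n => h1 h2.
  apply/eqP; rewrite -sqrf_eq0; apply/eqP; move: h1 h2; rewrite -mulr_natr; lra.
have : 0 < sin (`|t| / 2).
  apply: sin_gt0_pi; rewrite ?in_itv /=; have := t0; rewrite -normr_gt0; lra.
by rewrite s0 ltxx.
Qed.

Lemma dirichlet K (i a : nat) :
  (0 < i <= 2 * K + 1)%N -> (0 < a <= 2 * K + 1)%N ->
  \sum_(l < 2 * K + 1)
     expi (2 * pi * (mode l)%:~R * (i%:R - a%:R) / (2 * K + 1)%:R : R)
  = if i == a then (2 * K + 1)%:R else 0.
Proof.
move=> hi ha; set N := (2 * K + 1)%N.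
have N0 : (N%:R : R) != 0 by rewrite pnatr_eq0 /N addn1.
case: eqP => [->|/eqP nia].
  under eq_bigr do rewrite subrr mulr0 mul0r expi0.
  by rewrite sumr_const card_ord.
set w := expi (2 * pi * (i%:R - a%:R) / N%:R : R).
rewrite (eq_bigr (fun l : 'I_N => expi (- (K%:R * (2 * pi * (i%:R - a%:R) / N%:R))) * w ^+ l)); last first.
  move=> l _; rewrite expiX -expiD; congr expi.
  by rewrite /mode intrB -!pmulrn; ring.
rewrite -mulr_sumr.
have w1 : w != 1.
  apply/eqP => /expi_eq1 h.
  have pi0 := pi_gt0 R.
  have Np : (0 : R) < N%:R by rewrite lt0r N0 ler0n.
  have hb : `|(i%:R - a%:R : R)| < N%:R.
    case/andP: hi; case/andP: ha.
    rewrite -/N -!(ltr_nat R) -!(ler_nat R) => *; rewrite ltr_norml; lra.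
  have : 2 * pi * (i%:R - a%:R) / N%:R = 0 :> R.
    apply: h; rewrite normrM normfV (ger0_norm (ltW Np)) ltr_pdivrMr //.
    by rewrite normrM gtr0_norm ?ltr_pM2l; lra.
  move/eqP; rewrite !mulf_eq0 invr_eq0 (negPf N0) subr_eq0 eqr_nat (negPf nia).
  by rewrite pnatr_eq0 (gt_eqF pi0).
have : w ^+ N - 1 = 0.
  rewrite expiX.
  have -> : N%:R * (2 * pi * (i%:R - a%:R) / N%:R) = 2 * pi * i%:R - 2 * pi * a%:R :> R by field.
  rewrite expiD -expi_conj [2 * pi * i%:R]mulrC [2 * pi * a%:R]mulrC -!(expiX (2 * pi)) expi_2pi !expr1n.
  by apply/eqP; rewrite eq_complex /= ; apply/andP; split; apply/eqP; ring.
rewrite subrX1 => /eqP; rewrite mulf_eq0 subr_eq0 (negPf w1) /= => /eqP ->.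
by rewrite mulr0.
Qed.

Let e (K : nat) (l : 'I_(2 * K + 1)) (i a : nat) : R[i] :=
  expi (2 * pi * (mode l)%:~R * (i%:R - a%:R) / (2 * K + 1)%:R : R).

Lemma dft_inversion1 K (g : nat -> R[i]) i : (0 < i <= 2 * K + 1)%N ->
  \sum_(l < 2 * K + 1) \sum_(1 <= a < (2 * K + 1).+1) g a * e l i a
  = (2 * K + 1)%:R * g i.
Proof.
move=> hi; rewrite exchange_big /=.
rewrite (eq_big_nat _ _ (F2 := fun a => if i == a then (2 * K + 1)%:R * g i else 0)); last first.
  move=> a ha; rewrite -mulr_sumr dirichlet //.
  by case: eqP => [->|]; rewrite ?mulr0 // mulrC.
rewrite -big_mkcond /= (eq_bigl (fun a => a == i)); last by move=> a; rewrite eq_sym.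
by rewrite big_nat1_eq ltnS hi.
Qed.

(* The expansion with coefficients dft_coef K L f takes the values of f at the
   nodes, i.e. it is the discrete Fourier expansion of f. *)
Lemma trig_sum_dft_coef K (L : R) (f : grid_fun R) (i j k : nat) : L != 0 ->
  (0 < i <= 2 * K + 1)%N -> (0 < j <= 2 * K + 1)%N ->
  (0 < k <= 2 * K + 1)%N ->
  trig_sum K L (dft_coef K L f) (node K L i%:Z) (node K L j%:Z)
    (node K L k%:Z) = Complex (f i%:Z j%:Z k%:Z) 0.
Proof.
move=> L0 hi hj hk; rewrite /trig_sum /dft_coef.
set N := (2 * K + 1)%N in hi hj hk *.
have N0 : (N%:R : R) != 0 by rewrite pnatr_eq0 /N addn1.
have NC0 : (N%:R : R[i]) != 0 by rewrite pnatr_eq0 /N addn1.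
transitivity (N%:R ^- 3 * (\sum_(l < N) \sum_(1 <= a < N.+1)
   (\sum_(m < N) \sum_(1 <= b < N.+1)
     (\sum_(n < N) \sum_(1 <= c < N.+1)
       Complex (f a%:Z b%:Z c%:Z) 0 * e n k c) * e m j b) * e l i a)).
  rewrite mulr_sumr; apply: eq_bigr => l _.
  transitivity (N%:R ^- 3 * \sum_(m < N) \sum_(n < N) \sum_(1 <= a < N.+1)
     \sum_(1 <= b < N.+1) \sum_(1 <= c < N.+1)
       Complex (f a%:Z b%:Z c%:Z) 0 * (e n k c * e m j b * e l i a)).
    rewrite mulr_sumr; apply: eq_bigr => m _.
    rewrite mulr_sumr; apply: eq_bigr => n _.
    rewrite -mulrA; congr (_ * _); rewrite mulr_suml; apply: eq_bigr => a _.
    rewrite mulr_suml; apply: eq_bigr => b _.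
    rewrite mulr_suml; apply: eq_bigr => c _.
    rewrite -mulrA; congr (_ * _); rewrite /wave /e expi_conj -!expiD; congr expi.
    by rewrite /node /mesh -!pmulrn; field; move: N0; rewrite L0 /N natrD natrM => ->.
  congr (_ * _).
  under eq_bigr => m _ do rewrite exchange_big /=.
  rewrite exchange_big /=; apply: eq_bigr => a _.
  rewrite mulr_suml; apply: eq_bigr => m _.
  rewrite exchange_big /= mulr_suml; apply: eq_bigr => b _.
  rewrite -mulrA mulr_suml; apply: eq_bigr => n _.
  by rewrite mulr_suml; apply: eq_bigr => c _; rewrite !mulrA.
rewrite (dft_inversion1 (fun a => \sum_(m < N) _) hi).
rewrite (dft_inversion1 (fun a => \sum_(m < N) _) hj).
rewrite (dft_inversion1 (fun a => Complex _ 0) hk).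
rewrite -/N; set F := Complex _ 0; have -> : N%:R * (N%:R * (N%:R * F)) = N%:R ^+ 3 * F by ring.
by rewrite mulKf // expf_neq0.
Qed.

End Interpolation.

(* Main.v *)
Require Import Defs.
From mathcomp Require Import all_boot all_order all_algebra.
From mathcomp Require Import all_classical all_reals all_analysis.
From mathcomp.real_closed Require Import complex.
From mathcomp Require Import ring lra zify.

Set Implicit Arguments.
Unset Strict Implicit.
Unset Printing Implicit Defensive.

Import Order.TTheory GRing.Theory Num.Theory.
Import numFieldNormedType.Exports.
Local Open Scope ring_scope.

(** The estimate is proved on the discrete Fourier side.  Let symb be the symbol
    of minus the fourth order grid Laplacian and let the weight of a frequency be
    the eighth root of 1 + symb, so that eight powers of the weight are worth two
    derivatives.  A grid function decays at rate q when the moduli of its Fourier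
    coefficients times the power q of the weight are bounded (decay).  In three
    dimensions the power - 15 of the weight is summable (weight_sum), so products
    preserve every rate q >= 15 (decay_mul).

    Stability.  Since the artificial diffusion has coefficient A >= 1 / 16, a
    modified energy does not increase, whatever the size of dt
    (modified_energy_step).  It bounds the fourth power and the gradient of the
    numerical solution by powers of 1 / eps, uniformly in time
    (energy_estimates).

    Regularity.  A single Fourier coefficient of the solution obeys a scalar
    recursion, in which the implicit linear terms contribute dt * eps * symb ^ 2
    and the nonlinearity enters as a forcing of size dt * symb / eps times its
    own coefficient.  The recursion is stable uniformly in dt and in the number
    of steps (bdf2_bound), so the solution gains a factor symb, that is eight
    powers of the weight, over its nonlinearity (decay_gain).  The energy bounds
    alone give the cube the rate 4 (decay_cube_of_energy), and iterating the gain
    reaches every rate, with a constant that is a power of 1 / eps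
    (scheme_decay_all).

    Time differences.  In terms of the increments d_n the scheme reads
    3/2 d_{n+1} - 1/2 d_n = dt * lap4 mu, which contracts by the factor 1/3
    (contraction).  Hence the increments are of order dt as soon as the potential
    mu is bounded at every rate.  The increments of mu are then of order dt as
    well, and the same contraction, applied to the difference of two consecutive
    steps, makes the second differences of order dt ^ 2.  The choice of
    phi^{-1} starts this induction: the increment phi^0 - phi^{-1} is
    dt * lap4 mu^0, with mu^0 of the same form as the later potentials
    (second_difference_decay).

    The two ends of the argument compare the grid with the continuum.
    Integration by parts gives the Fourier coefficients of a smooth initial
    datum the decay that the induction requires (decay_initial_grid), and on the
    retained modes a frequency is at most four times the fourth power of the
    weight, so a rate 4 k + 15 of the grid function bounds the norm of order k
    of its trigonometric extension (sobolev_extension). *)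

(** * Sums over one period of the grid *)

Section PeriodicSums.
Variable K : nat.
Notation N := (2 * K + 1)%N.

Definition cyclic3 (V : Type) (F : int -> int -> int -> V) : Prop :=
  forall i j k : int,
  [/\ F (i + N%:Z) j k = F i j k, F i (j + N%:Z) k = F i j k
    & F i j (k + N%:Z) = F i j k].

Variable V : zmodType.
Implicit Types (f : int -> V) (F G : int -> int -> int -> V).

Definition total F : V := \sum_(1 <= i < N.+1) \sum_(1 <= j < N.+1)
  \sum_(1 <= k < N.+1) F i%:Z j%:Z k%:Z.

Definition mode_total F : V := \sum_(l < N) \sum_(m < N) \sum_(n < N)
  F (mode l) (mode m) (mode n).

Lemma period_sum_shift f (a : int) : (forall i, f (i + N%:Z) = f i) ->
  \sum_(1 <= i < N.+1) f (i%:Z + a) = \sum_(1 <= i < N.+1) f i%:Z.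
Proof.
have step (g : int -> V) : (forall i, g (i + N%:Z) = g i) ->
    \sum_(1 <= i < N.+1) g (i%:Z + 1) = \sum_(1 <= i < N.+1) g i%:Z.
  move=> hg; rewrite [RHS]big_ltn; last by rewrite addn1.
  rewrite [X in _ = _ + X]big_add1 [LHS]big_nat_recr /=; last by rewrite addn1.
  rewrite addrC; congr (_ + _).
    by have := hg 1; rewrite addrC.
  by apply: eq_bigr => i _; rewrite -addn1 PoszD.
have up (n : nat) (u : int -> V) : (forall i, u (i + N%:Z) = u i) ->
    \sum_(1 <= i < N.+1) u (i%:Z + n%:Z) = \sum_(1 <= i < N.+1) u i%:Z.
  elim: n u => [u _|n IH u hu]; first by under eq_bigr do rewrite addr0.
  rewrite -(step u hu) -(IH (fun i => u (i + 1))); last first.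
    by move=> i; rewrite addrAC hu.
  by apply: eq_bigr => i _; rewrite -addn1 PoszD addrA.
move=> hf; case: (intP a) => [|n|n]; first by apply: (up 0%N).
  exact: up.
rewrite -(up n.+1 (fun i => f (i + - n.+1%:Z))); last first.
  by move=> i; rewrite addrAC hf.
by apply: eq_bigr => i _; rewrite addrK.
Qed.

Lemma total_shift F a b c : cyclic3 F ->
  total (fun i j k => F (i + a) (j + b) (k + c)) = total F.
Proof.
move=> hF; rewrite /total.
transitivity (\sum_(1 <= i < N.+1) \sum_(1 <= j < N.+1)
    \sum_(1 <= k < N.+1) F (i%:Z + a) j%:Z k%:Z).
  apply: eq_bigr => i _.
  rewrite -(@period_sum_shift (fun j => \sum_(1 <= k < N.+1) F (i%:Z + a) j k%:Z) b).
    apply: eq_bigr => j _; apply: (@period_sum_shift (F _ _)) => k.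
    by case: (hF (i%:Z + a) (j%:Z + b) k).
  by move=> j; apply: eq_bigr => k _; case: (hF (i%:Z + a) j k%:Z).
apply: (@period_sum_shift
  (fun i => \sum_(1 <= j < N.+1) \sum_(1 <= k < N.+1) F i j%:Z k%:Z)) => i.
by apply: eq_bigr => j _; apply: eq_bigr => k _; case: (hF i j%:Z k%:Z).
Qed.

Lemma mode_totalE F : cyclic3 F -> mode_total F = total F.
Proof.
move=> hF; rewrite -(total_shift (- K%:Z - 1) (- K%:Z - 1) (- K%:Z - 1) hF).
have e (G : int -> V) : \sum_(l < N) G (mode l) =
    \sum_(1 <= l < N.+1) G (l%:Z + (- K%:Z - 1)).
  rewrite big_add1 /= big_mkord; apply: eq_bigr => l _; congr G.
  by rewrite /mode -[l.+1]addn1 PoszD; ring.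
rewrite /mode_total /total (e (fun l => \sum_(m < N) \sum_(n < N) F l (mode m) (mode n))).
apply: eq_bigr => i _; rewrite (e (fun m => \sum_(n < N) F _ m (mode n))).
by apply: eq_bigr => j _; rewrite (e (F _ _)).
Qed.

Lemma eq_total F G : (forall i j k, F i j k = G i j k) -> total F = total G.
Proof.
by move=> h; apply: eq_bigr => i _; apply: eq_bigr => j _; apply: eq_bigr => k _.
Qed.

Lemma totalD F G :
  total (fun i j k => F i j k + G i j k) = total F + total G.
Proof.
rewrite /total -big_split; apply: eq_bigr => i _; rewrite -big_split /=.
by apply: eq_bigr => j _; rewrite -big_split.
Qed.

Lemma totalB F G :
  total (fun i j k => F i j k - G i j k) = total F - total G.
Proof.
rewrite /total -sumrB; apply: eq_bigr => i _; rewrite -sumrB /=.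
by apply: eq_bigr => j _; rewrite -sumrB.
Qed.

Lemma mode_totalD F G : mode_total (fun i j k => F i j k + G i j k) =
  mode_total F + mode_total G.
Proof.
rewrite /mode_total -big_split; apply: eq_bigr => i _; rewrite -big_split /=.
by apply: eq_bigr => j _; rewrite -big_split.
Qed.

Lemma total_sum (I : Type) (r : seq I) (F : I -> int -> int -> int -> V) :
  total (fun i j k => \sum_(l <- r) F l i j k) = \sum_(l <- r) total (F l).
Proof.
rewrite /total [RHS]exchange_big; apply: eq_bigr => i _.
rewrite [RHS]exchange_big; apply: eq_bigr => j _.
by rewrite [RHS]exchange_big.
Qed.

Lemma total_exchange (F : int -> int -> int -> int -> int -> int -> V) :
  total (fun i j k => mode_total (fun l m n => F l m n i j k)) =
  mode_total (fun l m n => total (F l m n)).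
Proof.
rewrite /mode_total total_sum; apply: eq_bigr => l _.
rewrite total_sum; apply: eq_bigr => m _.
by rewrite total_sum.
Qed.

End PeriodicSums.

Section PeriodicSumsRing.
Variables (K : nat) (A : pzRingType).
Implicit Types (F : int -> int -> int -> A).

Lemma totalZ (a : A) F : total K (fun i j k => a * F i j k) = a * total K F.
Proof.
rewrite /total mulr_sumr; apply: eq_bigr => i _; rewrite mulr_sumr.
by apply: eq_bigr => j _; rewrite mulr_sumr.
Qed.

Lemma mode_totalZ (a : A) F :
  mode_total K (fun i j k => a * F i j k) = a * mode_total K F.
Proof.
rewrite /mode_total mulr_sumr; apply: eq_bigr => i _; rewrite mulr_sumr.
by apply: eq_bigr => j _; rewrite mulr_sumr.
Qed.

End PeriodicSumsRing.

Section PeriodicSumsReal.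
Variables (K : nat) (R : realType).
Implicit Types (F G : int -> int -> int -> R).

Lemma ler_total F G : (forall i j k, F i j k <= G i j k) ->
  total K F <= total K G.
Proof.
by move=> h; apply: ler_sum => i _; apply: ler_sum => j _; apply: ler_sum => k _.
Qed.

Lemma ler_mode_total F G : (forall i j k, F i j k <= G i j k) ->
  mode_total K F <= mode_total K G.
Proof.
by move=> h; apply: ler_sum => i _; apply: ler_sum => j _; apply: ler_sum => k _.
Qed.

Lemma total_cst (c : R) : total K (fun _ _ _ => c) = (2 * K + 1)%:R ^+ 3 * c.
Proof.
rewrite /total !sumr_const_nat subn1 /= -!mulrnA -[LHS]mulr_natl !natrM.
by rewrite exprS expr2 mulrA.
Qed.

Lemma total_ge0 F : (forall i j k, 0 <= F i j k) -> 0 <= total K F.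
Proof.
move=> F0; rewrite -[leLHS](_ : total K (fun _ _ _ => 0) = 0); last first.
  by rewrite total_cst mulr0.
exact: ler_total.
Qed.

End PeriodicSumsReal.

(** * The grid Laplacian and energy stability *)

Section GridLaplacian.
Variables (R : realType) (K : nat) (L : R).
Hypothesis L_gt0 : 0 < L.
Notation h := (mesh K L).
Implicit Types (f g w : grid_fun R) (a b c : int).

Lemma mesh_gt0 : 0 < h.
Proof. by rewrite /mesh divr_gt0 // ltr0n addn1. Qed.

Definition translate a b c f : grid_fun R :=
  fun i j k => f (i + a) (j + b) (k + c).

Definition fwd_diff a b c f : grid_fun R :=
  fun i j k => (translate a b c f i j k - f i j k) / h.

Definition second_diff a b c f : grid_fun R := fun i j k =>
  (translate a b c f i j k - 2 * f i j k
   + translate (- a) (- b) (- c) f i j k) / h ^+ 2.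

Definition stencil4 a b c f : grid_fun R :=
  second_diff a b c (fun i j k => f i j k - h ^+ 2 / 12 * second_diff a b c f i j k).

Lemma lap4E f : lap4 K L f = fun i j k =>
  stencil4 1 0 0 f i j k + stencil4 0 1 0 f i j k + stencil4 0 0 1 f i j k.
Proof.
apply/funext => i; apply/funext => j; apply/funext => k.
rewrite /lap4 /long_stencil /stencil4 /second_diff /translate /D2x /D2y /D2z.
by rewrite !oppr0 !addr0.
Qed.

Lemma VperE f : Vper K f = cyclic3 K f.
Proof. by []. Qed.

Lemma Vper_translate a b c f : Vper K f -> Vper K (translate a b c f).
Proof.
rewrite !VperE => hf i j k; rewrite /translate.
have [e1 e2 e3] := hf (i + a) (j + b) (k + c).
by split; [rewrite [i + _ + a]addrAC e1|rewrite [j + _ + b]addrAC e2|rewrite [k + _ + c]addrAC e3].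
Qed.

Lemma Vper_map2 (op : R -> R -> R) f g : Vper K f -> Vper K g ->
  Vper K (fun i j k => op (f i j k) (g i j k)).
Proof.
rewrite !VperE => hf hg i j k; have [-> -> ->] := hf i j k.
by have [-> -> ->] := hg i j k.
Qed.

Lemma Vper_map (op : R -> R) f : Vper K f -> Vper K (fun i j k => op (f i j k)).
Proof. by rewrite !VperE => hf i j k; have [-> -> ->] := hf i j k. Qed.

Lemma Vper_second_diff a b c f : Vper K f -> Vper K (second_diff a b c f).
Proof.
move=> hf; apply: (Vper_map (fun x => x / h ^+ 2)).
apply: (Vper_map2 (fun x y => x + y)); last exact: Vper_translate.
apply: (Vper_map2 (fun x y => x - 2 * y)) => //; exact: Vper_translate.
Qed.

Lemma Vper_stencil4 a b c f : Vper K f -> Vper K (stencil4 a b c f).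
Proof.
move=> hf; apply: Vper_second_diff.
apply: (Vper_map2 (fun x y => x - h ^+ 2 / 12 * y)) => //.
exact: Vper_second_diff.
Qed.

Lemma Vper_lap4 f : Vper K f -> Vper K (lap4 K L f).
Proof.
move=> hf; rewrite lap4E; apply: (Vper_map2 +%R); last exact: Vper_stencil4.
by apply: (Vper_map2 +%R); apply: Vper_stencil4.
Qed.

Lemma lap4_lin f g (x y : R) i j k :
  lap4 K L (fun i j k => x * f i j k + y * g i j k) i j k
  = x * lap4 K L f i j k + y * lap4 K L g i j k.
Proof.
by rewrite !lap4E /stencil4 /second_diff /translate; ring.
Qed.

Lemma total_translate a b c f : Vper K f ->
  total K (translate a b c f) = total K f.
Proof. exact: total_shift. Qed.

(** Summation by parts: the boundary terms cancel by periodicity. *)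
Lemma total_second_diff a b c f g : Vper K f -> Vper K g ->
  total K (fun i j k => f i j k * second_diff a b c g i j k) =
  - total K (fun i j k => fwd_diff a b c f i j k * fwd_diff a b c g i j k).
Proof.
move=> hf hg.
have h0 : h != 0 by rewrite gt_eqF // mesh_gt0.
have s1 := total_translate a b c (Vper_map2 ( *%R) hf hg).
have s2 := total_translate a b c
  (Vper_map2 ( *%R) hf (Vper_translate (- a) (- b) (- c) hg)).
apply/eqP; rewrite -subr_eq0 opprK -totalD.
have -> : total K (fun i j k => f i j k * second_diff a b c g i j k
    + fwd_diff a b c f i j k * fwd_diff a b c g i j k) =
  h ^- 2 * (total K (fun i j k => f i j k * translate (- a) (- b) (- c) g i j k)
   - total K (translate a b c (fun i j k => f i j k * translate (- a) (- b) (- c) g i j k))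
   + (total K (translate a b c (fun i j k => f i j k * g i j k)) -
   total K (fun i j k => f i j k * g i j k))).
  rewrite -!totalB -totalD -totalZ; apply: eq_total => i j k.
  by rewrite /second_diff /fwd_diff /translate !addrK; field.
by rewrite s1 s2 !subrr addr0 mulr0.
Qed.

Lemma innerE f g : inner K L f g = h ^+ 3 * total K (fun i j k => f i j k * g i j k).
Proof. by []. Qed.

Definition stiff f g : R := inner K L f (fun i j k => - lap4 K L g i j k).

Definition stiff1 a b c f g : R := h ^+ 3 *
  (total K (fun i j k => fwd_diff a b c f i j k * fwd_diff a b c g i j k)
   + h ^+ 2 / 12 *
   total K (fun i j k => second_diff a b c f i j k * second_diff a b c g i j k)).

Lemma total_stencil4 a b c f g : Vper K f -> Vper K g ->
  h ^+ 3 * total K (fun i j k => f i j k * stencil4 a b c g i j k) =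
  - stiff1 a b c f g.
Proof.
move=> hf hg; rewrite /stiff1.
have hg2 := Vper_second_diff a b c hg.
rewrite /stencil4 total_second_diff //; last first.
  by apply: (Vper_map2 (fun x y => x - h ^+ 2 / 12 * y)).
rewrite -mulrN; congr (_ * _); congr (- _).
have := total_second_diff a b c hg2 hf.
have := total_second_diff a b c hf hg2.
have -> : total K (fun i j k => fwd_diff a b c (second_diff a b c g) i j k * fwd_diff a b c f i j k)
  = total K (fun i j k => fwd_diff a b c f i j k * fwd_diff a b c (second_diff a b c g) i j k).
  by apply: eq_total => i j k; rewrite mulrC.
move=> e1 e2; have e3 := etrans e2 (esym e1).
transitivity (total K (fun i j k => fwd_diff a b c f i j k * fwd_diff a b c g i j k) -
   h ^+ 2 / 12 * total K (fun i j k => fwd_diff a b c f i j k * fwd_diff a b c (second_diff a b c g) i j k)).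
  rewrite -totalZ -totalB; apply: eq_total => i j k.
  by rewrite /fwd_diff /translate; ring.
congr (_ + _); rewrite -mulrN -e2; congr (_ * _).
by apply: eq_total => i j k; rewrite mulrC.
Qed.

Lemma stiffE f g : Vper K f -> Vper K g ->
  stiff f g = stiff1 1 0 0 f g + stiff1 0 1 0 f g + stiff1 0 0 1 f g.
Proof.
move=> hf hg; have e a b c := total_stencil4 a b c hf hg.
apply: oppr_inj; rewrite !opprD -!e -!mulrDr -!totalD /stiff /inner -mulrN.
congr (_ * _).
transitivity (- total K (fun i j k => f i j k * - lap4 K L g i j k)) => //.
apply: oppr_inj; rewrite opprK.
transitivity (total K (fun i j k => -1 * (f i j k * lap4 K L g i j k))).
  by apply: eq_total => i j k; ring.
rewrite totalZ mulN1r; congr (- _); apply: eq_total => i j k.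
by rewrite lap4E !mulrDr.
Qed.

Lemma stiffC f g : Vper K f -> Vper K g -> stiff f g = stiff g f.
Proof.
move=> hf hg; rewrite !stiffE // /stiff1.
by congr (_ * (_ + _ * _) + _ * (_ + _ * _) + _ * (_ + _ * _));
   apply: eq_total => i j k; rewrite mulrC.
Qed.

Lemma inner_lap4 f g : inner K L f (lap4 K L g) = - stiff f g.
Proof.
rewrite /stiff !innerE -mulrN; congr (_ * _); rewrite -mulN1r -totalZ.
by apply: eq_total => i j k; ring.
Qed.

Lemma inner_linl f g w (x y : R) :
  inner K L (fun i j k => x * f i j k + y * g i j k) w =
  x * inner K L f w + y * inner K L g w.
Proof.
rewrite !innerE mulrCA [y * _]mulrCA -mulrDr; congr (_ * _).
rewrite -!totalZ -totalD; apply: eq_total => i j k; ring.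
Qed.

Lemma innerC f g : inner K L f g = inner K L g f.
Proof.
by rewrite !innerE; congr (_ * _); apply: eq_total => i j k; rewrite mulrC.
Qed.

Lemma stiff_linl f g w (x y : R) :
  stiff (fun i j k => x * f i j k + y * g i j k) w = x * stiff f w + y * stiff g w.
Proof. exact: inner_linl. Qed.

Lemma stiff_fwd_diff a b c f : (a, b, c) \in [:: (1, 0, 0); (0, 1, 0); (0, 0, 1)] ->
  Vper K f -> h ^+ 3 * total K (fun i j k => fwd_diff a b c f i j k ^+ 2) <= stiff f f.
Proof.
have h3 : 0 <= h ^+ 3 by rewrite exprn_ge0 // ltW // mesh_gt0.
move=> habc hf; rewrite stiffE //.
have sq0 F : 0 <= total K (fun i j k => F i j k * F i j k : R).
  by apply: total_ge0 => i j k; rewrite -expr2 sqr_ge0.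
have st a' b' c' : h ^+ 3 * total K (fun i j k => fwd_diff a' b' c' f i j k ^+ 2) <= stiff1 a' b' c' f f.
  rewrite /stiff1 ler_wpM2l //.
  rewrite -[leLHS]addr0 lerD //; last by rewrite mulr_ge0 // divr_ge0 // sqr_ge0.
have st0 a' b' c' : 0 <= stiff1 a' b' c' f f.
  by rewrite /stiff1 mulr_ge0 // addr_ge0 // mulr_ge0 // divr_ge0 // sqr_ge0.
have := st0 1 0 0; have := st0 0 1 0; have := st0 0 0 1.
move: habc; rewrite !inE => /orP[/eqP[-> -> ->]|/orP[]/eqP[-> -> ->]].
- have := st 1 0 0; lra.
- have := st 0 1 0; lra.
- have := st 0 0 1; lra.
Qed.

Lemma stiff_ge0 f : Vper K f -> 0 <= stiff f f.
Proof.
move=> hf; apply: le_trans (stiff_fwd_diff (a := 1) (b := 0) (c := 0) _ hf) => //.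
apply: mulr_ge0; first by rewrite exprn_ge0 // ltW // mesh_gt0.
by apply: total_ge0 => i j k; rewrite sqr_ge0.
Qed.

End GridLaplacian.

Section EnergyStability.
Variables (R : realType) (K : nat) (L A eps dt : R).
Hypotheses (L_gt0 : 0 < L) (A_ge : 16^-1 <= A) (eps_gt0 : 0 < eps) (dt_gt0 : 0 < dt).
Notation N := (2 * K + 1)%N.
Notation h := (mesh K L).
Notation stiff := (stiff K L).
Implicit Types (f g u v w psi : grid_fun R).

Definition sub_grid f g : grid_fun R := fun i j k => f i j k - g i j k.

Lemma Vper_sub_grid f g : Vper K f -> Vper K g -> Vper K (sub_grid f g).
Proof. exact: (Vper_map2 (fun x y => x - y)). Qed.

Definition modified_energy v w psi : R :=
  energy K L eps v + stiff psi psi / (4 * dt)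
  + norm2_sq K L (sub_grid v w) / (2 * eps).

Lemma inner_ge0 f : 0 <= inner K L f f.
Proof.
rewrite innerE; apply: mulr_ge0; first by rewrite exprn_ge0 // ltW // mesh_gt0.
by apply: total_ge0 => i j k; rewrite -expr2 sqr_ge0.
Qed.

Lemma stiff_subl f g w : stiff (sub_grid f g) w = stiff f w - stiff g w.
Proof.
rewrite -[stiff f w]mul1r -mulN1r -stiff_linl; congr stiff.
by apply/funext => i; apply/funext => j; apply/funext => k; rewrite /sub_grid; ring.
Qed.

Lemma Vper_mu_next u v w : Vper K u -> Vper K v -> Vper K w ->
  Vper K (mu_next K L A eps dt u v w).
Proof.
move=> hu hv hw.
apply: (Vper_map2 (fun x y => x - A * eps ^- 2 * dt * y)).
  apply: (Vper_map2 (fun x y => x - eps * y)); last exact: Vper_lap4.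
  apply: (Vper_map (fun x => eps^-1 * x)).
  apply: (Vper_map2 (fun x y => x + y)) => //.
  exact: (Vper_map2 (fun x y => x ^+ 3 - 2 * y)).
by apply: Vper_lap4; exact: (Vper_map2 (fun x y => x - y)).
Qed.

(** Convexity of the quartic part, treated implicitly, and extrapolation of the
    concave part: the pointwise defect is a sum of three squares. *)
Lemma inner_mu_next u v w : Vper K u -> Vper K v -> Vper K w ->
  eps^-1 * ((norm4_4 K L u - norm4_4 K L v) / 4
            - (norm2_sq K L u - norm2_sq K L v) / 2
            - norm2_sq K L (sub_grid v w) / 2)
  + eps * stiff (sub_grid u v) u
  + A * eps ^- 2 * dt * stiff (sub_grid u v) (sub_grid u v)
  <= inner K L (sub_grid u v) (mu_next K L A eps dt u v w).
Proof.
move=> hu hv hw; set d := sub_grid u v; set e := sub_grid v w.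
have h3 : 0 <= h ^+ 3 by rewrite exprn_ge0 // ltW // mesh_gt0.
have -> : inner K L d (mu_next K L A eps dt u v w) =
    eps^-1 * (h ^+ 3 * total K (fun i j k => d i j k * (u i j k ^+ 3 - 2 * v i j k + w i j k)))
    + eps * stiff d u + A * eps ^- 2 * dt * stiff d d.
  rewrite -[stiff d u]opprK -[stiff d d]opprK -!inner_lap4 !innerE.
  rewrite !mulrN !(mulrCA _ (h ^+ 3)) -!mulrBr; congr (_ * _).
  rewrite -!totalZ -!totalB; apply: eq_total => i j k.
  by rewrite /mu_next -/(sub_grid u v); ring.
rewrite !lerD2r ler_pM2l ?invr_gt0 //.
rewrite /norm4_4 /norm2_sq !innerE.
set t1 := total _ _; set t2 := total _ _; set t3 := total _ _.
set t4 := total _ _; set t5 := total _ _.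
have -> : (h ^+ 3 * t1 - h ^+ 3 * t2) / 4 - (h ^+ 3 * t3 - h ^+ 3 * t4) / 2 - h ^+ 3 * t5 / 2
  = h ^+ 3 * (4^-1 * (t1 - t2) - 2^-1 * (t3 - t4) - 2^-1 * t5) by field.
rewrite ler_wpM2l // /t1 /t2 /t3 /t4 /t5 -!totalB -!totalZ -!totalB.
apply: ler_total => i j k; rewrite /d /e /sub_grid.
set a := u i j k; set b := v i j k; set c := w i j k.
rewrite -subr_ge0.
have -> : (a - b) * (a ^+ 3 - 2 * b + c) -
    (4^-1 * (a ^+ 4 * 1 - b ^+ 4 * 1) - 2^-1 * (a * a - b * b) - 2^-1 * ((b - c) * (b - c)))
  = (a ^+ 2 - b ^+ 2) ^+ 2 / 4 + a ^+ 2 * (a - b) ^+ 2 / 2 + (a - b - (b - c)) ^+ 2 / 2 by field.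
have sq := @sqr_ge0 R.
have p x : 0 <= (x : R) -> 0 <= x / 4 /\ 0 <= x / 2 by move=> x0; split; lra.
apply: addr_ge0; first apply: addr_ge0.
- by apply p; apply: sq.
- by apply p; apply: mulr_ge0; apply: sq.
- by apply p; apply: sq.
Qed.

(** The potential psi of the time increment stands for its inverse Laplacian:
    the identity v - w = lap4 psi is propagated from one step to the next, and
    the scheme is tested with u - v.  The only bad term, coming from the
    explicit concave part, is |u - v|^2 / (2 eps); since u - v = lap4 psi', it
    is at most the geometric mean of the dissipation stiff psi' psi' / dt and
    of the artificial one, which is what A >= 1/16 is made for. *)
Lemma modified_energy_step u v w psi :
  Vper K u -> Vper K v -> Vper K w -> Vper K psi ->
  (forall i j k, v i j k - w i j k = lap4 K L psi i j k) ->
  (forall i j k, (3 / 2 * u i j k - 2 * v i j k + 1 / 2 * w i j k) / dt =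
     lap4 K L (mu_next K L A eps dt u v w) i j k) ->
  exists psi', [/\ Vper K psi',
    forall i j k, u i j k - v i j k = lap4 K L psi' i j k &
    modified_energy u v psi' <= modified_energy v w psi].
Proof.
move=> hu hv hw hpsi hd hs.
set mu := mu_next K L A eps dt u v w in hs *.
have hmu : Vper K mu by exact: Vper_mu_next.
pose psi' : grid_fun R := fun i j k => 3^-1 * psi i j k + (2 / 3 * dt) * mu i j k.
have hpsi' : Vper K psi'.
  exact: (Vper_map2 (fun x y => 3^-1 * x + (2 / 3 * dt) * y)).
have hd' i j k : u i j k - v i j k = lap4 K L psi' i j k.
  rewrite /psi' lap4_lin -hs -hd; field; exact: lt0r_neq0.
exists psi'; split => //.
set d := sub_grid u v.
have hd2 : Vper K d by exact: Vper_sub_grid.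
have e1 : d = lap4 K L psi'.
  by apply/funext => i; apply/funext => j; apply/funext => k; rewrite -hd'.
have q1 := inner_mu_next hu hv hw.
rewrite -/mu -/d in q1.
have q2 : inner K L d mu = - (3 / 2 * stiff psi' psi' - 1 / 2 * stiff psi' psi) / dt.
  rewrite e1 innerC inner_lap4 stiffC //.
  have -> : stiff psi' psi = stiff psi psi' by exact: stiffC.
  have : stiff psi' psi' = 3^-1 * stiff psi psi' + 2 / 3 * dt * stiff mu psi'.
    by rewrite -stiff_linl.
  have -> : stiff psi' mu = stiff mu psi' by exact: stiffC.
  by move=> ->; field; exact: lt0r_neq0.
clearbody psi'.
have q3 : norm2_sq K L d = - stiff psi' d.
  by rewrite /norm2_sq {2}e1 inner_lap4 stiffC.
pose z : grid_fun R := fun i j k => 1 * psi' i j k + (dt / (4 * eps)) * d i j k.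
have hz : Vper K z by exact: (Vper_map2 (fun x y => 1 * x + (dt / (4 * eps)) * y)).
have q4 : 0 <= stiff psi' psi' + dt / (2 * eps) * stiff psi' d
    + dt ^+ 2 / (16 * eps ^+ 2) * stiff d d.
  have := stiff_ge0 L_gt0 hz.
  rewrite stiff_linl (stiffC _ hpsi' hz) // (stiffC _ hd2 hz) // !stiff_linl.
  rewrite (stiffC _ hd2 hpsi') //.
  by congr (_ <= _); field; exact: lt0r_neq0.
have q5 : 0 <= stiff psi' psi' - 2 * stiff psi' psi + stiff psi psi.
  have hc := Vper_sub_grid hpsi' hpsi.
  have := stiff_ge0 L_gt0 hc.
  rewrite stiff_subl (stiffC _ hpsi' hc) // (stiffC _ hpsi hc) // !stiff_subl.
  rewrite (stiffC _ hpsi hpsi') //.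
  by congr (_ <= _); ring.
have q6 : stiff d u = (stiff u u - stiff v v) / 2 + stiff d d / 2.
  have a1 : stiff d u = stiff u u - stiff v u by exact: stiff_subl.
  have a2 : stiff d v = stiff u v - stiff v v by exact: stiff_subl.
  have a3 : stiff d d = stiff u d - stiff v d by exact: stiff_subl.
  rewrite a3 (stiffC L_gt0 hu hd2) (stiffC L_gt0 hv hd2) a1 a2.
  by rewrite (stiffC L_gt0 hv hu); field.
have q7 := stiff_ge0 L_gt0 hd2.
rewrite q6 q2 in q1.
rewrite /modified_energy /energy -/d q3.
rewrite /grad4_norm2_sq -!/(stiff _ _).
have p1 : 0 <= (stiff psi' psi' + dt / (2 * eps) * stiff psi' d
    + dt ^+ 2 / (16 * eps ^+ 2) * stiff d d) / dt by rewrite divr_ge0 // ltW.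
have p2 : 0 <= (stiff psi' psi' - 2 * stiff psi' psi + stiff psi psi) / dt.
  by rewrite divr_ge0 // ltW.
have p3 : 16^-1 * (eps ^- 2 * dt * stiff d d) <= A * (eps ^- 2 * dt * stiff d d).
  apply: ler_wpM2r => //; apply: mulr_ge0 => //; apply: mulr_ge0; last exact: ltW.
  by rewrite invr_ge0 exprn_ge0 // ltW.
have p4 : 0 <= eps / 2 * stiff d d by apply: mulr_ge0 => //; rewrite divr_ge0 // ltW.
move: q1 p1 p2 p3 p4.
set N4u := norm4_4 K L u; set N4v := norm4_4 K L v.
set N2u := norm2_sq K L u; set N2v := norm2_sq K L v; set N2w := norm2_sq K L _.
set Spp := stiff psi' psi'; set Spd := stiff psi' d; set Sdd := stiff d d.
set Sp := stiff psi' psi; set S0 := stiff psi psi; set Su := stiff u u; set Sv := stiff v v.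
have -> : eps ^- 2 = eps^-1 ^+ 2 by rewrite exprVn.
rewrite !invfM.
have -> : (Spp + dt * (2^-1 * eps^-1) * Spd + dt ^+ 2 * (16^-1 * eps^-1 ^+ 2) * Sdd) / dt =
  Spp / dt + (2^-1 * eps^-1) * Spd + dt * (16^-1 * eps^-1 ^+ 2) * Sdd.
  by field; rewrite !lt0r_neq0.
set E := eps^-1; set D := dt^-1.
lra.
Qed.

(** From the squares of f ^ 2 - 2 and of f ^ 2 - 1. *)
Lemma double_well_lower f :
  norm4_4 K L f / 8 - L ^+ 3 / 2 <= norm4_4 K L f / 4 - norm2_sq K L f / 2 /\
  - L ^+ 3 / 4 <= norm4_4 K L f / 4 - norm2_sq K L f / 2.
Proof.
have h3 : 0 <= h ^+ 3 by rewrite exprn_ge0 // ltW // mesh_gt0.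
have eL : L ^+ 3 = h ^+ 3 * total K (fun _ _ _ => 1).
  have N0 : N%:R != 0 :> R by rewrite pnatr_eq0 addn1.
  by rewrite total_cst /mesh; field.
have key (c : R) : 0 <= h ^+ 3 * total K (fun i j k => (f i j k ^+ 2 - c) ^+ 2).
  by apply: mulr_ge0 => //; apply: total_ge0 => i j k; exact: sqr_ge0.
have ex (c : R) : h ^+ 3 * total K (fun i j k => (f i j k ^+ 2 - c) ^+ 2) =
    norm4_4 K L f - 2 * c * norm2_sq K L f + c ^+ 2 * L ^+ 3.
  rewrite eL /norm4_4 /norm2_sq !innerE ![_ * (h ^+ 3 * _)]mulrCA -mulrBr -mulrDr.
  congr (_ * _); rewrite -!totalZ -totalB -totalD.
  by apply: eq_total => i j k; ring.
have := key 2; have := key 1; rewrite !ex.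
by split; lra.
Qed.

End EnergyStability.

Section EnergyArithmetic.
Variable R : realFieldType.

(** E stands for 1 / eps, W for the double well and X for the term in
    dt ^ 2 of the initial energy; the modified energy weighs X by 1 / eps, which
    the bound on W from below makes harmless. *)
Lemma initial_energy_arith (E W S Y X C Z l : R) :
  2 <= Z -> C <= Z -> 0 <= l -> l <= Z -> 1 <= E -> E <= Z -> - l / 4 <= W ->
  0 <= Y -> 0 <= S -> 0 <= X -> E * W + S + Y + X <= C ->
  E * W + S + Y + E * X <= Z ^+ 3.
Proof.
move=> Z2 CZ l0 lZ E1 EZ hW y0 s0 x0 hE.
have hEW : - (Z ^+ 2 / 4) <= E * W.
  have a1 : 0 <= E * (W + l / 4) by apply: mulr_ge0; lra.
  have a2 : E * l <= Z * Z by apply: ler_pM => //; lra.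
  lra.
have hX : X <= Z + Z ^+ 2 / 4 by lra.
have : (E - 1) * X <= (Z - 1) * (Z + Z ^+ 2 / 4) by apply: ler_pM => //; lra.
have : Z ^+ 2 <= Z ^+ 3 by rewrite ler_eXn2l //; lra.
lra.
Qed.

Lemma energy_bound_arith (Q S eps Z l : R) : 0 < eps -> eps < 1 -> 2 <= Z ->
  l <= Z -> eps^-1 <= Z -> 0 <= Q -> 0 <= S ->
  eps^-1 * (Q / 8 - l / 2) + eps / 2 * S <= Z ^+ 3 ->
  Q <= Z ^+ 7 /\ S <= Z ^+ 7.
Proof.
move=> eps_gt0 eps_lt1 Z_ge2 lZ Ze Q0 S0 hE.
have hE' : Q / 8 + eps ^+ 2 / 2 * S <= Z ^+ 3 + Z / 2.
  have a1 : Q / 8 - l / 2 + eps ^+ 2 / 2 * S <= eps * Z ^+ 3.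
    rewrite (_ : _ + _ = eps * (eps^-1 * (Q / 8 - l / 2) + eps / 2 * S)); last first.
      by field; exact: lt0r_neq0.
    by rewrite ler_pM2l.
  have a2 : eps * Z ^+ 3 <= Z ^+ 3.
    by apply: ler_piMl; [apply: exprn_ge0|]; lra.
  lra.
have Z3 : 8 <= Z ^+ 3.
  by rewrite (_ : 8 = 2 ^+ 3); [rewrite lerXn2r // nnegrE; lra | ring].
have Z6 : Z ^+ 3 * 8 <= Z ^+ 3 * Z ^+ 3 by rewrite ler_wpM2l //; lra.
have Z7 : Z * Z ^+ 3 * Z ^+ 3 = Z ^+ 7 by ring.
have Z1 : Z <= Z ^+ 3 by rewrite -[leLHS]expr1 ler_eXn2l //; lra.
have Z8 : 2 * (Z ^+ 3 * Z ^+ 3) <= Z ^+ 7.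
  by rewrite -Z7 -mulrA ler_wpM2r //; apply: mulr_ge0; lra.
have eS : 0 <= eps ^+ 2 / 2 * S by rewrite mulr_ge0 // divr_ge0 // sqr_ge0.
split; first by lra.
have hS : eps ^+ 2 * S <= 4 * Z ^+ 3 by lra.
have -> : S = eps^-1 ^+ 2 * (eps ^+ 2 * S) by field; exact: lt0r_neq0.
have ei : 0 <= eps^-1 by rewrite invr_ge0 ltW.
have : eps^-1 ^+ 2 * (eps ^+ 2 * S) <= Z ^+ 2 * (4 * Z ^+ 3).
  by apply: ler_pM => //; [exact: sqr_ge0|lra|rewrite lerXn2r // nnegrE; lra].
move/le_trans; apply.
rewrite -Z7 (_ : Z ^+ 2 * (4 * Z ^+ 3) = 4 * (Z ^+ 2 * Z ^+ 3)); last by ring.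
rewrite (_ : Z * Z ^+ 3 * Z ^+ 3 = (Z * Z) * (Z ^+ 2 * Z ^+ 3)); last by ring.
apply: ler_wpM2r; last by nra.
by rewrite mulr_ge0 // exprn_ge0 //; lra.
Qed.

End EnergyArithmetic.

Section EnergyBound.
Variables (R : realType) (K : nat) (L A eps dt C0 Z : R).
Variables (phi0 : R -> R -> R -> R) (phi : int -> grid_fun R).
Hypotheses (L_gt0 : 0 < L) (A_ge : 16^-1 <= A) (eps_gt0 : 0 < eps) (eps_lt1 : eps < 1).
Hypotheses (dt_gt0 : 0 < dt) (sol : numerical_solution K L A eps dt phi0 phi).
Hypothesis E0 : initial_energy K L eps dt (phi 0) <= C0.
Hypotheses (Z_ge2 : 2 <= Z) (Z_C0 : C0 <= Z) (Z_L : L ^+ 3 <= Z) (Z_eps : eps^-1 <= Z).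

Lemma Vper_mu_init : Vper K (mu_init K L eps (phi 0)).
Proof.
have p0 : Vper K (phi 0) := sol_periodic sol 0.
apply: (Vper_map2 (fun x y => x - eps * y)); last exact: Vper_lap4.
exact: (Vper_map (fun x => eps^-1 * (x ^+ 3 - x))).
Qed.

Lemma Vper_sol (n : nat) : Vper K (phi (n%:Z - 1)).
Proof.
case: n => [|n]; last by rewrite -addn1 PoszD addrK; exact: sol_periodic sol n.
rewrite sub0r (_ : phi (- 1) = fun i j k =>
  phi 0 i j k - dt * lap4 K L (mu_init K L eps (phi 0)) i j k); last first.
  apply/funext => i; apply/funext => j; apply/funext => k; exact: sol_ghost sol i j k.
apply: (Vper_map2 (fun x y => x - dt * y)); first exact: sol_periodic sol 0%N.
exact: Vper_lap4 Vper_mu_init.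
Qed.

(** At the first step the potential is dt times mu of the initial datum: the
    three parts of the modified energy are then those of the initial energy,
    up to the factor 1 / eps on the last one. *)
Lemma modified_energy_bound (n : nat) : exists psi, [/\ Vper K psi,
  forall i j k, phi n%:Z i j k - phi (n%:Z - 1) i j k = lap4 K L psi i j k &
  modified_energy K L eps dt (phi n%:Z) (phi (n%:Z - 1)) psi <= Z ^+ 3].
Proof.
elim: n => [|n [psi [hpsi hd hE]]]; last first.
  have hs := sol_step sol n.
  have := @modified_energy_step R K L A eps dt L_gt0 A_ge eps_gt0 dt_gt0
    (phi (n%:Z + 1)) (phi n%:Z) (phi (n%:Z - 1)) psi.
  have e1 : n%:Z + 1 = n.+1%:Z by rewrite -addn1 PoszD.
  have e2 : n.+1%:Z - 1 = n%:Z by rewrite -e1 addrK.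
  rewrite e1 e2 in hs *; case=> //.
  - exact: sol_periodic sol n.+1.
  - exact: sol_periodic sol n.
  - exact: Vper_sol.
  move=> psi' [h1 h2 h3]; exists psi'; split => //.
  exact: le_trans h3 hE.
set mu := mu_init K L eps (phi 0).
have hmu : Vper K mu by exact: Vper_mu_init.
exists (fun i j k => dt * mu i j k + 0 * mu i j k); split.
- exact: (Vper_map (fun x => dt * x + 0 * x)).
- by move=> i j k; rewrite lap4_lin mul0r addr0 sub0r (sol_ghost sol); ring.
have -> : (fun i j k => dt * mu i j k + 0 * mu i j k) = (fun i j k => dt * mu i j k).
  by apply/funext => i; apply/funext => j; apply/funext => k; rewrite mul0r addr0.
rewrite sub0r /modified_energy.
have -> : sub_grid (phi 0) (phi (-1)) = fun i j k => dt * lap4 K L mu i j k + 0 * lap4 K L mu i j k.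
  apply/funext => i; apply/funext => j; apply/funext => k.
  by rewrite /sub_grid (sol_ghost sol) -/mu; ring.
have -> : norm2_sq K L (fun i j k => dt * lap4 K L mu i j k + 0 * lap4 K L mu i j k)
    = dt ^+ 2 * norm2_sq K L (lap4 K L mu).
  by rewrite /norm2_sq inner_linl mul0r addr0 innerC inner_linl; ring.
have -> : stiff K L (fun i j k => dt * mu i j k) (fun i j k => dt * mu i j k) =
    dt ^+ 2 * grad4_norm2_sq K L mu.
  have e : (fun i j k => dt * mu i j k) = (fun i j k => dt * mu i j k + 0 * mu i j k).
    by apply/funext => i; apply/funext => j; apply/funext => k; rewrite mul0r addr0.
  have hd : Vper K (fun i j k => dt * mu i j k) by exact: (Vper_map (fun x => dt * x)).
  by rewrite {1}e stiff_linl stiffC // e stiff_linl /stiff /grad4_norm2_sq; ring.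
have := E0; rewrite /initial_energy -/mu.
have [_] := double_well_lower K L_gt0 (phi 0).
rewrite /energy.
have p0 : Vper K (phi 0) := sol_periodic sol 0.
have g0 : 0 <= grad4_norm2_sq K L (phi 0) := stiff_ge0 L_gt0 p0.
have g1 : 0 <= grad4_norm2_sq K L mu := stiff_ge0 L_gt0 hmu.
have g2 : 0 <= norm2_sq K L (lap4 K L mu) by exact: inner_ge0.
set W := _ / 4 - _ / 2.
have -> : dt ^+ 2 * grad4_norm2_sq K L mu / (4 * dt) = dt / 4 * grad4_norm2_sq K L mu.
  by field; exact: lt0r_neq0.
have -> : dt ^+ 2 * norm2_sq K L (lap4 K L mu) / (2 * eps) =
   eps^-1 * (dt ^+ 2 / 2 * norm2_sq K L (lap4 K L mu)) by field; exact: lt0r_neq0.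
have y0 : 0 <= dt / 4 * grad4_norm2_sq K L mu by apply: mulr_ge0 => //; rewrite divr_ge0 // ltW.
have x0 : 0 <= dt ^+ 2 / 2 * norm2_sq K L (lap4 K L mu).
  by apply: mulr_ge0 => //; rewrite divr_ge0 // sqr_ge0.
have s0 : 0 <= eps / 2 * grad4_norm2_sq K L (phi 0).
  by apply: mulr_ge0 => //; rewrite divr_ge0 // ltW.
move=> hW hE; apply: (initial_energy_arith (C := C0) (l := L ^+ 3)) => //.
- by rewrite exprn_ge0 // ltW.
- by rewrite invf_ge1 // ltW.
Qed.

Lemma energy_estimates (n : nat) :
  norm4_4 K L (phi n%:Z) <= Z ^+ 7 /\ stiff K L (phi n%:Z) (phi n%:Z) <= Z ^+ 7.
Proof.
have [psi [hpsi hd]] := modified_energy_bound n; rewrite /modified_energy /energy.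
have g0 : 0 <= stiff K L (phi n%:Z) (phi n%:Z).
  exact: (stiff_ge0 (f := phi n%:Z) L_gt0 (sol_periodic sol n)).
have t1 : 0 <= stiff K L psi psi / (4 * dt).
  by rewrite divr_ge0 ?stiff_ge0 // mulr_ge0 // ltW.
have t2 : 0 <= norm2_sq K L (sub_grid (phi n%:Z) (phi (n%:Z - 1))) / (2 * eps).
  by rewrite divr_ge0 ?inner_ge0 // mulr_ge0 // ltW.
have n4 : 0 <= norm4_4 K L (phi n%:Z).
  rewrite /norm4_4 innerE; apply: mulr_ge0; first by rewrite exprn_ge0 // ltW // mesh_gt0.
  by apply: total_ge0 => i j k; rewrite mulr1 -[4%N]/(2 * 2)%N exprM sqr_ge0.
have [] := double_well_lower K L_gt0 (phi n%:Z).
rewrite /grad4_norm2_sq -/(stiff K L _ _).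
move=> w1 w2 hE; apply: (energy_bound_arith (eps := eps) (l := L ^+ 3)) => //.
apply: le_trans hE; rewrite -[leLHS]addr0; apply: lerD => //.
rewrite -[leLHS]addr0; apply: lerD => //; rewrite lerD2r.
by rewrite ler_pM2l ?invr_gt0.
Qed.

End EnergyBound.

(** * The symbol of the grid Laplacian and the Fourier weight *)

Section TrigBounds.
Variable R : realType.
Implicit Types x y : R.

Lemma sin_mvt x : 0 < x -> exists2 c, 0 < c < x & sin x = cos c * x.
Proof.
move=> x0.
have cs : {within `[0, x], continuous (@sin R)}%classic.
  by apply: continuous_subspaceT => y; exact: continuous_sin.
have [c] := MVT x0 (fun y _ => is_derive_sin y) cs.
by rewrite in_itv /= sin0 !subr0 => hc e; exists c.
Qed.

Lemma sqr_sin_le x : sin x ^+ 2 <= x ^+ 2.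
Proof.
wlog x0 : x / 0 < x.
  move=> hw; have [x0|x0|->] := ltgtP x 0; last by rewrite sin0.
    by have := hw (- x); rewrite sinN !sqrrN oppr_gt0; apply.
  exact: hw.
have [c _ ->] := sin_mvt x0; rewrite exprMn; apply: ler_piMl; first exact: sqr_ge0.
by rewrite cos2sin2 gerBl sqr_ge0.
Qed.

(** With y = x / 2, sin x = 2 sin y cos y >= 2 y cos y ^ 2 = y (1 + cos x). *)
Lemma sin_ge_half x : 0 <= x -> x <= pi / 2 -> x / 2 <= sin x.
Proof.
rewrite le_eqVlt => /orP[/eqP <-|x0 xpi]; first by rewrite mul0r sin0.
have pi0 := pi_gt0 R.
set y := x / 2; have xy : x = y *+ 2 by rewrite /y -mulr_natr; field.
have y0 : 0 < y by rewrite divr_gt0.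
have [c /andP[c0 cy] hc] := sin_mvt y0.
have cosy : cos y <= cos c.
  by apply: ltW; rewrite ltr_cos // in_itv /=; apply/andP; split; rewrite /y in y0 cy *; lra.
have cosy0 : 0 <= cos y.
  by apply: cos_ge0_pihalf; rewrite /y; apply/andP; split; lra.
have cosx0 : 0 <= cos x by apply: cos_ge0_pihalf; apply/andP; split; lra.
have e : cos y ^+ 2 *+ 2 = 1 + cos x by rewrite xy cos_mulr2n; ring.
rewrite xy sin_mulr2n hc.
have h1 : y <= y * (1 + cos x) by apply: ler_peMr; [exact: ltW|rewrite lerDl].
have : cos y * (cos y * y) <= cos y * (cos c * y).
  by rewrite ler_wpM2l // ler_wpM2r // ltW.
by move: h1; rewrite -e !mulr2n => h1 h2; lra.
Qed.

Lemma two_sub_cos x : 2 - 2 * cos x = 4 * sin (x / 2) ^+ 2.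
Proof.
rewrite [in cos _](_ : x = (x / 2) *+ 2); last by rewrite -mulr_natr; field.
by rewrite cos_mulr2n cos2sin2; ring.
Qed.

Lemma two_sub_cos_le x : 2 - 2 * cos x <= x ^+ 2.
Proof.
rewrite two_sub_cos; have := sqr_sin_le (x / 2).
by rewrite exprMn exprVn; lra.
Qed.

Lemma two_sub_cos_ge x : `|x| <= pi -> x ^+ 2 / 4 <= 2 - 2 * cos x.
Proof.
wlog x0 : x / 0 <= x.
  move=> hw; have [x0|x0] := leP 0 x; first exact: hw.
  by have := hw (- x); rewrite cosN sqrrN normrN; apply; lra.
rewrite ger0_norm // => xpi; rewrite two_sub_cos.
have : x / 2 / 2 <= sin (x / 2) by apply: sin_ge_half; lra.
nra.
Qed.

(** For z = e^{ix} and w = e^{iy} this is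
    |1 - z w|^2 <= 2 |1 - z|^2 + 2 |1 - w|^2; by the parallelogram law for
    1 - w and w (1 - z) the defect is |1 - 2 w + z w|^2. *)
Lemma two_sub_cosD x y :
  2 - 2 * cos (x + y) <= 2 * (2 - 2 * cos x + (2 - 2 * cos y)).
Proof.
rewrite cosD.
have := cos2Dsin2 x; have := cos2Dsin2 y.
set c := cos x; set s := sin x; set c' := cos y; set s' := sin y => h' h.
have -> : 2 * (2 - 2 * c + (2 - 2 * c')) = 2 - 2 * (c * c' - s * s') +
   ((c * c' - s * s' - 2 * c' + 1) ^+ 2 + (s * c' + c * s' - 2 * s') ^+ 2).
  have hh : (c * c' - s * s' - 2 * c' + 1) ^+ 2 + (s * c' + c * s' - 2 * s') ^+ 2
    = (c ^+ 2 + s ^+ 2) * (c' ^+ 2 + s' ^+ 2) + 4 * (c' ^+ 2 + s' ^+ 2) + 1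
      - 4 * c * (c' ^+ 2 + s' ^+ 2) + 2 * (c * c' - s * s') - 4 * c' by ring.
  by rewrite hh h h'; ring.
by rewrite lerDl addr_ge0 ?sqr_ge0.
Qed.

End TrigBounds.

Section Weight.
Variables (R : realType) (K : nat) (L : R).
Hypothesis L_gt0 : 0 < L.
Notation N := (2 * K + 1)%N.
Notation h := (mesh K L).

(** Symbol of minus the second difference: for the frequency l it is
    4 sin(pi l / N) ^ 2 / h ^ 2. *)
Definition mu1 (l : int) : R := (2 - 2 * cos (2 * pi * l%:~R / N%:R)) / h ^+ 2.

Definition sym1 (l : int) : R := mu1 l + h ^+ 2 / 12 * mu1 l ^+ 2.

Definition symb (l m n : int) : R := sym1 l + sym1 m + sym1 n.

(** The symbol is N-periodic like the moduli of the discrete Fourier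
    coefficients, which makes it a better weight than a power of the frequency:
    no representative modulo N has to be chosen for the frequencies of a
    product.  The eighth
    root is taken because all decay rates of the proof are then integers. *)
Definition weight (l m n : int) : R :=
  Num.sqrt (Num.sqrt (Num.sqrt (1 + symb l m n))).

Let N0 : N%:R != 0 :> R. Proof. by rewrite pnatr_eq0 addn1. Qed.
Let Np : 0 < N%:R :> R. Proof. by rewrite ltr0n addn1. Qed.
Let hp : 0 < h. Proof. by rewrite /mesh divr_gt0. Qed.

Lemma mu1_ge0 l : 0 <= mu1 l.
Proof. by rewrite /mu1 divr_ge0 ?sqr_ge0 // two_sub_cos mulr_ge0 ?sqr_ge0. Qed.

Lemma mu1_periodic l : mu1 (l + N%:Z) = mu1 l.
Proof.
rewrite /mu1; congr ((_ - _ * _) / _).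
rewrite (_ : 2 * pi * (l + N%:Z)%:~R / N%:R = 2 * pi * l%:~R / N%:R + pi *+ 2).
  exact: cosD2pi.
by rewrite intrD -pmulrn -mulr_natr; field.
Qed.

Lemma mu1N l : mu1 (- l) = mu1 l.
Proof. by rewrite /mu1 intrN mulrN mulNr cosN. Qed.

Lemma mu1D l m : mu1 (l + m) <= 2 * (mu1 l + mu1 m).
Proof.
rewrite /mu1 -mulrDl mulrA ler_pM2r ?invr_gt0 ?exprn_gt0 //.
rewrite (_ : 2 * pi * (l + m)%:~R / N%:R = 2 * pi * l%:~R / N%:R + 2 * pi * m%:~R / N%:R).
  exact: two_sub_cosD.
by rewrite intrD; ring.
Qed.

Lemma mu1_bound l : h ^+ 2 / 12 * mu1 l <= 3^-1.
Proof.
rewrite /mu1 (_ : _ / 12 * _ = (2 - 2 * cos (2 * pi * l%:~R / N%:R)) / 12).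
  by have := cos_geN1 (2 * pi * l%:~R / N%:R : R); lra.
by field; exact: lt0r_neq0.
Qed.

Lemma sym1_ge l : mu1 l <= sym1 l.
Proof. by rewrite /sym1 lerDl mulr_ge0 ?sqr_ge0 // divr_ge0 // sqr_ge0. Qed.

Lemma sym1_le l : sym1 l <= 4 / 3 * mu1 l.
Proof.
rewrite /sym1 expr2 mulrA.
have := ler_wpM2r (mu1_ge0 l) (mu1_bound l); lra.
Qed.

Lemma sym1_ge0 l : 0 <= sym1 l.
Proof. exact: le_trans (mu1_ge0 l) (sym1_ge l). Qed.

Lemma sym1D l m : sym1 (l + m) <= 4 * (sym1 l + sym1 m).
Proof.
have := sym1_le (l + m); have := mu1D l m; have := sym1_ge l; have := sym1_ge m.
have := sym1_ge0 l; have := sym1_ge0 m; lra.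
Qed.

Lemma symb_ge0 l m n : 0 <= symb l m n.
Proof. by apply: addr_ge0; [apply: addr_ge0|]; exact: sym1_ge0. Qed.

Lemma weight8 l m n : weight l m n ^+ 8 = 1 + symb l m n.
Proof.
have s0 := symb_ge0 l m n.
rewrite (_ : 8%N = (2 * (2 * 2))%N) // !exprM /weight !sqr_sqrtr ?sqrtr_ge0 //.
exact: addr_ge0.
Qed.

Lemma weight_ge1 l m n : 1 <= weight l m n.
Proof.
have w0 : 0 <= weight l m n by rewrite sqrtr_ge0.
rewrite -(@ler_pXn2r _ 8) ?nnegrE // expr1n weight8 lerDl; exact: symb_ge0.
Qed.

Lemma weight_gt0 l m n : 0 < weight l m n.
Proof. exact: lt_le_trans ltr01 (weight_ge1 l m n). Qed.

Lemma weight_periodic : cyclic3 K weight.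
Proof. by move=> l m n; rewrite /weight /symb /sym1 !mu1_periodic. Qed.

Lemma weightN l m n : weight (- l) (- m) (- n) = weight l m n.
Proof. by rewrite /weight /symb /sym1 !mu1N. Qed.

Lemma weightD l m n l' m' n' : weight (l + l') (m + m') (n + n') <=
  2 * Num.max (weight l m n) (weight l' m' n').
Proof.
set a := weight l m n; set b := weight l' m' n'.
wlog ab : l m n l' m' n' @a @b / b <= a.
  move=> hw; have /orP[ba|ab] := le_total b a; first by have := hw l m n l' m' n' ba.
  by have := hw l' m' n' l m n ab; rewrite maxC (addrC l') (addrC m') (addrC n').
rewrite max_l // -(@ler_pXn2r _ 8) ?nnegrE //; last 2 first.
- exact: ltW (weight_gt0 _ _ _).
- by rewrite mulr_ge0 // ltW // weight_gt0.
have : b ^+ 8 <= a ^+ 8 by rewrite ler_pXn2r ?nnegrE // ltW // weight_gt0.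
rewrite exprMn !weight8 /symb.
have := sym1D l l'; have := sym1D m m'; have := sym1D n n'.
have := sym1_ge0 l; have := sym1_ge0 m; have := sym1_ge0 n.
rewrite (_ : 2 ^+ 8 = 256); last by ring.
lra.
Qed.

Lemma symb_le_weight l m n : symb l m n <= weight l m n ^+ 8.
Proof. by rewrite weight8 lerDr. Qed.

End Weight.

Section OneDimensional.
Variables (R : realType) (K : nat).
Notation N := (2 * K + 1)%N.

Definition root4 (j : nat) : R := Num.sqrt (Num.sqrt (1 + j%:R)).

Lemma root4_X4 j : root4 j ^+ 4 = 1 + j%:R.
Proof. by rewrite (_ : 4%N = (2 * 2)%N) // exprM /root4 !sqr_sqrtr ?sqrtr_ge0. Qed.

Lemma root4_gt0 j : 0 < root4 j.
Proof. by rewrite /root4 !sqrtr_gt0 ltr_pwDl. Qed.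

Lemma root4_le j : root4 j <= root4 j.+1.
Proof.
rewrite -(@ler_pXn2r _ 4) ?nnegrE ?(ltW (root4_gt0 _)) //.
by rewrite !root4_X4 lerD2l ler_nat.
Qed.

(** The convergent series with general term (1 + j) ^ (- 5 / 4), summed by
    telescoping the differences of (1 + j) ^ (- 1 / 4). *)
Lemma root4_sum n : \sum_(0 <= j < n.+1) (root4 j) ^- 5 <= 5 - 4 / root4 n.
Proof.
elim: n => [|n IH].
  by rewrite big_nat1 /root4 addr0 !sqrtr1 expr1n invr1; lra.
rewrite big_nat_recr //=; set S := \sum_(_ <= _ < _) _ in IH *.
have a0 := root4_gt0 n; have b0 := root4_gt0 n.+1; have ab := root4_le n.
have : root4 n.+1 ^+ 4 - root4 n ^+ 4 = 1 by rewrite !root4_X4 -natr1; ring.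
move: a0 b0 ab IH; move: (root4 n) (root4 n.+1) => a b a0 b0 ab IH e.
suff : b ^- 5 <= 4 / a - 4 / b by lra.
have -> : 4 / a - 4 / b = 4 * (b - a) * b ^+ 4 / a * b ^- 5.
  by field; rewrite !lt0r_neq0.
rewrite ler_peMl ?invr_ge0 ?exprn_ge0 ?(ltW b0) // ler_pdivlMr // mul1r.
have h1 : 1 <= (b - a) * (4 * b ^+ 3).
  rewrite [leLHS](_ : 1 = (b - a) * (b ^+ 3 + b ^+ 2 * a + b * a ^+ 2 + a ^+ 3)); last first.
    by rewrite -[LHS]e; ring.
  apply: ler_wpM2l; first by lra.
  have h2 : b ^+ 2 * a <= b ^+ 3 by rewrite [leRHS]exprSr ler_wpM2l // exprn_ge0 // ltW.
  have h3 : b * a ^+ 2 <= b ^+ 3.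
    by rewrite [leRHS]exprS ler_wpM2l ?(ltW b0) // lerXn2r // nnegrE ltW.
  have h4 : a ^+ 3 <= b ^+ 3 by rewrite lerXn2r // nnegrE ltW.
  lra.
have -> : 4 * (b - a) * b ^+ 4 = ((b - a) * (4 * b ^+ 3)) * b by ring.
by apply: (le_trans ab); rewrite ler_peMl // ltW.
Qed.

Lemma mode_sum_abs (g : nat -> R) : (forall j, 0 <= g j) ->
  \sum_(l < N) g `|mode l|%N <= 2 * \sum_(0 <= j < K.+1) g j.
Proof.
move=> g0; rewrite -(big_mkord xpredT (fun l => g `|l%:Z - K%:Z|%N)).
rewrite (@big_cat_nat _ _ _ K) //=; last by rewrite mul2n -addnn -addnA leq_addr.
rewrite mulr_natl mulr2n; apply: lerD.
  rewrite big_nat_rev /= big_nat_recl //= ler_wpDl //.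
  rewrite le_eqVlt; apply/orP; left; apply/eqP; apply: eq_big_nat => j /andP[_ jK].
  by congr g; rewrite add0n distnC; lia.
rewrite -{1}[K]add0n big_addn.
have -> : (N - K = K.+1)%N by lia.
rewrite le_eqVlt; apply/orP; left; apply/eqP; apply: eq_big_nat => j _.
by congr g; rewrite PoszD addrK.
Qed.

Variable L : R.
Hypothesis L_gt0 : 0 < L.

Let N0 : N%:R != 0 :> R. Proof. by rewrite pnatr_eq0 addn1. Qed.
Let Np : 0 < N%:R :> R. Proof. by rewrite ltr0n addn1. Qed.

Lemma mu1_mode_ge (l : 'I_N) : 4 / L ^+ 2 * (mode l)%:~R ^+ 2 <= mu1 K L (mode l).
Proof.
have pi0 := pi_gt0 R; have pi2 := pi_ge2 R.
set x := (mode l)%:~R : R.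
have hx : `|x| <= K%:R.
  have : (l <= 2 * K)%N by have := ltn_ord l; lia.
  rewrite -(ler_nat R) natrM /x /mode intrB -!pmulrn ler_norml => h1.
  have h0 : (0 : R) <= l%:R by [].
  by apply/andP; split; lra.
have hN : N%:R = 2 * K%:R + 1 :> R by rewrite natrD natrM.
have hth : `|2 * pi * x / N%:R| <= pi.
  rewrite !normrM normfV (ger0_norm (ltW Np)) ler_pdivrMr //.
  rewrite (ger0_norm (ltW pi0)) (@ger0_norm _ 2) //.
  rewrite [2 * _]mulrC -mulrA ler_pM2l // hN; lra.
have := two_sub_cos_ge hth; rewrite /mu1 -/x => h1.
rewrite ler_pdivlMr; last by rewrite exprn_gt0 // divr_gt0.
apply: le_trans h1.
have -> : (2 * pi * x / N%:R) ^+ 2 / 4 = (x / N%:R) ^+ 2 * pi ^+ 2 by field.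
have -> : 4 / L ^+ 2 * x ^+ 2 * mesh K L ^+ 2 = (x / N%:R) ^+ 2 * 2 ^+ 2.
  have := N0; rewrite /mesh; move: (N%:R) => q q0; field.
  by rewrite q0 lt0r_neq0.
by rewrite ler_wpM2l ?sqr_ge0 // lerXn2r // nnegrE ltW.
Qed.

End OneDimensional.

Section WeightSum.
Variables (R : realType) (K : nat) (L Z : R).
Hypotheses (L_gt0 : 0 < L) (Z_ge2 : 2 <= Z) (Z_L2 : L ^+ 2 <= 2 * Z).
Notation N := (2 * K + 1)%N.
Notation weight := (weight K L).
Notation root4 := (root4 R).

(** The factor Z absorbs the dependence on L of the ratio between the symbol
    and the square of the frequency. *)
Lemma weight_mode_ge (l m n : 'I_N) (i : 'I_N) : i \in [:: l; m; n] ->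
  root4 `|mode i|%N / Z <= weight (mode l) (mode m) (mode n).
Proof.
move=> hi; have Z2 := Z_ge2; have ZL := Z_L2; have Z0 : 0 < Z by lra.
rewrite -(@ler_pXn2r _ 8) ?nnegrE //; last 2 first.
- by rewrite divr_ge0 ?ltW ?root4_gt0.
- exact: ltW (weight_gt0 _ _ _ _ _).
rewrite weight8 // exprMn (_ : 8%N = (4 * 2)%N) // exprM root4_X4 exprVn.
rewrite ler_pdivrMr ?exprn_gt0 //.
set x := (`|mode i|%N)%:R : R.
have hs : 4 / L ^+ 2 * x ^+ 2 <= symb K L (mode l) (mode m) (mode n).
  have -> : x ^+ 2 = (mode i)%:~R ^+ 2.
    by rewrite /x natr_absz intr_norm real_normK ?num_real.
  apply: le_trans (mu1_mode_ge L_gt0 i) _.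
  apply: le_trans (sym1_ge K L (mode i)) _ => //.
  have p j : 0 <= sym1 K L j by exact: sym1_ge0.
  rewrite /symb; move: hi; rewrite !inE => /orP[/eqP ->|/orP[]/eqP ->].
  - by rewrite -addrA lerDl addr_ge0.
  - by rewrite addrAC lerDr addr_ge0.
  - by rewrite lerDr addr_ge0.
have hL : 2 / Z <= 4 / L ^+ 2.
  rewrite ler_pdivrMr // mulrAC ler_pdivlMr ?exprn_gt0 //; lra.
have x0 : 0 <= x by [].
have Z8 : Z * Z <= Z ^+ 8.
  rewrite (_ : Z * Z = Z ^+ 2) // ler_eXn2l //; lra.
have : (1 + x) ^+ 2 <= 2 * (1 + x ^+ 2) by have := sqr_ge0 (x - 1); lra.
move/le_trans; apply.
have hsum : 1 + 2 / Z * x ^+ 2 <= 1 + symb K L (mode l) (mode m) (mode n).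
  by rewrite lerD2l; apply: le_trans hs; rewrite ler_wpM2r ?sqr_ge0.
apply: le_trans (_ : (1 + 2 / Z * x ^+ 2) * Z ^+ 8 <= _); last first.
  by rewrite ler_pM2r ?exprn_gt0.
have h2 : 2 / Z <= 1 by rewrite ler_pdivrMr // mul1r.
apply: le_trans (_ : 2 / Z * (1 + x ^+ 2) * (Z * Z) <= _).
  have -> : 2 / Z * (1 + x ^+ 2) * (Z * Z) = 2 * (1 + x ^+ 2) * Z by field; exact: lt0r_neq0.
  rewrite ler_peMr //; last by lra.
  by rewrite mulr_ge0 // addr_ge0 // sqr_ge0.
have p0 : 0 <= 2 / Z by rewrite divr_ge0 // ltW.
apply: ler_pM => //.
- by rewrite mulr_ge0 // addr_ge0 // sqr_ge0.
- by rewrite mulr_ge0 // ltW.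
- by have := sqr_ge0 x; nra.
Qed.

(** Each of the three directions receives five of the fifteen powers, which by
    weight_mode_ge are worth (1 + |l|) ^ (- 5 / 4). *)
Lemma weight_sum : mode_total K (fun l m n => (weight l m n) ^- 15) <= Z ^+ 25.
Proof.
have Z2 := Z_ge2; have ZL := Z_L2; have Z0 : 0 < Z by lra.
pose g (j : nat) : R := (root4 j) ^- 5.
have g0 j : 0 <= g j by rewrite invr_ge0 exprn_ge0 // ltW // root4_gt0.
have hg : \sum_(l < N) g `|mode l|%N <= 10.
  apply: le_trans (mode_sum_abs K g0) _.
  have := root4_sum R K; have r0 := root4_gt0 R K.
  have : 0 < 4 / root4 K by rewrite divr_gt0.
  by rewrite /g; lra.
have gs0 : 0 <= \sum_(l < N) g `|mode l|%N by exact: sumr_ge0.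
apply: (@le_trans _ _ (Z ^+ 15 * (\sum_(l < N) g `|mode l|%N) ^+ 3)); last first.
  have h10 : (\sum_(l < N) g `|mode l|%N) ^+ 3 <= 10 ^+ 3.
    by rewrite lerXn2r // nnegrE.
  have h3 : 10 ^+ 3 <= Z ^+ 10.
    apply: (@le_trans _ _ (2 ^+ 10)); first by rewrite -!natrX ler_nat.
    by rewrite lerXn2r // nnegrE; lra.
  rewrite (_ : Z ^+ 25 = Z ^+ 15 * Z ^+ 10); last by rewrite -exprD.
  by rewrite ler_wpM2l ?exprn_ge0 ?(ltW Z0) // (le_trans h10).
set S := \sum_(l < N) _.
have -> : Z ^+ 15 * S ^+ 3 = \sum_(l < N) \sum_(m < N) \sum_(n < N)
    Z ^+ 15 * (g `|mode l|%N * (g `|mode m|%N * g `|mode n|%N)).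
  under [RHS]eq_bigr => l _ do under eq_bigr => m _ do rewrite -!mulr_sumr.
  under [RHS]eq_bigr => l _ do rewrite -!mulr_sumr -mulr_suml.
  by rewrite -mulr_sumr -mulr_suml -/S; ring.
apply: ler_sum => l _; apply: ler_sum => m _; apply: ler_sum => n _.
have hl := @weight_mode_ge l m n l; have hm := @weight_mode_ge l m n m.
have hn := @weight_mode_ge l m n n.
rewrite !inE !eqxx ?orbT in hl hm hn.
have := hl isT; have := hm isT; have := hn isT; set w := weight _ _ _.
have pw : 0 < w by exact: weight_gt0.
have := root4_gt0 R `|mode l|%N; have := root4_gt0 R `|mode m|%N.
have := root4_gt0 R `|mode n|%N; rewrite /g.
move: (root4 _) (root4 _) (root4 _) => a b c c0 b0 a0 cw bw aw.
have p5 x : 0 < x -> x / Z <= w -> 0 < (x / Z) ^+ 5 /\ (x / Z) ^+ 5 <= w ^+ 5.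
  move=> x0 xw; have xZ : 0 < x / Z by rewrite divr_gt0.
  by split; [rewrite exprn_gt0|rewrite lerXn2r // nnegrE ltW].
have [a5 aw5] := p5 a a0 aw; have [b5 bw5] := p5 b b0 bw; have [c5 cw5] := p5 c c0 cw.
have -> : Z ^+ 15 * (a ^- 5 * (b ^- 5 * c ^- 5)) =
    ((a / Z) ^+ 5 * (b / Z) ^+ 5 * (c / Z) ^+ 5)^-1.
  by field; rewrite !lt0r_neq0.
rewrite lef_pV2 ?posrE ?exprn_gt0 ?mulr_gt0 ?invr_gt0 //.
rewrite (_ : w ^+ 15 = w ^+ 5 * w ^+ 5 * w ^+ 5); last by rewrite -!exprD.
have ab := ler_pM (ltW a5) (ltW b5) aw5 bw5.
exact: (ler_pM (mulr_ge0 (ltW a5) (ltW b5)) (ltW c5) ab cw5).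
Qed.

End WeightSum.

(** * Discrete Fourier coefficients *)

Section ComplexNorm.
Variable R : realType.
Implicit Types (z : R[i]) (x : R).
Notation normc := (@Normc.normc R).

Lemma normcE z : normc z = Num.sqrt (complex.Re z ^+ 2 + complex.Im z ^+ 2).
Proof. by case: z. Qed.

Lemma normc_sqr z : normc z ^+ 2 = complex.Re z ^+ 2 + complex.Im z ^+ 2.
Proof. by rewrite normcE sqr_sqrtr // addr_ge0 // sqr_ge0. Qed.

Lemma normc_ge0 z : 0 <= normc z.
Proof. by rewrite normcE sqrtr_ge0. Qed.

Lemma normc_conj z : normc z^*%C = normc z.
Proof. by case: z => a b; rewrite !normcE /= sqrrN. Qed.

Lemma normc_real x : normc (Complex x 0) = `|x|.
Proof. by rewrite normcE /= expr0n addr0 sqrtr_sqr. Qed.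

Lemma normc_expi x : normc (expi x) = 1.
Proof. by rewrite normcE /= cos2Dsin2 sqrtr1. Qed.

Lemma normr_Re_le z : `|complex.Re z| <= normc z.
Proof. by rewrite normcE -sqrtr_sqr ler_wsqrtr // lerDl sqr_ge0. Qed.

Lemma normr_Im_le z : `|complex.Im z| <= normc z.
Proof. by rewrite normcE -sqrtr_sqr ler_wsqrtr // lerDr sqr_ge0. Qed.

Lemma normc_le_ReIm z : normc z <= `|complex.Re z| + `|complex.Im z|.
Proof.
rewrite -(@ler_pXn2r _ 2) ?nnegrE ?normc_ge0 ?addr_ge0 // normc_sqr.
rewrite sqrrD !real_normK ?num_real // addrAC lerDl.
by rewrite mulrn_wge0 // mulr_ge0.
Qed.

Lemma ler_normc_sum (I : Type) (r : seq I) (P : pred I) (F : I -> R[i]) :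
  normc (\sum_(i <- r | P i) F i) <= \sum_(i <- r | P i) normc (F i).
Proof.
elim/big_ind2: _ => //; first by rewrite Normc.normc0.
by move=> x1 x2 y1 y2 h1 h2; apply: le_trans (le_normcD _ _) (lerD h1 h2).
Qed.

Lemma ler_normc_total K (F : int -> int -> int -> R[i]) :
  normc (total K F) <= total K (fun i j k => normc (F i j k)).
Proof.
apply: le_trans (ler_normc_sum _ _ _) _; apply: ler_sum => i _.
apply: le_trans (ler_normc_sum _ _ _) _; apply: ler_sum => j _.
exact: ler_normc_sum.
Qed.

Lemma ler_normc_mode_total K (F : int -> int -> int -> R[i]) :
  normc (mode_total K F) <= mode_total K (fun i j k => normc (F i j k)).
Proof.
apply: le_trans (ler_normc_sum _ _ _) _; apply: ler_sum => i _.
apply: le_trans (ler_normc_sum _ _ _) _; apply: ler_sum => j _.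
exact: ler_normc_sum.
Qed.

Lemma expi_sym x : expi x + expi (- x) = Complex (2 * cos x) 0.
Proof.
by rewrite /expi cosN sinN; apply/eqP; rewrite eq_complex /=; apply/andP; split; apply/eqP; ring.
Qed.

Lemma expi_2piz (q : int) : expi (2 * pi * q%:~R : R) = 1.
Proof.
case: (intP q) => [|n|n]; first by rewrite mulr0 expi0.
  by rewrite mulrC -expiX expi_2pi expr1n.
by rewrite intrN mulrN -expi_conj mulrC -expiX expi_2pi expr1n conjc1.
Qed.

End ComplexNorm.

Section DFT.
Variables (R : realType) (K : nat) (L : R).
Hypothesis L_gt0 : 0 < L.
Notation N := (2 * K + 1)%N.
Notation h := (mesh K L).
Notation normc := (@Normc.normc R).
Notation dft := (dft_coef K L).
Implicit Types (f g : grid_fun R) (l m n a b c : int) (x y : R).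

Let N0 : N%:R != 0 :> R. Proof. by rewrite pnatr_eq0 addn1. Qed.

Definition gwave l m n : int -> int -> int -> R[i] := fun i j k =>
  (wave L l m n (node K L i) (node K L j) (node K L k))^*%C.

Definition angle (q : int) : R := 2 * pi * q%:~R / N%:R.

Lemma gwave_shift l m n a b c i j k : gwave l m n (i + a) (j + b) (k + c) =
  expi (- angle (l * a + m * b + n * c)) * gwave l m n i j k.
Proof.
have L0 : L != 0 by rewrite gt_eqF.
rewrite /gwave /wave !expi_conj -expiD; congr expi.
rewrite /angle /node !intrD !intrM.
have := N0; rewrite /mesh; move: (N%:R) => q q0; field.
by rewrite L0 q0.
Qed.

Lemma expi_angle_period q : expi (- angle (q * N%:Z)) = 1.
Proof.
rewrite -(expi_2piz R (- q)); congr expi; rewrite /angle intrM intrN -pmulrn.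
by have := N0; move: (N%:R) => x x0; field.
Qed.

Lemma gwave_cyclic l m n : cyclic3 K (gwave l m n).
Proof.
move=> i j k; split.
- by have := gwave_shift l m n N%:Z 0 0 i j k; rewrite !addr0 !mulr0 !addr0 expi_angle_period mul1r.
- by have := gwave_shift l m n 0 N%:Z 0 i j k; rewrite !addr0 !mulr0 !addr0 add0r expi_angle_period mul1r.
- by have := gwave_shift l m n 0 0 N%:Z i j k; rewrite !addr0 !mulr0 !add0r expi_angle_period mul1r.
Qed.

Lemma dftE f l m n : dft f l m n =
  (N%:R ^- 3) * total K (fun i j k => Complex (f i j k) 0 * gwave l m n i j k).
Proof. by []. Qed.

Lemma ComplexD x y : Complex (x + y) 0 = Complex x 0 + Complex y 0 :> R[i].
Proof. by apply/eqP; rewrite eq_complex /= addr0 !eqxx. Qed.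

Lemma ComplexM x y : Complex (x * y) 0 = Complex x 0 * Complex y 0 :> R[i].
Proof. by apply/eqP; rewrite eq_complex /= !mulr0 !mul0r subr0 addr0 !eqxx. Qed.

Lemma dft_lin f g x y l m n : dft (fun i j k => x * f i j k + y * g i j k) l m n =
  Complex x 0 * dft f l m n + Complex y 0 * dft g l m n.
Proof.
rewrite !dftE mulrCA [Complex y 0 * _]mulrCA -mulrDr; congr (_ * _).
rewrite -!totalZ -totalD; apply: eq_total => i j k.
by rewrite ComplexD !ComplexM mulrDl !mulrA.
Qed.

Lemma eq_dft f g l m n : (forall i j k, f i j k = g i j k) -> dft f l m n = dft g l m n.
Proof. by move=> e; rewrite !dftE; congr (_ * _); apply: eq_total => i j k; rewrite e. Qed.

Lemma dft_translate a b c f l m n : Vper K f -> dft (translate a b c f) l m n =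
  expi (angle (l * a + m * b + n * c)) * dft f l m n.
Proof.
rewrite VperE => hf; rewrite !dftE mulrCA; congr (_ * _); rewrite -totalZ.
have hF : cyclic3 K (fun i j k =>
    expi (angle (l * a + m * b + n * c)) * (Complex (f i j k) 0 * gwave l m n i j k)).
  move=> i j k; have [-> -> ->] := gwave_cyclic l m n i j k.
  by have [-> -> ->] := hf i j k.
rewrite -(total_shift a b c hF); apply: eq_total => i j k.
rewrite gwave_shift /translate mulrCA; congr (_ * _).
by rewrite mulrA -expiD subrr expi0 mul1r.
Qed.

Lemma dft_second_diff a b c f l m n : Vper K f -> dft (second_diff K L a b c f) l m n =
  Complex (- mu1 K L (l * a + m * b + n * c)) 0 * dft f l m n.
Proof.
move=> hf; set q := l * a + m * b + n * c.
rewrite (@eq_dft _ (fun i j k => h ^- 2 * translate a b c f i j k +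
  1 * ((- 2 * h ^- 2) * f i j k + h ^- 2 * translate (- a) (- b) (- c) f i j k))); last first.
  by move=> i j k; rewrite /second_diff; ring.
rewrite dft_lin dft_lin !dft_translate // -/q.
rewrite (_ : l * - a + m * - b + n * - c = - q); last by rewrite /q; ring.
have -> : angle (- q) = - angle q by rewrite /angle intrN mulrN mulNr.
rewrite -/(1 : R[i]) mul1r.
transitivity ((Complex (h ^- 2) 0 * (expi (angle q) + expi (- angle q)) + Complex (- 2 * h ^- 2) 0) * dft f l m n).
  by ring.
rewrite expi_sym -ComplexM -ComplexD; congr (Complex _ 0 * _).
by rewrite /mu1 -/(angle q); ring.
Qed.

Lemma dft_stencil4 a b c f l m n : Vper K f -> dft (stencil4 K L a b c f) l m n =
  Complex (- sym1 K L (l * a + m * b + n * c)) 0 * dft f l m n.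
Proof.
move=> hf; have hf2 := Vper_second_diff L a b c hf.
rewrite dft_second_diff; last by apply: (Vper_map2 (fun x y => x - h ^+ 2 / 12 * y)).
rewrite (@eq_dft _ (fun i j k => 1 * f i j k + (- (h ^+ 2 / 12)) * second_diff K L a b c f i j k)); last first.
  by move=> i j k; ring.
rewrite dft_lin dft_second_diff //; set q := l * a + m * b + n * c.
transitivity ((Complex (- mu1 K L q) 0 * (Complex 1 0 +
    Complex (- (h ^+ 2 / 12)) 0 * Complex (- mu1 K L q) 0)) * dft f l m n).
  by ring.
rewrite -ComplexM -ComplexD -ComplexM; by congr (Complex _ 0 * _); rewrite /sym1; ring.
Qed.

Lemma dft_lap4 f l m n : Vper K f -> dft (lap4 K L f) l m n =
  Complex (- symb K L l m n) 0 * dft f l m n.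
Proof.
move=> hf.
rewrite (@eq_dft _ (fun i j k => 1 * stencil4 K L 1 0 0 f i j k +
  1 * (1 * stencil4 K L 0 1 0 f i j k + 1 * stencil4 K L 0 0 1 f i j k))); last first.
  by move=> i j k; rewrite lap4E; ring.
rewrite !dft_lin !dft_stencil4 // !mulr0 !mulr1 !addr0 !add0r.
rewrite -/(1 : R[i]) !mul1r -!mulrDl -!ComplexD.
by congr (Complex _ 0 * _); rewrite /symb; ring.
Qed.

Lemma eq_total_node (V : zmodType) (F G : int -> int -> int -> V) :
  (forall i j k : nat, (0 < i <= N)%N -> (0 < j <= N)%N -> (0 < k <= N)%N ->
     F i%:Z j%:Z k%:Z = G i%:Z j%:Z k%:Z) ->
  total K F = total K G.
Proof.
move=> h; apply: eq_big_nat => i hi; apply: eq_big_nat => j hj.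
by apply: eq_big_nat => k hk; apply: h.
Qed.

Lemma wave_mul_gwave l m n l' m' n' i j k :
  wave L l' m' n' (node K L i) (node K L j) (node K L k) * gwave l m n i j k =
  gwave (l - l') (m - m') (n - n') i j k.
Proof.
rewrite /gwave /wave !expi_conj -expiD; congr expi; rewrite !intrB.
by field; rewrite gt_eqF.
Qed.

(** Aliasing is accounted for by the values of dft_coef g outside the
    retained modes, where dft_coef is periodic up to sign. *)
Lemma dft_mul f g l m n : dft (fun i j k => f i j k * g i j k) l m n =
  mode_total K (fun l' m' n' => dft f l' m' n' * dft g (l - l') (m - m') (n - n')).
Proof.
have L0 : L != 0 by rewrite gt_eqF.
rewrite dftE.
transitivity (N%:R ^- 3 * total K (fun i j k => mode_total K (fun l' m' n' =>
   dft f l' m' n' * (Complex (g i j k) 0 * gwave (l - l') (m - m') (n - n') i j k)))).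
  congr (_ * _); apply: eq_total_node => i j k hi hj hk.
  rewrite ComplexM -(trig_sum_dft_coef f L0 hi hj hk) -mulrA mulrC.
  transitivity (mode_total K (fun l' m' n' => (Complex (g i%:Z j%:Z k%:Z) 0 * gwave l m n i%:Z j%:Z k%:Z) *
    (dft f l' m' n' * wave L l' m' n' (node K L i%:Z) (node K L j%:Z) (node K L k%:Z)))).
    by rewrite mode_totalZ.
  apply: eq_bigr => l' _; apply: eq_bigr => m' _; apply: eq_bigr => n' _.
  by rewrite -wave_mul_gwave; ring.
rewrite total_exchange -mode_totalZ.
apply: eq_bigr => l' _; apply: eq_bigr => m' _; apply: eq_bigr => n' _.
by rewrite totalZ mulrCA -dftE.
Qed.

Lemma normc_gwave l m n i j k : normc (gwave l m n i j k) = 1.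
Proof. by rewrite /gwave normc_conj /wave normc_expi. Qed.

Lemma normc_natV : normc (N%:R ^- 3) = N%:R ^- 3.
Proof.
have -> : N%:R ^- 3 = Complex (N%:R ^- 3) 0 :> R[i].
  have := rmorphXn (real_complex R) 3 (N%:R^-1); rewrite fmorphV /= rmorph_nat => e.
  by rewrite -exprVn -e -exprVn.
by rewrite normc_real ger0_norm // invr_ge0 exprn_ge0.
Qed.

Lemma normc_dft_le f l m n :
  normc (dft f l m n) <= N%:R ^- 3 * total K (fun i j k => `|f i j k|).
Proof.
rewrite dftE Normc.normcM normc_natV ler_wpM2l ?invr_ge0 ?exprn_ge0 //.
apply: le_trans (ler_normc_total _ _) _; apply: ler_total => i j k.
by rewrite Normc.normcM normc_gwave mulr1 normc_real.
Qed.

End DFT.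

(** * A uniform bound for the modal recursion *)

Section ModalRecursion.
Variable R : realFieldType.

Definition bdf2_energy (gam bet b c : R) : R :=
  (b ^+ 2 + (2 * b - c) ^+ 2) / 4 + (gam / 2 + bet / 4) * b ^+ 2.

(** The multiplier a turns the left side into a difference of quadratic forms
    plus bet * a ^ 2.  A quarter of bet * (a ^ 2 + b ^ 2) survives the
    absorption of the forcing; it dominates a fixed fraction of the new energy,
    so the energy decreases as soon as it exceeds the size of the forcing. *)
Lemma bdf2_energy_step (gam bet a b c g G M : R) : 0 < bet -> 0 <= gam ->
  (3 / 2 + gam + bet) * a = (2 + gam) * b - c / 2 + g -> `|g| <= bet * G ->
  9 / 2 * (1 + gam + bet) * G ^+ 2 <= M ->
  bdf2_energy gam bet b c <= M -> bdf2_energy gam bet a b <= M.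
Proof.
move=> bet0 gam0 e hg hM hY.
have hga : g * a <= bet * (a ^+ 2 + G ^+ 2) / 2.
  apply: le_trans (ler_norm _) _; rewrite normrM.
  apply: le_trans (ler_wpM2r (normr_ge0 a) hg) _.
  have : bet * G * `|a| <= bet * ((`|a| ^+ 2 + G ^+ 2) / 2).
    by rewrite -mulrA ler_pM2l //; have := sqr_ge0 (`|a| - G); lra.
  by rewrite real_normK ?num_real //; lra.
have id1 : (3 / 2 + gam + bet) * a * a = ((2 + gam) * b - c / 2 + g) * a by rewrite e.
have diss : bdf2_energy gam bet a b + bet / 4 * (a ^+ 2 + b ^+ 2)
    <= bdf2_energy gam bet b c + bet / 2 * G ^+ 2.
  have s1 := sqr_ge0 (a - 2 * b + c).
  have s2 : 0 <= gam * (a - b) ^+ 2 by rewrite mulr_ge0 ?sqr_ge0.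
  rewrite /bdf2_energy; lra.
have up : bdf2_energy gam bet a b <= 9 / 4 * (1 + gam + bet) * (a ^+ 2 + b ^+ 2).
  have s1 := sqr_ge0 (2 * a + b); have s2 := sqr_ge0 a; have s3 := sqr_ge0 b.
  have s4 := mulr_ge0 gam0 s2; have s5 := mulr_ge0 gam0 s3.
  have s6 := mulr_ge0 (ltW bet0) s2; have s7 := mulr_ge0 (ltW bet0) s3.
  rewrite /bdf2_energy; lra.
rewrite leNgt; apply/negP => hlt.
set Y := bdf2_energy _ _ a b in hlt diss up.
have k0 : 0 < 9 / 4 * (1 + gam + bet) by lra.
have h1 : 2 * G ^+ 2 < a ^+ 2 + b ^+ 2.
  rewrite -(ltr_pM2l k0); apply: lt_le_trans up.
  by apply: le_lt_trans hlt; apply: le_trans hM; lra.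
have : bet / 4 * (2 * G ^+ 2) < bet / 4 * (a ^+ 2 + b ^+ 2).
  by rewrite ltr_pM2l // divr_gt0.
lra.
Qed.

Lemma bdf2_bound (x g : nat -> R) (gam bet G : R) : 0 < bet -> 0 <= gam ->
  (forall n, (3 / 2 + gam + bet) * x n.+2 = (2 + gam) * x n.+1 - x n / 2 + g n) ->
  (forall n, `|g n| <= bet * G) ->
  forall n, x n ^+ 2 <= 9 * (x 0%N ^+ 2 + x 1%N ^+ 2) + 18 * G ^+ 2.
Proof.
move=> bet0 gam0 e hg.
pose M := bdf2_energy gam bet (x 1%N) (x 0%N) + 9 / 2 * (1 + gam + bet) * G ^+ 2.
have k0 : 0 < 1 + gam + bet by lra.
have hM : 9 / 2 * (1 + gam + bet) * G ^+ 2 <= M.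
  rewrite lerDr /bdf2_energy; apply: addr_ge0.
    by rewrite divr_ge0 // addr_ge0 // sqr_ge0.
  by apply: mulr_ge0; [lra | exact: sqr_ge0].
have hY n : bdf2_energy gam bet (x n.+1) (x n) <= M.
  elim: n => [|n IH]; last exact: bdf2_energy_step (e n) (hg n) hM IH.
  by rewrite lerDl; apply: mulr_ge0; [lra | exact: sqr_ge0].
have s0 := sqr_ge0 (x 0%N); have s1 := sqr_ge0 (x 1%N); have sG := sqr_ge0 G.
case=> [|n]; first by lra.
have h1 : (1 + gam + bet) * x n.+1 ^+ 2 <= 4 * M.
  apply: le_trans (ler_wpM2l _ (hY n)); last by [].
  have t1 := sqr_ge0 (2 * x n.+1 - x n).
  have t2 := mulr_ge0 gam0 (sqr_ge0 (x n.+1)).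
  by rewrite /bdf2_energy; lra.
rewrite -(ler_pM2l k0); apply: le_trans h1 _; rewrite /M /bdf2_energy.
have t0 := sqr_ge0 (2 * x 1%N + x 0%N).
have t1 := mulr_ge0 gam0 s0; have t2 := mulr_ge0 (ltW bet0) s0.
have t3 := mulr_ge0 gam0 s1; have t4 := mulr_ge0 (ltW bet0) s1.
lra.
Qed.

End ModalRecursion.

(** * Decay of Fourier coefficients *)

Section Decay.
Variables (R : realType) (K : nat) (L Z : R).
Hypotheses (L_gt0 : 0 < L) (Z_ge2 : 2 <= Z) (Z_L2 : L ^+ 2 <= 2 * Z).
Notation N := (2 * K + 1)%N.
Notation weight := (weight K L).
Notation normc := (@Normc.normc R).
Notation dft := (dft_coef K L).
Implicit Types (f g : grid_fun R) (l m n : int) (x y M : R) (p q r : nat).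

Definition decay q M f : Prop :=
  forall l m n, normc (dft f l m n) * weight l m n ^+ q <= M.

Lemma weightX_gt0 l m n q : 0 < weight l m n ^+ q.
Proof. by rewrite exprn_gt0 // weight_gt0. Qed.

Lemma decay_ge0 q M f : decay q M f -> 0 <= M.
Proof.
move/(_ 0 0 0); apply: le_trans.
by rewrite mulr_ge0 ?normc_ge0 // ltW // weightX_gt0.
Qed.

Lemma decay_le q M M' f : M <= M' -> decay q M f -> decay q M' f.
Proof. by move=> MM' hf l m n; exact: le_trans (hf l m n) MM'. Qed.

Lemma decay_leq q q' M f : (q' <= q)%N -> decay q M f -> decay q' M f.
Proof.
move=> qq hf l m n; apply: le_trans (hf l m n).
by rewrite ler_wpM2l ?normc_ge0 // ler_weXn2l // weight_ge1.
Qed.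

Lemma decay_eq q M f g : (forall i j k, f i j k = g i j k) ->
  decay q M f -> decay q M g.
Proof. by move=> e hf l m n; rewrite -(eq_dft K L _ _ _ e). Qed.

Lemma decay_lin q M M' f g x y : decay q M f -> decay q M' g ->
  decay q (`|x| * M + `|y| * M') (fun i j k => x * f i j k + y * g i j k).
Proof.
move=> hf hg l m n; rewrite dft_lin.
have w0 := ltW (weightX_gt0 l m n q).
apply: le_trans (ler_wpM2r w0 (le_normcD _ _)) _.
rewrite (Normc.normcM (Complex x 0)) (Normc.normcM (Complex y 0)) !normc_real.
rewrite mulrDl -!mulrA.
exact: lerD (ler_wpM2l (normr_ge0 x) (hf l m n)) (ler_wpM2l (normr_ge0 y) (hg l m n)).
Qed.

Lemma decay_lap4 q M f : Vper K f -> decay (q + 8) M f -> decay q M (lap4 K L f).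
Proof.
move=> hp hf l m n; apply: le_trans (hf l m n).
rewrite dft_lap4 // Normc.normcM normc_real normrN ger0_norm ?symb_ge0 //.
rewrite -mulrA (_ : _ * _ ^+ (q + 8) = weight l m n ^+ 8 * (normc (dft f l m n) * weight l m n ^+ q)).
  apply: ler_wpM2r; last exact: symb_le_weight.
  by rewrite mulr_ge0 ?normc_ge0 // ltW // weightX_gt0.
by rewrite exprD; ring.
Qed.

Lemma leq_gap r p q : (r <= p)%N -> (r + 15 <= p + q)%N -> (15 - q <= p - r)%N.
Proof. by lia. Qed.

(** Of two frequencies with sum xi, the larger one carries at least half of
    the weight of xi; the powers that it does not need are passed on to the
    smaller one, which leaves the summable power 15. *)
Lemma decay_mul p q r M1 M2 f g : (r <= p)%N -> (r <= q)%N -> (r + 15 <= p + q)%N ->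
  decay p M1 f -> decay q M2 g ->
  decay r (M1 * M2 * Z ^+ (r + 26)) (fun i j k => f i j k * g i j k).
Proof.
move=> rp rq rpq hf hg l m n; have Z2 := Z_ge2.
have M10 := decay_ge0 hf; have M20 := decay_ge0 hg.
have M0 := mulr_ge0 M10 M20.
have wr := ltW (weightX_gt0 l m n r).
rewrite dft_mul //; apply: le_trans (ler_wpM2r wr (ler_normc_mode_total _ _)) _.
pose W l' m' n' : R := (weight l' m' n') ^- 15.
have step (a b A B w C1 C2 : R) (p' q' : nat) : (r <= p')%N -> (r + 15 <= p' + q')%N ->
    1 <= a -> a <= b -> 0 <= A -> 0 <= B -> 0 <= w -> w <= 2 * b ->
    B * b ^+ p' <= C1 -> A * a ^+ q' <= C2 -> B * A * w ^+ r <= C1 * C2 * 2 ^+ r * a ^- 15.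
  move=> rp' rpq' a1 ab A0 B0 w0 wb hB hA.
  have a0 : 0 < a by lra.
  have b0 : 0 < b by lra.
  rewrite ler_pdivlMr ?exprn_gt0 //.
  have t1 : w ^+ r <= 2 ^+ r * b ^+ r by rewrite -exprMn lerXn2r // nnegrE mulr_ge0 // ltW.
  have t2 : b ^+ r * a ^+ 15 <= b ^+ p' * a ^+ q'.
    rewrite -(subnKC rp') exprD -mulrA ler_pM2l ?exprn_gt0 //.
    have [le15|lt15] := leqP 15 q'.
      rewrite -[leLHS]mul1r; apply: ler_pM => //; rewrite ?exprn_ge0 ?(ltW a0) //.
        by rewrite exprn_ege1 //; lra.
      by rewrite ler_weXn2l.
    have -> : a ^+ 15 = a ^+ (15 - q') * a ^+ q' by rewrite -exprD subnK // ltnW.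
    rewrite ler_pM2r ?exprn_gt0 //.
    apply: le_trans (_ : b ^+ (15 - q') <= _); first by rewrite lerXn2r // nnegrE ltW.
    have b1 : 1 <= b := le_trans a1 ab.
    by apply: ler_weXn2l => //; exact: leq_gap.
  apply: le_trans (_ : B * A * (2 ^+ r * b ^+ r) * a ^+ 15 <= _).
    by rewrite ler_wpM2r ?exprn_ge0 ?(ltW a0) // ler_wpM2l // mulr_ge0.
  have -> : B * A * (2 ^+ r * b ^+ r) * a ^+ 15 = 2 ^+ r * (B * A * (b ^+ r * a ^+ 15)) by ring.
  rewrite [leRHS]mulrC ler_wpM2l ?exprn_ge0 //.
  apply: le_trans (_ : B * A * (b ^+ p' * a ^+ q') <= _); first by rewrite ler_wpM2l // mulr_ge0.
  have -> : B * A * (b ^+ p' * a ^+ q') = (B * b ^+ p') * (A * a ^+ q') by ring.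
  by apply: ler_pM => //; rewrite mulr_ge0 // exprn_ge0 // ltW.
have tot : forall l' m' n', normc (dft f l' m' n' * dft g (l - l') (m - m') (n - n')) * weight l m n ^+ r
   <= M1 * M2 * 2 ^+ r * (W l' m' n' + W (l' - l) (m' - m) (n' - n)).
  move=> l' m' n'; rewrite Normc.normcM.
  have hw : weight l m n <= 2 * Num.max (weight l' m' n') (weight (l - l') (m - m') (n - n')).
    by have := weightD K L_gt0 l' m' n' (l - l') (m - m') (n - n'); rewrite !subrKC.
  rewrite /W -(weightN K L (l' - l)) !opprB.
  have := hf l' m' n'; have := hg (l - l') (m - m') (n - n').
  have := weight_ge1 K L l' m' n'; have := weight_ge1 K L (l - l') (m - m') (n - n').
  have := normc_ge0 (dft f l' m' n'); have := normc_ge0 (dft g (l - l') (m - m') (n - n')).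
  move: hw; set a := weight l' m' n'; set b := weight (l - l') _ _; set w := weight l m n.
  set F := normc (dft f l' m' n'); set G := normc _ => hw G0 F0 b1 a1 hG hF.
  have w0 : 0 <= w by exact: ltW (weight_gt0 _ _ _ _ _).
  have i15 (z : R) : 1 <= z -> 0 <= z ^- 15.
    by move=> z1; rewrite invr_ge0 exprn_ge0 //; lra.
  have MM : 0 <= M1 * M2 * 2 ^+ r by rewrite mulr_ge0 // exprn_ge0.
  have [ab|ba] := leP a b.
    rewrite max_r // in hw.
    apply: le_trans (_ : M1 * M2 * 2 ^+ r * a ^- 15 <= _); last first.
      by rewrite ler_wpM2l // lerDl i15.
    rewrite (mulrC M1) [F * G]mulrC.
    by apply: (step a b F G w M2 M1 q p) => //; rewrite (addnC q).
  rewrite max_l ?(ltW ba) // in hw.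
  apply: le_trans (_ : M1 * M2 * 2 ^+ r * b ^- 15 <= _); last first.
    by rewrite ler_wpM2l // lerDr i15.
  by apply: (step b a G F w M1 M2 p q) => //; exact: ltW.
have W_cyc : cyclic3 K W.
  by move=> i j k; rewrite /W; have [-> -> ->] := weight_periodic K L i j k.
rewrite mulrC -mode_totalZ.
apply: le_trans (_ : mode_total K (fun l' m' n' => M1 * M2 * 2 ^+ r *
    (W l' m' n' + W (l' - l) (m' - m) (n' - n))) <= _).
  by apply: ler_mode_total => l' m' n'; rewrite mulrC.
rewrite mode_totalZ mode_totalD.
rewrite [X in _ + X]mode_totalE; last first.
  move=> i j k; have := W_cyc (i - l) (j - m) (k - n).
  by rewrite !(addrAC _ _ N%:Z).
rewrite (total_shift (- l) (- m) (- n) W_cyc) -(mode_totalE W_cyc).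
have S : mode_total K W <= Z ^+ 25 by exact: weight_sum.
rewrite -[leLHS]mulrA ler_wpM2l //.
rewrite (_ : 2 ^+ r * _ = 2 ^+ r.+1 * mode_total K W); last by rewrite exprSr; ring.
have -> : (r + 26 = r.+1 + 25)%N by rewrite addSnnS.
rewrite [in leRHS]exprD.
apply: ler_pM => //.
  by rewrite mode_totalE //; apply: total_ge0 => i j k; rewrite invr_ge0 exprn_ge0 // ltW // weight_gt0.
by rewrite lerXn2r // nnegrE; lra.
Qed.

End Decay.

Section InitialDecay.
Variables (R : realType) (K : nat) (L Z : R).
Hypotheses (L_gt0 : 0 < L) (Z_ge2 : 2 <= Z) (Z_L3 : L ^- 3 <= Z).
Notation N := (2 * K + 1)%N.
Notation h := (mesh K L).
Notation weight := (weight K L).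
Notation normc := (@Normc.normc R).
Notation dft := (dft_coef K L).
Implicit Types (f : grid_fun R) (l m n : int) (x : R).

Let Np : 0 < N%:R :> R. Proof. by rewrite ltr0n addn1. Qed.

Lemma mean_total (F : int -> int -> int -> R) :
  N%:R ^- 3 * total K F = L ^- 3 * (h ^+ 3 * total K F).
Proof.
have L0 := L_gt0; have N0 := Np; rewrite /mesh; move: (N%:R) N0 => q q0.
by field; rewrite !lt0r_neq0.
Qed.

Lemma mean_pow4 f : norm4_4 K L f <= Z ^+ 7 ->
  N%:R ^- 3 * total K (fun i j k => f i j k ^+ 4) <= Z ^+ 8.
Proof.
move=> h4; have Z2 := Z_ge2; rewrite mean_total (_ : Z ^+ 8 = Z * Z ^+ 7) //.
have e : h ^+ 3 * total K (fun i j k => f i j k ^+ 4) = norm4_4 K L f.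
  by rewrite /norm4_4 innerE; congr (_ * _); apply: eq_total => i j k; rewrite mulr1.
rewrite e; apply: ler_pM => //.
  by rewrite invr_ge0 exprn_ge0 // ltW.
rewrite -e; apply: mulr_ge0; first by rewrite exprn_ge0 // ltW // mesh_gt0.
by apply: total_ge0 => i j k; rewrite (_ : 4%N = (2 * 2)%N) // exprM sqr_ge0.
Qed.

Lemma mean_le_pow4 f (c : R -> R) : (forall x, `|c x| <= 1 + x ^+ 4) ->
  norm4_4 K L f <= Z ^+ 7 ->
  N%:R ^- 3 * total K (fun i j k => `|c (f i j k)|) <= 1 + Z ^+ 8.
Proof.
move=> hc /mean_pow4 h4.
have N3 : 0 <= N%:R ^- 3 :> R by rewrite invr_ge0 exprn_ge0 // ltW.
apply: le_trans (_ : N%:R ^- 3 * total K (fun i j k => 1 + f i j k ^+ 4) <= _).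
  by apply: ler_wpM2l => //; apply: ler_total => i j k; exact: hc.
rewrite totalD mulrDr; apply: lerD => //.
by rewrite total_cst mulr1 mulVf // expf_neq0 // lt0r_neq0.
Qed.

Lemma Zpow8_le : 1 + Z ^+ 8 <= Z ^+ 9.
Proof.
have Z2 := Z_ge2; have Z8 : 1 <= Z ^+ 8 by rewrite exprn_ege1 //; lra.
have : 2 * Z ^+ 8 <= Z ^+ 9 by rewrite [leRHS]exprS ler_wpM2r //; lra.
lra.
Qed.

(** A Fourier coefficient is at most the mean of |f|, which the mean of f ^ 4
    controls. *)
Lemma decay_of_L4 f : norm4_4 K L f <= Z ^+ 7 -> decay K L 0 (Z ^+ 9) f.
Proof.
move=> h4 l m n; rewrite expr0 mulr1; apply: le_trans (normc_dft_le _ _ _ _ _ _) _.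
apply: le_trans Zpow8_le; apply: (@mean_le_pow4 f id) => // x /=.
have [x1|x1] := leP `|x| 1.
  by apply: le_trans x1 _; rewrite lerDl (_ : 4%N = (2 * 2)%N) // exprM sqr_ge0.
rewrite (_ : x ^+ 4 = `|x| ^+ 4); last first.
  by rewrite -normrX ger0_norm // (_ : 4%N = (2 * 2)%N) // exprM sqr_ge0.
apply: le_trans (_ : `|x| ^+ 4 <= _).
  by rewrite ler_eXnr // ltW.
by rewrite lerDr.
Qed.

Lemma dft_fwd_diff a b c f l m n : Vper K f ->
  normc (dft (fwd_diff K L a b c f) l m n) ^+ 2 =
  mu1 K L (l * a + m * b + n * c) * normc (dft f l m n) ^+ 2.
Proof.
move=> hf; set q := l * a + m * b + n * c.
rewrite (@eq_dft _ _ _ _ (fun i j k => h^-1 * translate a b c f i j k + (- h^-1) * f i j k)); last first.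
  by move=> i j k; rewrite /fwd_diff; ring.
rewrite dft_lin dft_translate // -/q.
have -> : Complex h^-1 0 * (expi (angle R K q) * dft f l m n) + Complex (- h^-1) 0 * dft f l m n
  = (Complex h^-1 0 * expi (angle R K q) + Complex (- h^-1) 0) * dft f l m n by ring.
rewrite Normc.normcM exprMn; congr (_ * _).
rewrite normc_sqr /= /mu1 -/(angle R K q) !mul0r !subr0 !addr0.
have := cos2Dsin2 (angle R K q); set cc := cos _; set s := sin _ => e.
have hn : h != 0 by rewrite gt_eqF // mesh_gt0.
have -> : (h^-1 * cc - h^-1) ^+ 2 + (h^-1 * s) ^+ 2 = (cc ^+ 2 + s ^+ 2 + 1 - 2 * cc) / h ^+ 2 by field.
by rewrite e; congr (_ / _); ring.
Qed.

(** The difference quotient of f ^ 3 is a difference quotient of f times a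
    quadratic expression in f, hence bounded in the mean by the energy. *)
Lemma mean_fwd_diff_cube a b c f : Vper K f ->
  (a, b, c) \in [:: (1, 0, 0); (0, 1, 0); (0, 0, 1)] ->
  norm4_4 K L f <= Z ^+ 7 -> stiff K L f f <= Z ^+ 7 ->
  N%:R ^- 3 * total K (fun i j k =>
    `|fwd_diff K L a b c (fun i j k => f i j k ^+ 3) i j k|) <= 5 * Z ^+ 8.
Proof.
move=> hf habc h4 hs.
have N3 : 0 <= N%:R ^- 3 :> R by rewrite invr_ge0 exprn_ge0 // ltW.
have hn : h != 0 by rewrite gt_eqF // mesh_gt0.
have h4' := mean_pow4 h4.
have hd : N%:R ^- 3 * total K (fun i j k => fwd_diff K L a b c f i j k ^+ 2) <= Z ^+ 8.
  rewrite mean_total (_ : Z ^+ 8 = Z * Z ^+ 7) //; apply: ler_pM => //.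
  - by rewrite invr_ge0 exprn_ge0 // ltW.
  - apply: mulr_ge0; first by rewrite exprn_ge0 // ltW // mesh_gt0.
    by apply: total_ge0 => i j k; rewrite sqr_ge0.
  - exact: le_trans (stiff_fwd_diff L_gt0 habc hf) hs.
have h4t : total K (translate a b c (fun i j k => f i j k ^+ 4)) = total K (fun i j k => f i j k ^+ 4).
  by apply: total_translate; exact: (Vper_map (fun x => x ^+ 4)).
apply: le_trans (_ : N%:R ^- 3 * total K (fun i j k => 2^-1 * fwd_diff K L a b c f i j k ^+ 2 +
    (9 / 4) * (translate a b c (fun i j k => f i j k ^+ 4) i j k + f i j k ^+ 4)) <= _).
  apply: ler_wpM2l => //; apply: ler_total => i j k; rewrite /fwd_diff /translate.
  set u := f (i + a) _ _; set v := f i j k.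
  have -> : (u ^+ 3 - v ^+ 3) / h = ((u - v) / h) * (u ^+ 2 + u * v + v ^+ 2) by field.
  set d := (u - v) / h; set s := u ^+ 2 + u * v + v ^+ 2.
  have hss : s ^+ 2 <= 9 / 2 * (u ^+ 4 + v ^+ 4).
    have s1 : 0 <= s by rewrite /s; have := sqr_ge0 (u + v); have := sqr_ge0 u; have := sqr_ge0 v; lra.
    have s2 : s <= 3 / 2 * (u ^+ 2 + v ^+ 2) by rewrite /s; have := sqr_ge0 (u - v); lra.
    have : s ^+ 2 <= (3 / 2 * (u ^+ 2 + v ^+ 2)) ^+ 2 by rewrite lerXn2r // nnegrE; lra.
    have := sqr_ge0 (u ^+ 2 - v ^+ 2); lra.
  have : `|d * s| <= d ^+ 2 / 2 + s ^+ 2 / 2.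
    rewrite ler_norml; have := sqr_ge0 (d + s); have := sqr_ge0 (d - s).
    by move=> *; apply/andP; split; lra.
  lra.
rewrite totalD !totalZ totalD h4t mulrDr (mulrCA _ 2^-1) (mulrCA _ (9 / 4)) mulrDr.
lra.
Qed.

(** Four powers of the weight are one derivative, and the mean of the difference
    quotients of f ^ 3 bounds the coefficients of f ^ 3 times sqrt mu1. *)
Lemma decay_cube_of_energy f : Vper K f ->
  norm4_4 K L f <= Z ^+ 7 -> stiff K L f f <= Z ^+ 7 ->
  decay K L 4 (Z ^+ 12) (fun i j k => f i j k ^+ 3).
Proof.
move=> hf h4 hs l m n; have Z2 := Z_ge2.
set F : grid_fun R := fun i j k => f i j k ^+ 3.
have hF : Vper K F by exact: (Vper_map (fun x => x ^+ 3)).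
have Z8 : 1 <= Z ^+ 8 by rewrite exprn_ege1 //; lra.
set B := 5 * Z ^+ 8; set D := normc _.
have D0 : 0 <= D by exact: normc_ge0.
have B0 : 0 <= B by rewrite /B; lra.
have hD : D <= B.
  apply: le_trans (normc_dft_le _ _ _ _ _ _) _.
  apply: le_trans (@mean_le_pow4 f (fun x => x ^+ 3) _ h4) _; last by rewrite /B; lra.
  move=> x; rewrite normrX; have := sqr_ge0 (x ^+ 2 - 1); have := sqr_ge0 (`|x| ^+ 2 - `|x| / 2).
  have -> : x ^+ 4 = `|x| ^+ 4 by rewrite -normrX ger0_norm // (_ : 4%N = (2 * 2)%N) // exprM sqr_ge0.
  have := sqr_ge0 (`|x|); have := sqr_ge0 (`|x| - 1); have := sqr_ge0 (`|x| ^+ 2 - `|x|).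
  have := sqr_ge0 (`|x| ^+ 2 - 1).
  nra.
have hdir a b c : (a, b, c) \in [:: (1, 0, 0); (0, 1, 0); (0, 0, 1)] ->
    mu1 K L (l * a + m * b + n * c) * D ^+ 2 <= B ^+ 2.
  move=> habc; rewrite -dft_fwd_diff // lerXn2r // ?nnegrE ?normc_ge0 //.
  apply: le_trans (normc_dft_le _ _ _ _ _ _) _.
  exact: mean_fwd_diff_cube.
have := hdir 1 0 0 isT; have := hdir 0 1 0 isT; have := hdir 0 0 1 isT.
rewrite !mulr0 !mulr1 !addr0 !add0r => hn hm hl.
have hw : (D * weight l m n ^+ 4) ^+ 2 <= (3 * B) ^+ 2.
  have D2 : D ^+ 2 <= B ^+ 2 by rewrite lerXn2r // nnegrE.
  have D20 := sqr_ge0 D.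
  have tl := ler_wpM2r D20 (sym1_le K L_gt0 l).
  have tm := ler_wpM2r D20 (sym1_le K L_gt0 m).
  have tn := ler_wpM2r D20 (sym1_le K L_gt0 n).
  have B20 := sqr_ge0 B.
  by rewrite exprMn -exprM weight8 /symb; lra.
have : D * weight l m n ^+ 4 <= 3 * B.
  rewrite -(@ler_pXn2r _ 2) ?nnegrE //; first by rewrite mulr_ge0 // ltW // weightX_gt0.
  by rewrite mulr_ge0.
move/le_trans; apply; rewrite /B (_ : Z ^+ 12 = Z ^+ 4 * Z ^+ 8); last by rewrite -exprD.
rewrite mulrA ler_wpM2r //; first by lra.
apply: (@le_trans _ _ (2 ^+ 4)); first by rewrite -natrX -natrM ler_nat.
by rewrite lerXn2r // nnegrE; lra.
Qed.

End InitialDecay.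

(** * Uniform decay of the numerical solution *)

Section PowerDecay.
Variables (R : realType) (K : nat) (L Z : R).
Hypotheses (L_gt0 : 0 < L) (Z_ge2 : 2 <= Z) (Z_L2 : L ^+ 2 <= 2 * Z).
Notation decay := (decay K L).
Implicit Types (f g : grid_fun R) (x y del : R) (q a b : nat).

(** All constants are powers of a single Z, which is of the order of 1 / eps:
    the exponent is then the only thing to keep track of. *)
Definition pdecay q a del f : Prop := decay q (Z ^+ a * del) f.

Lemma Zpow_gt0 a : 0 < Z ^+ a.
Proof. by rewrite exprn_gt0 //; have := Z_ge2; lra. Qed.

Lemma Zpow_le a b : (a <= b)%N -> Z ^+ a <= Z ^+ b.
Proof. by move=> ab; rewrite ler_weXn2l //; have := Z_ge2; lra. Qed.

Lemma pdecay_exp q a b del f : (a <= b)%N -> pdecay q a del f -> pdecay q b del f.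
Proof.
move=> ab hf; have := decay_ge0 hf => M0; apply: decay_le hf.
apply: ler_wpM2r; last exact: Zpow_le.
move: M0; rewrite pmulr_rge0 //; exact: Zpow_gt0.
Qed.

Lemma pdecay_level q q' a del f : (q' <= q)%N -> pdecay q a del f -> pdecay q' a del f.
Proof. exact: decay_leq. Qed.

Lemma pdecay_eq q a del f g : (forall i j k, f i j k = g i j k) ->
  pdecay q a del f -> pdecay q a del g.
Proof. exact: decay_eq. Qed.

Lemma pdecay_lin q a b del f g x y : `|x| <= Z ^+ b -> `|y| <= Z ^+ b ->
  pdecay q a del f -> pdecay q a del g ->
  pdecay q (a + b).+1 del (fun i j k => x * f i j k + y * g i j k).
Proof.
move=> hx hy hf hg; have M0 := decay_ge0 hf.
apply: decay_le (decay_lin x y hf hg); rewrite -mulrDl.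
rewrite (_ : Z ^+ (a + b).+1 * del = (Z * Z ^+ b) * (Z ^+ a * del)); last first.
  by rewrite exprS exprD; ring.
apply: ler_wpM2r => //.
have := Zpow_gt0 b; have := Z_ge2 => Z2 zb.
have : 2 * Z ^+ b <= Z * Z ^+ b by rewrite ler_pM2r.
lra.
Qed.

Lemma pdecay_sub q a del f g : pdecay q a del f -> pdecay q a del g ->
  pdecay q a.+1 del (fun i j k => f i j k - g i j k).
Proof.
move=> hf hg.
apply: (@pdecay_eq _ _ _ (fun i j k => 1 * f i j k + (-1) * g i j k)).
  by move=> i j k; ring.
by rewrite -[a]addn0; apply: pdecay_lin; rewrite ?normrN ?normr1.
Qed.

Lemma pdecay_scale q a del f x : 0 <= x -> pdecay q a del f ->
  pdecay q a (x * del) (fun i j k => x * f i j k).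
Proof.
move=> x0 hf.
apply: (@pdecay_eq _ _ _ (fun i j k => x * f i j k + 0 * f i j k)).
  by move=> i j k; ring.
apply: decay_le (decay_lin x 0 hf hf).
by rewrite normr0 mul0r addr0 ger0_norm // mulrCA.
Qed.

Lemma pdecay_lap4 q a del f : Vper K f -> pdecay (q + 8) a del f ->
  pdecay q a del (lap4 K L f).
Proof. exact: decay_lap4. Qed.

Lemma pdecay_mul p q r a b del del' f g : (r <= p)%N -> (r <= q)%N -> (r + 15 <= p + q)%N ->
  pdecay p a del f -> pdecay q b del' g ->
  pdecay r (a + b + (r + 26)) (del * del') (fun i j k => f i j k * g i j k).
Proof.
move=> rp rq rpq hf hg.
have := decay_mul L_gt0 Z_ge2 Z_L2 rp rq rpq hf hg.
by apply: decay_le; rewrite le_eqVlt; apply/orP; left; apply/eqP; rewrite !exprD; ring.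
Qed.

Lemma pdecay_mul_same q a b del del' f g : (15 <= q)%N ->
  pdecay q a del f -> pdecay q b del' g ->
  pdecay q (a + b + (q + 26)) (del * del') (fun i j k => f i j k * g i j k).
Proof. by move=> q15; apply: pdecay_mul => //; rewrite leq_add2l. Qed.

Lemma pdecay_cube p q r a f : (q <= p)%N -> (q + 15 <= p + p)%N -> (r <= q)%N ->
  (r + 15 <= p + q)%N -> pdecay p a 1 f ->
  pdecay r (3 * a + q + r + 52) 1 (fun i j k => f i j k ^+ 3).
Proof.
move=> qp qpp rq rpq hf.
have := pdecay_mul (leq_trans rq qp) rq rpq hf (pdecay_mul qp qp qpp hf hf).
rewrite !mulr1 (_ : (a + (a + a + (q + 26)) + (r + 26) = 3 * a + q + r + 52)%N); last by lia.
by apply: pdecay_eq => i j k; rewrite !exprS expr0 mulr1.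
Qed.

Variables (A eps dt : R).

(** The common shape of the chemical potentials of the scheme and of their
    differences. *)
Definition mu_form (c v w u e : grid_fun R) : grid_fun R := fun i j k =>
  eps^-1 * (c i j k - 2 * v i j k + w i j k) - eps * lap4 K L u i j k
  - A * eps ^- 2 * dt * lap4 K L e i j k.

Hypotheses (A_ge0 : 0 <= A) (A_le : A <= Z) (eps_gt0 : 0 < eps) (eps_lt1 : eps < 1).
Hypotheses (eps_le : eps^-1 <= Z) (dt_gt0 : 0 < dt) (dt_le1 : dt <= 1).

Lemma pdecay_mu_form q a del c v w u e : Vper K u -> Vper K e ->
  pdecay q a del c -> pdecay q a del v -> pdecay q a del w ->
  pdecay (q + 8) a del u -> pdecay (q + 8) a del e ->
  pdecay q (a + 12) del (mu_form c v w u e).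
Proof.
move=> pu pe hc hv hw hu he; have Z2 := Z_ge2.
have e0 := eps_gt0; have e1 := eps_lt1; have eZ := eps_le.
have ei0 : 0 <= eps^-1 by rewrite invr_ge0 ltW.
have Z1 : Z <= Z ^+ 3 by rewrite -[leLHS]expr1 Zpow_le.
have Z12 : 2 * Z <= Z ^+ 3.
  apply: le_trans (_ : Z ^+ 2 <= _); last exact: Zpow_le.
  by rewrite expr2 ler_wpM2r //; lra.
have c1 : `|eps^-1| <= Z ^+ 3 by rewrite ger0_norm //; lra.
have c2 : `|- 2 * eps^-1| <= Z ^+ 3.
  by rewrite normrM normrN !ger0_norm //; lra.
have c3 : `|- eps| <= Z ^+ 3 by rewrite normrN ger0_norm; lra.
have c0 : `|1| <= Z ^+ 3 by rewrite normr1; lra.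
have c4 : `|- (A * eps ^- 2 * dt)| <= Z ^+ 3.
  rewrite normrN -exprVn ger0_norm; last first.
    by rewrite !mulr_ge0 ?exprn_ge0 // ltW.
  have p2 : 0 <= eps^-1 ^+ 2 by rewrite exprn_ge0.
  have p3 : eps^-1 ^+ 2 <= Z ^+ 2 by rewrite lerXn2r // nnegrE; lra.
  rewrite -[leRHS]mulr1 exprS.
  exact: ler_pM (mulr_ge0 A_ge0 p2) (ltW dt_gt0) (ler_pM A_ge0 p2 A_le p3) dt_le1.
have l1 := pdecay_lin c3 c4 (pdecay_lap4 pu hu) (pdecay_lap4 pe he).
have aa : (a <= (a + 3).+1)%N by rewrite leqW ?leq_addr.
have l2 := pdecay_lin c1 c0 (pdecay_exp aa hw) l1.
have l3 := pdecay_lin c1 c2 hc hv.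
have aa' : ((a + 3).+1 <= ((a + 3).+1 + 3).+1)%N by rewrite leqW ?leq_addr.
have := pdecay_lin c0 c0 (pdecay_exp aa' l3) l2.
rewrite (_ : ((((a + 3).+1 + 3).+1 + 3).+1 = a + 12)%N); last by rewrite !addnS !addn0.
by apply: pdecay_eq => i j k; rewrite /mu_form; ring.
Qed.

End PowerDecay.

(** Time levels are numbered from -1, so that X n is phi ^ (n - 1) and X 1 is the
    initial grid function.  Z dominates every parameter and P measures the
    regularity of X 1. *)
Record regular_scheme (R : realType) (K : nat) (L A eps dt Z : R) (P : nat)
    (X : nat -> grid_fun R) : Prop := {
  rs_L : 0 < L; rs_A : 0 <= A; rs_eps : 0 < eps; rs_eps1 : eps < 1;
  rs_dt : 0 < dt; rs_dt1 : dt <= 1;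
  rs_Z2 : 2 <= Z; rs_ZA : A <= Z; rs_Zeps : eps^-1 <= Z;
  rs_ZL2 : L ^+ 2 <= 2 * Z; rs_ZL3 : L ^- 3 <= Z;
  rs_per : forall n, Vper K (X n);
  rs_ghost : forall i j k, X 0%N i j k =
    X 1%N i j k - dt * lap4 K L (mu_init K L eps (X 1%N)) i j k;
  rs_step : forall n i j k,
    (3 / 2 * X n.+2 i j k - 2 * X n.+1 i j k + 1 / 2 * X n i j k) / dt =
    lap4 K L (mu_next K L A eps dt (X n.+2) (X n.+1) (X n)) i j k;
  rs_L4 : forall n, norm4_4 K L (X n.+1) <= Z ^+ 7;
  rs_stiff : forall n, stiff K L (X n.+1) (X n.+1) <= Z ^+ 7;
  rs_init : pdecay K L Z P 1 1 (X 1%N) }.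

Lemma Re_lin (R : realType) (x y : R) (z w : R[i]) :
  complex.Re (Complex x 0 * z + Complex y 0 * w) = x * complex.Re z + y * complex.Re w.
Proof. by case: z w => a b [c d] /=; ring. Qed.

Lemma Im_lin (R : realType) (x y : R) (z w : R[i]) :
  complex.Im (Complex x 0 * z + Complex y 0 * w) = x * complex.Im z + y * complex.Im w.
Proof. by case: z w => a b [c d] /=; ring. Qed.

Lemma Re_scale (R : realType) (x : R) (z : R[i]) :
  complex.Re (Complex x 0 * z) = x * complex.Re z.
Proof. by case: z => a b /=; ring. Qed.

Lemma Im_scale (R : realType) (x : R) (z : R[i]) :
  complex.Im (Complex x 0 * z) = x * complex.Im z.
Proof. by case: z => a b /=; ring. Qed.

Section RegularScheme.
Variables (R : realType) (K : nat) (L A eps dt Z : R) (P : nat) (X : nat -> grid_fun R).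
Hypothesis rs : regular_scheme K L A eps dt Z P X.
Notation weight := (weight K L).
Notation normc := (@Normc.normc R).
Notation dft := (dft_coef K L).
Notation pdecay := (pdecay K L Z).
Notation mu_form := (mu_form K L A eps dt).
Implicit Types (q a b n : nat) (del : R).

Let L_gt0 := rs_L rs.
Let Z_ge2 := rs_Z2 rs.
Let Z_L2 := rs_ZL2 rs.
Let per := rs_per rs.

Lemma pdecay_mu q a del c v w u e : Vper K u -> Vper K e ->
  pdecay q a del c -> pdecay q a del v -> pdecay q a del w ->
  pdecay (q + 8) a del u -> pdecay (q + 8) a del e ->
  pdecay q (a + 12) del (mu_form c v w u e).
Proof.
by apply: pdecay_mu_form; [apply: rs_L rs|apply: rs_Z2 rs|apply: rs_A rs|apply: rs_ZA rs|apply: rs_eps rs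
  |apply: rs_eps1 rs|apply: rs_Zeps rs|apply: rs_dt rs|apply: rs_dt1 rs].
Qed.

Definition explicit_part n : grid_fun R := fun i j k =>
  X n.+2 i j k ^+ 3 - 2 * X n.+1 i j k + X n i j k.

(** Stated for an arbitrary linear functional that diagonalizes the grid
    Laplacian; it is used for the real and the imaginary part of a Fourier
    coefficient. *)
Lemma modal_recursion (Phi : grid_fun R -> R) (s : R) n :
  (forall x y f g, Phi (fun i j k => x * f i j k + y * g i j k) = x * Phi f + y * Phi g) ->
  (forall f, Vper K f -> Phi (lap4 K L f) = - s * Phi f) ->
  (3 / 2 + A * eps ^- 2 * dt ^+ 2 * s ^+ 2 + dt * eps * s ^+ 2) * Phi (X n.+2) =
  (2 + A * eps ^- 2 * dt ^+ 2 * s ^+ 2) * Phi (X n.+1) - Phi (X n) / 2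
  + - (dt * s / eps) * Phi (explicit_part n).
Proof.
move=> lin lap; have dt0 := lt0r_neq0 (rs_dt rs); have ep0 := lt0r_neq0 (rs_eps rs).
have hE : Vper K (explicit_part n).
  apply: (Vper_map2 (fun x y => x + y)) => //.
  exact: (Vper_map2 (fun x y => x ^+ 3 - 2 * y)).
pose g1 : grid_fun R := fun i j k => 3 / 2 * X n.+2 i j k + (- 2) * X n.+1 i j k.
pose g : grid_fun R := fun i j k => 1 * g1 i j k + (1 / 2) * X n i j k.
pose d : grid_fun R := fun i j k => 1 * X n.+2 i j k + (-1) * X n.+1 i j k.
pose m1 : grid_fun R := fun i j k => eps^-1 * explicit_part n i j k + (- eps) * lap4 K L (X n.+2) i j k.
pose m2 : grid_fun R := fun i j k => 1 * m1 i j k + (- (A * eps ^- 2 * dt)) * lap4 K L d i j k.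
have hd : Vper K d by exact: (Vper_map2 (fun x y => 1 * x + (-1) * y)).
have em : mu_next K L A eps dt (X n.+2) (X n.+1) (X n) = m2.
  apply/funext => i; apply/funext => j; apply/funext => k.
  rewrite /mu_next /m2 /m1 /explicit_part mul1r mulNr mulNr; congr (_ - _ - _ * _).
  by apply: (f_equal (fun f : grid_fun R => lap4 K L f i j k));
    apply/funext => ?; apply/funext => ?; apply/funext => ?; rewrite /d; ring.
have hm : Vper K m2.
  apply: (Vper_map2 (fun x y => 1 * x + (- (A * eps ^- 2 * dt)) * y)); last exact: Vper_lap4.
  by apply: (Vper_map2 (fun x y => eps^-1 * x + (- eps) * y)) => //; exact: Vper_lap4.
have e : Phi g = dt * Phi (lap4 K L m2).
  rewrite (_ : g = fun i j k => dt * lap4 K L m2 i j k + 0 * lap4 K L m2 i j k).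
    by rewrite lin mul0r addr0.
  apply/funext => i; apply/funext => j; apply/funext => k.
  by rewrite -em -(rs_step rs) /g /g1; field.
have eg : Phi g = 3 / 2 * Phi (X n.+2) - 2 * Phi (X n.+1) + Phi (X n) / 2.
  by rewrite /g lin /g1 lin; ring.
have em2 : Phi m2 = eps^-1 * Phi (explicit_part n) + eps * s * Phi (X n.+2)
    + A * eps ^- 2 * dt * s * (Phi (X n.+2) - Phi (X n.+1)).
  by rewrite /m2 lin /m1 lin !lap // /d lin; ring.
move: e; rewrite lap // em2 eg.
move: (Phi (X n.+2)) (Phi (X n.+1)) (Phi (X n)) (Phi (explicit_part n)) => a b c G e.
have -> : (3 / 2 + A * eps ^- 2 * dt ^+ 2 * s ^+ 2 + dt * eps * s ^+ 2) * a =
  (3 / 2 * a - 2 * b + c / 2) + 2 * b - c / 2 + (A * eps ^- 2 * dt ^+ 2 * s ^+ 2 + dt * eps * s ^+ 2) * a by ring.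
by rewrite e; ring.
Qed.

(** Gain of two derivatives, that is of the power 8 of the weight: the forcing
    of the modal recursion is the explicit part times dt * symb / eps, and it is
    divided by dt * eps * symb ^ 2.  Frequencies with symb < 1 carry a bounded
    weight. *)
Lemma decay_gain q a : (forall n, pdecay 0 a 1 (X n)) ->
  (forall n, pdecay q a 1 (explicit_part n)) ->
  pdecay (q + 8) a 1 (X 0%N) -> pdecay (q + 8) a 1 (X 1%N) ->
  forall n, pdecay (q + 8) (a + q + 12) 1 (X n).
Proof.
move=> h0 hE hX0 hX1 n l m p.
have Z2 := Z_ge2; set s := symb K L l m p; set w := weight l m p.
have ep0 := rs_eps rs; have dt0 := rs_dt rs.
have s0 : 0 <= s by exact: symb_ge0.
have w8 : w ^+ 8 = 1 + s by exact: weight8.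
have w1 : 1 <= w by exact: weight_ge1.
have w0 : 0 < w by lra.
set M := Z ^+ a * 1.
have M0 : 0 <= M by exact: decay_ge0 hX0.
have ZM : Z ^+ (a + q + 12) * 1 = Z ^+ (q + 12) * M by rewrite /M -addnA exprD; ring.
rewrite ZM.
have [s1|s1] := ltP s 1.
  have w2 : w <= 2.
    rewrite -(@ler_pXn2r _ 8) ?nnegrE ?(ltW w0) // w8.
    by apply: (@le_trans _ _ (2 ^+ 1)); [rewrite expr1; lra | rewrite ler_weXn2l // ler1n].
  have hM : normc (dft (X n) l m p) <= M.
    by have := h0 n l m p; rewrite -/M expr0 mulr1.
  rewrite mulrC; apply: ler_pM => //; [by rewrite exprn_ge0 // ltW|exact: normc_ge0|].
  apply: (@le_trans _ _ (Z ^+ (q + 8))); first by apply: lerXn2r; rewrite ?nnegrE; lra.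
  by apply: Zpow_le => //; rewrite leq_add2l.
have sp : 0 < s by lra.
pose gam := A * eps ^- 2 * dt ^+ 2 * s ^+ 2; pose bet := dt * eps * s ^+ 2.
have bet0 : 0 < bet by rewrite !mulr_gt0 // exprn_gt0.
have gam0 : 0 <= gam.
  have i0 : 0 <= eps ^- 2 by rewrite invr_ge0 sqr_ge0.
  exact: mulr_ge0 (mulr_ge0 (mulr_ge0 (rs_A rs) i0) (sqr_ge0 _)) (sqr_ge0 _).
have bound (Phi : grid_fun R -> R) :
  (forall x y f g, Phi (fun i j k => x * f i j k + y * g i j k) = x * Phi f + y * Phi g) ->
  (forall f, Vper K f -> Phi (lap4 K L f) = - s * Phi f) ->
  (forall f, `|Phi f| <= normc (dft f l m p)) ->
  (Phi (X n) * w ^+ (q + 8)) ^+ 2 <= (Z ^+ 6 * M) ^+ 2.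
  move=> lin lap le.
  pose G := eps ^- 2 * (M / w ^+ q) / s.
  have := bdf2_bound bet0 gam0 (fun n => modal_recursion n lin lap) (G := G).
  have wq0 : 0 < w ^+ q by rewrite exprn_gt0.
  have hg i : `|- (dt * s / eps) * Phi (explicit_part i)| <= bet * G.
    have c0 : 0 <= dt * s / eps by rewrite divr_ge0 ?(ltW ep0) // mulr_ge0 // ltW.
    rewrite normrM normrN (ger0_norm c0).
    have -> : bet * G = dt * s / eps * (M / w ^+ q).
      by rewrite /bet /G; field; rewrite !lt0r_neq0.
    apply: ler_wpM2l => //.
    rewrite ler_pdivlMr ?exprn_gt0 //.
    apply: le_trans (hE i l m p); rewrite ler_wpM2r ?exprn_ge0 ?(ltW w0) //.
  move=> /(_ hg n); set x := Phi (X n); set x0 := Phi (X 0%N); set x1 := Phi (X 1%N) => hx.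
  have W0 : 0 < w ^+ (q + 8) by rewrite exprn_gt0.
  have b0 : (x0 * w ^+ (q + 8)) ^+ 2 <= M ^+ 2.
    rewrite -[leLHS]real_normK ?num_real // lerXn2r // ?nnegrE // normrM (ger0_norm (ltW W0)).
    by apply: le_trans (hX0 l m p); rewrite ler_pM2r //; exact: le.
  have b1 : (x1 * w ^+ (q + 8)) ^+ 2 <= M ^+ 2.
    rewrite -[leLHS]real_normK ?num_real // lerXn2r // ?nnegrE // normrM (ger0_norm (ltW W0)).
    by apply: le_trans (hX1 l m p); rewrite ler_pM2r //; exact: le.
  have bG : (G * w ^+ (q + 8)) ^+ 2 <= (2 * Z ^+ 2 * M) ^+ 2.
    have -> : G * w ^+ (q + 8) = eps^-1 ^+ 2 * (w ^+ 8 / s) * M.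
      by rewrite /G exprD; field; rewrite !lt0r_neq0.
    have ei : 0 < eps^-1 by rewrite invr_gt0.
    have e2 : 0 <= eps^-1 ^+ 2 by rewrite sqr_ge0.
    have ws : 0 <= w ^+ 8 / s by rewrite divr_ge0 ?exprn_ge0 // ltW.
    have t1 : eps^-1 ^+ 2 <= Z ^+ 2.
      by apply: lerXn2r (rs_Zeps rs); rewrite nnegrE; lra.
    have t2 : w ^+ 8 / s <= 2 by rewrite ler_pdivrMr // w8; lra.
    have t4 : eps^-1 ^+ 2 * (w ^+ 8 / s) * M <= 2 * Z ^+ 2 * M.
      by apply: (ler_wpM2r M0); rewrite [leRHS]mulrC; exact: (ler_pM e2 ws t1 t2).
    have t0 : 0 <= eps^-1 ^+ 2 * (w ^+ 8 / s) * M := mulr_ge0 (mulr_ge0 e2 ws) M0.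
    by apply: lerXn2r => //; rewrite nnegrE //; exact: le_trans t0 t4.
  have Z4 : 16 <= Z ^+ 4.
    apply: (@le_trans _ _ (2 ^+ 4)); first by rewrite -natrX ler_nat.
    by apply: lerXn2r; rewrite ?nnegrE; lra.
  have M2 : 0 <= M ^+ 2 by exact: sqr_ge0.
  have : (x * w ^+ (q + 8)) ^+ 2 <= 9 * (M ^+ 2 + M ^+ 2) + 18 * (2 * Z ^+ 2 * M) ^+ 2.
    rewrite exprMn; apply: le_trans (ler_wpM2r (sqr_ge0 _) hx) _.
    rewrite exprMn in b0; rewrite exprMn in b1; rewrite [in leLHS]exprMn in bG.
    by move: (w ^+ (q + 8)) b0 b1 bG => W b0 b1 bG; lra.
  move/le_trans; apply.
  have -> : 9 * (M ^+ 2 + M ^+ 2) + 18 * (2 * Z ^+ 2 * M) ^+ 2 = (18 + 72 * Z ^+ 4) * M ^+ 2 by ring.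
  rewrite [leRHS]exprMn; apply: ler_wpM2r => //.
  have -> : (Z ^+ 6) ^+ 2 = Z ^+ 4 * (Z ^+ 4 * Z ^+ 4) by ring.
  have : 16 * Z ^+ 4 <= Z ^+ 4 * Z ^+ 4 by rewrite ler_wpM2r //; lra.
  have : 16 * (Z ^+ 4 * Z ^+ 4) <= Z ^+ 4 * (Z ^+ 4 * Z ^+ 4).
    by rewrite ler_wpM2r // mulr_ge0 //; lra.
  lra.
have bR := bound (fun f => complex.Re (dft f l m p)).
have bI := bound (fun f => complex.Im (dft f l m p)).
have ZZ : 0 <= Z ^+ 6 * M by rewrite mulr_ge0 // exprn_ge0 //; lra.
have hR : `|complex.Re (dft (X n) l m p) * w ^+ (q + 8)| <= Z ^+ 6 * M.
  rewrite -(@ler_pXn2r _ 2) ?nnegrE // real_normK ?num_real //; apply: bR.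
  - by move=> x y f g; rewrite dft_lin Re_lin.
  - by move=> f hf; rewrite dft_lap4 // Re_scale.
  - by move=> f; exact: normr_Re_le.
have hI : `|complex.Im (dft (X n) l m p) * w ^+ (q + 8)| <= Z ^+ 6 * M.
  rewrite -(@ler_pXn2r _ 2) ?nnegrE // real_normK ?num_real //; apply: bI.
  - by move=> x y f g; rewrite dft_lin Im_lin.
  - by move=> f hf; rewrite dft_lap4 // Im_scale.
  - by move=> f; exact: normr_Im_le.
have W0 : 0 < w ^+ (q + 8) by rewrite exprn_gt0.
apply: le_trans (ler_wpM2r (ltW W0) (normc_le_ReIm _)) _.
move: hR hI; rewrite !normrM (ger0_norm (ltW W0)) => hR hI.
rewrite mulrDl; apply: (@le_trans _ _ (2 * (Z ^+ 6 * M))); first by lra.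
rewrite mulrA; apply: ler_wpM2r => //.
apply: (@le_trans _ _ (Z ^+ 7)); last by apply: Zpow_le => //; rewrite (leq_trans _ (leq_addl _ _)).
by rewrite [leRHS]exprS ler_wpM2r // exprn_ge0 //; lra.
Qed.

End RegularScheme.

Section Bootstrap.
Variables (R : realType) (K : nat) (L A eps dt Z : R) (P : nat) (X : nat -> grid_fun R).
Hypothesis rs : regular_scheme K L A eps dt Z P X.
Notation pdecay := (pdecay K L Z).
Notation mu_form := (mu_form K L A eps dt).
Implicit Types (q r a b n : nat) (del : R).

Let per n : Vper K (X n) := rs_per rs n.

Lemma Vper_mu_form c v w u e : Vper K c -> Vper K v -> Vper K w -> Vper K u ->
  Vper K e -> Vper K (mu_form c v w u e).
Proof.
move=> hc hv hw hu he.
apply: (Vper_map2 (fun x y => x - A * eps ^- 2 * dt * y)); last exact: Vper_lap4.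
apply: (Vper_map2 (fun x y => x - eps * y)); last exact: Vper_lap4.
apply: (Vper_map (fun x => eps^-1 * x)).
apply: (Vper_map2 (fun x y => x + y)) => //.
exact: (Vper_map2 (fun x y => x - 2 * y)).
Qed.

Lemma pdecay_del q a del del' f : del <= del' -> pdecay q a del f -> pdecay q a del' f.
Proof.
move=> dd hf; apply: decay_le hf; rewrite ler_pM2l //.
exact: (Zpow_gt0 (rs_Z2 rs)).
Qed.

Lemma pdecay_weaken q q' a b del f : (q' <= q)%N -> (a <= b)%N ->
  pdecay q a del f -> pdecay q' b del f.
Proof.
move=> qq ab hf; apply: pdecay_exp ab _; first exact: rs_Z2 rs.
exact: pdecay_level qq hf.
Qed.

Definition cube (f : grid_fun R) : grid_fun R := fun i j k => f i j k ^+ 3.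

Definition mu0 : grid_fun R := mu_init K L eps (X 1%N).

Lemma mu0E : mu0 = mu_form (cube (X 1%N)) (X 1%N) (X 1%N) (X 1%N) (sub_grid (X 1%N) (X 1%N)).
Proof.
apply/funext => i; apply/funext => j; apply/funext => k.
rewrite /mu0 /mu_init /mu_form /cube.
have -> : lap4 K L (sub_grid (X 1%N) (X 1%N)) i j k = 0.
  have -> : sub_grid (X 1%N) (X 1%N) = fun i j k => 0 * X 1%N i j k + 0 * X 1%N i j k.
    by apply/funext => ?; apply/funext => ?; apply/funext => ?; rewrite /sub_grid; ring.
  by rewrite lap4_lin !mul0r addr0.
by rewrite mulr0 subr0; congr (_ * _ - _); ring.
Qed.

Lemma Vper_mu0 : Vper K mu0.
Proof.
rewrite mu0E; apply: Vper_mu_form => //; last exact: Vper_sub_grid.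
exact: (Vper_map (fun x => x ^+ 3)).
Qed.

Lemma pdecay_init q a : (q <= P)%N -> pdecay q a.+1 1 (X 1%N).
Proof. by move=> qP; apply: pdecay_weaken qP _ (rs_init rs). Qed.

Lemma pdecay_cube_same q a f : (15 <= q)%N -> pdecay q a 1 f ->
  pdecay q (3 * a + q + q + 52) 1 (cube f).
Proof.
move=> q15; apply: pdecay_cube => //; rewrite ?leq_add2l //.
- exact: rs_L rs.
- exact: rs_Z2 rs.
- exact: rs_ZL2 rs.
Qed.

Lemma pdecay_mu0 q : (15 <= q)%N -> (q + 8 <= P)%N -> pdecay q (2 * q + 67) 1 mu0.
Proof.
move=> q15 qP; have qP' : (q <= P)%N := leq_trans (leq_addr _ _) qP.
rewrite mu0E (_ : (2 * q + 67 = (2 * q + 54).+1 + 12)%N); last by rewrite -addnS -addnA.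
apply: (pdecay_mu rs) => //; try exact: pdecay_init.
- exact: Vper_sub_grid.
- have := pdecay_cube_same q15 (pdecay_init 0 qP'); apply: pdecay_weaken => //.
  by rewrite muln1 mul2n -addnn; lia.
- have := pdecay_sub (rs_Z2 rs) (pdecay_init 0 qP) (pdecay_init 0 qP).
  by apply: pdecay_weaken => //; rewrite addnS.
Qed.

Lemma first_increment i j k : X 1%N i j k - X 0%N i j k = dt * lap4 K L mu0 i j k.
Proof. by rewrite (rs_ghost rs) opprB addrCA subrr addr0. Qed.

Lemma pdecay_first_increment q : (7 <= q)%N -> (q + 16 <= P)%N ->
  pdecay q (2 * q + 83) dt (sub_grid (X 1%N) (X 0%N)).
Proof.
move=> q7 qP; rewrite -[dt]mulr1.
apply: (@pdecay_eq _ _ _ _ _ _ _ (fun i j k => dt * lap4 K L mu0 i j k)).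
  by move=> i j k; rewrite /sub_grid first_increment.
suff hl : pdecay q (2 * q + 83) 1 (lap4 K L mu0) by exact: pdecay_scale (ltW (rs_dt rs)) hl.
apply: (pdecay_lap4 (rs_L rs) Vper_mu0).
have := @pdecay_mu0 (q + 8); rewrite -[(q + 8 + 8)%N]addnA => h.
apply: pdecay_weaken (h _ qP) => //; last by rewrite (leq_add2r 8 7 q).
by rewrite mulnDr -addnA.
Qed.

Lemma pdecay_ghost q : (7 <= q)%N -> (q + 16 <= P)%N -> pdecay q (2 * q + 84) 1 (X 0%N).
Proof.
move=> q7 qP; have qP' : (q <= P)%N := leq_trans (leq_addr _ _) qP.
apply: (@pdecay_eq _ _ _ _ _ _ _ (fun i j k => X 1%N i j k - sub_grid (X 1%N) (X 0%N) i j k)).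
  by move=> i j k; rewrite /sub_grid; ring.
rewrite addnS; apply: pdecay_sub; [exact: rs_Z2 rs|by rewrite addnS; exact: pdecay_init|].
exact: pdecay_del (rs_dt1 rs) (pdecay_first_increment q7 qP).
Qed.

Lemma pdecay_explicit_part r a n : (forall n, pdecay r a 1 (X n)) ->
  pdecay r a 1 (cube (X n.+2)) -> pdecay r (a + 4) 1 (explicit_part X n).
Proof.
move=> hX hc; have Z2 := rs_Z2 rs.
have z1 : `|1| <= Z ^+ 1 by rewrite normr1 expr1; lra.
have z2 : `|-2| <= Z ^+ 1 by rewrite normrN ger0_norm ?expr1.
have l1 := pdecay_lin Z2 z1 z2 hc (hX n.+1).
have aa : (a <= (a + 1).+1)%N by rewrite leqW ?leq_addr.
have := pdecay_lin Z2 z1 z1 l1 (pdecay_weaken (leqnn _) aa (hX n)).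
rewrite (_ : (((a + 1).+1 + 1).+1 = a + 4)%N); last by rewrite !addnS !addn0.
by apply: pdecay_eq => i j k; rewrite /cube /explicit_part; ring.
Qed.

Lemma decay_gain_cube r a : (r + 24 <= P)%N -> (forall n, pdecay r a 1 (X n)) ->
  (forall n, pdecay r a 1 (cube (X n.+2))) ->
  forall n, pdecay (r + 8) (a + 3 * r + 114) 1 (X n).
Proof.
move=> rP hX hc n.
have -> : (a + 3 * r + 114 = (a + (2 * r + 102)) + r + 12)%N by lia.
apply: (decay_gain rs) => {n} [n|n||].
- by apply: pdecay_weaken (hX n); rewrite ?leq_addr.
- by apply: pdecay_weaken (pdecay_explicit_part hX (hc n)); lia.
- by apply: pdecay_weaken (pdecay_ghost (q := r + 8) _ _); lia.
- by apply: pdecay_weaken (pdecay_init (q := r + 8) 0 _); lia.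
Qed.

Lemma pdecay0 n : (24 <= P)%N -> pdecay 0 98 1 (X n).
Proof.
move=> P24; case: n => [|n].
  by apply: pdecay_weaken (pdecay_ghost (q := 7) _ _) => //; lia.
apply: pdecay_weaken (_ : pdecay 0 9 1 _) => //.
rewrite /pdecay mulr1; apply: decay_of_L4; [exact: rs_L rs|exact: rs_Z2 rs|exact: rs_ZL3 rs|].
exact: rs_L4 rs n.
Qed.

Lemma pdecay_cube4 n : pdecay 4 12 1 (cube (X n.+1)).
Proof.
rewrite /pdecay mulr1; apply: decay_cube_of_energy; [exact: rs_L rs|exact: rs_Z2 rs|exact: rs_ZL3 rs|exact: per| |].
  exact: rs_L4 rs n.
exact: rs_stiff rs n.
Qed.

End Bootstrap.

(** The exponent is chosen before the parameters of the scheme, so that it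
    depends on the decay rate only. *)
Definition scheme_decay (q : nat) : Prop := exists a : nat,
  forall (R : realType) K (L A eps dt Z : R) P (X : nat -> grid_fun R),
  regular_scheme K L A eps dt Z P X -> (q + 24 <= P)%N ->
  forall n, pdecay K L Z q a 1 (X n).

Lemma scheme_decay12 : scheme_decay 12.
Proof.
have d8 : scheme_decay 8.
  exists (98 + 3 * 0 + 114)%N => R K L A eps dt Z P X rs P8.
  apply: (decay_gain_cube rs (r := 0) (a := 98)) => [|n|n]; first by lia.
    by apply: (pdecay0 rs); lia.
  exact: (pdecay_weaken rs _ _ (pdecay_cube4 rs n.+1)).
have [a ha] := d8.
exists (maxn a 12 + 3 * 4 + 114)%N => R K L A eps dt Z P X rs P12.
apply: (decay_gain_cube rs (r := 4) (a := maxn a 12)) => [|n|n]; first by lia.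
  apply: (pdecay_weaken rs _ _ (ha _ _ _ _ _ _ _ _ _ rs _ n)) => //; first by rewrite leq_maxl.
  by lia.
by apply: (pdecay_weaken rs _ _ (pdecay_cube4 rs n.+1)) => //; rewrite leq_maxr.
Qed.

Lemma leq_triple (x y z t : nat) : (x <= 3 * x + y + z + t)%N.
Proof. by lia. Qed.

Lemma scheme_decay_step p q r : (q <= p)%N -> (q + 15 <= p + p)%N -> (r <= q)%N ->
  (r + 15 <= p + q)%N -> (p <= r + 8)%N -> scheme_decay p -> scheme_decay (r + 8).
Proof.
move=> qp qpp rq rpq pr [a ha].
exists ((3 * a + q + r + 52) + 3 * r + 114)%N => R K L A eps dt Z P X rs rP.
have pP : (p + 24 <= P)%N by apply: leq_trans rP; rewrite leq_add2r.
have hX n := ha _ _ _ _ _ _ _ _ _ rs pP n.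
apply: (decay_gain_cube rs) => [|n|n].
- by apply: leq_trans rP; rewrite leq_add2r leq_addr.
- apply: (pdecay_weaken rs _ _ (hX n)); first exact: leq_trans rq qp.
  exact: leq_triple.
apply: pdecay_cube rq rpq (hX n.+2) => //.
- exact: rs_L rs.
- exact: rs_Z2 rs.
- exact: rs_ZL2 rs.
Qed.

(** From the rate 12 given by the energy, the convolution of the cube loses
    first 6 and then 2 of the powers; above 15 nothing is lost and each round
    gains 8. *)
Lemma scheme_decay_all j : scheme_decay (20 + 8 * j).
Proof.
elim: j => [|j IH]; last first.
  rewrite mulnSr addnA; apply: (@scheme_decay_step _ (20 + 8 * j)) IH => //; by lia.
apply: (@scheme_decay_step 14 13 12) => //.
exact: (@scheme_decay_step 12 9 6 _ _ _ _ _ scheme_decay12).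
Qed.

(** * Time differences *)

Section TimeDifferences.
Variables (R : realType) (K : nat) (L A eps dt Z : R) (P : nat) (X : nat -> grid_fun R).
Hypothesis rs : regular_scheme K L A eps dt Z P X.
Notation pdecay := (pdecay K L Z).
Notation mu_form := (mu_form K L A eps dt).
Notation lap := (lap4 K L).
Implicit Types (q a b n : nat) (del : R) (f g : grid_fun R).

Let per n : Vper K (X n) := rs_per rs n.

Definition increment n : grid_fun R := sub_grid (X n.+1) (X n).
Definition increment2 n : grid_fun R := sub_grid (increment n.+1) (increment n).
Definition mu n : grid_fun R := mu_next K L A eps dt (X n.+2) (X n.+1) (X n).

Lemma grid_ext (f g : grid_fun R) : (forall i j k, f i j k = g i j k) -> f = g.
Proof. by move=> e; apply/funext => i; apply/funext => j; apply/funext => k. Qed.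

Lemma Vper_cube f : Vper K f -> Vper K (cube f).
Proof. exact: (Vper_map (fun x => x ^+ 3)). Qed.

Lemma Vper_increment n : Vper K (increment n).
Proof. exact: Vper_sub_grid. Qed.

Lemma muE n : mu n = mu_form (cube (X n.+2)) (X n.+1) (X n) (X n.+2) (increment n.+1).
Proof. by []. Qed.

Lemma lap4_diff f g i j k : lap (sub_grid f g) i j k = lap f i j k - lap g i j k.
Proof.
rewrite (@grid_ext (sub_grid f g) (fun i j k => 1 * f i j k + (-1) * g i j k)).
  by rewrite lap4_lin; ring.
by move=> *; rewrite /sub_grid; ring.
Qed.

(** The left side of the scheme is 3/2 y_{n+1} - 1/2 y_n in terms of the time
    increments, so increments obey a contraction with ratio 1/3 and their bounds do
    not grow with the number of steps. *)
Lemma contraction q a del (y F : nat -> grid_fun R) :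
  (forall n i j k, 3 / 2 * y n.+1 i j k - y n i j k / 2 = dt * F n i j k) ->
  pdecay q a (dt * del) (y 0%N) -> (forall n, pdecay q a del (F n)) ->
  forall n, pdecay q a (dt * del) (y n).
Proof.
move=> e h0 hF; elim=> [//|n IH].
apply: (@pdecay_eq _ _ _ _ _ _ _ (fun i j k => 3^-1 * y n i j k + (2 / 3 * dt) * F n i j k)).
  by move=> i j k; have := e n i j k; lra.
have dt0 := ltW (rs_dt rs).
apply: decay_le (decay_lin 3^-1 (2 / 3 * dt) IH (hF n)).
have -> : `|3^-1 : R| = 3^-1 by rewrite ger0_norm.
have -> : `|2 / 3 * dt| = 2 / 3 * dt by rewrite ger0_norm // mulr_ge0.
by rewrite le_eqVlt; apply/orP; left; apply/eqP; field.
Qed.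

Lemma increment_step n i j k :
  3 / 2 * increment n.+1 i j k - increment n i j k / 2 = dt * lap (mu n) i j k.
Proof.
rewrite /mu -(rs_step rs) /increment /sub_grid; field.
exact: lt0r_neq0 (rs_dt rs).
Qed.

Lemma pdecay_increment q a : (7 <= q)%N -> (q + 16 <= P)%N ->
  (forall n, pdecay (q + 16) a 1 (X n)) ->
  forall n, pdecay q (3 * a + 2 * q + 83) dt (increment n).
Proof.
move=> q7 qP hX n; rewrite -[X in pdecay _ _ X]mulr1.
have q16 : (q + 16 = q + 8 + 8)%N by rewrite -addnA.
have q8 : (q + 8 <= q + 16)%N by rewrite leq_add2l.
have q15 : (15 <= q + 8)%N by rewrite (leq_add2r 8 7 q).
have a1 : (a <= 3 * a + (2 * q + 71))%N by lia.
have a2 : (a.+1 <= 3 * a + (2 * q + 71))%N by lia.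
have a3 : (3 * a + (q + 8) + (q + 8) + 52 <= 3 * a + (2 * q + 71))%N by lia.
have a4 : (2 * q + 83 <= 3 * a + 2 * q + 83)%N by rewrite leq_add2r leq_addl.
move: n; apply: (@contraction _ _ _ _ (fun n => lap (mu n))) => [n i j k||n].
- exact: increment_step.
- rewrite mulr1; apply: (pdecay_weaken rs) (pdecay_first_increment rs q7 qP) => //.
- rewrite (_ : (3 * a + 2 * q + 83 = (3 * a + (2 * q + 71)) + 12)%N); last by rewrite -!addnA.
  apply: (pdecay_lap4 (rs_L rs)).
    by rewrite muE; apply: Vper_mu_form => //; [exact: Vper_cube | exact: Vper_increment].
  rewrite muE; apply: (pdecay_mu rs) => //; first exact: Vper_increment.
  + have hc := pdecay_cube_same rs q15 (pdecay_weaken rs q8 (leqnn a) (hX n.+2)).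
    exact: (pdecay_weaken rs (leqnn _) a3 hc).
  + exact: (pdecay_weaken rs q8 a1 (hX _)).
  + exact: (pdecay_weaken rs q8 a1 (hX _)).
  + by rewrite -q16; exact: (pdecay_weaken rs (leqnn _) a1 (hX _)).
  + have hd := pdecay_sub (rs_Z2 rs) (hX n.+2) (hX n.+1).
    by rewrite -q16; exact: (pdecay_weaken rs (leqnn _) a2 hd).
Qed.

Lemma pdecay_cube_diff q b del f g : (15 <= q)%N ->
  pdecay q b 1 f -> pdecay q b 1 g -> pdecay q b del (sub_grid f g) ->
  pdecay q (3 * b + 2 * q + 56) del (sub_grid (cube f) (cube g)).
Proof.
move=> q15 hf hg hd; have Z2 := rs_Z2 rs.
have z1 : `|1| <= Z ^+ 1 by rewrite normr1 expr1; lra.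
have mul a b' del1 del2 f' g' :=
  @pdecay_mul_same _ K _ _ (rs_L rs) Z2 (rs_ZL2 rs) q a b' del1 del2 f' g' q15.
have s1 := mul _ _ _ _ _ _ hf hf.
have s2 := mul _ _ _ _ _ _ (pdecay_lin Z2 z1 z1 hf hg) hg.
have e1 : (b + b + (q + 26) <= (b + 1).+1 + b + (q + 26))%N.
  by rewrite !leq_add2r leqW ?leq_addr.
have s3 := pdecay_lin Z2 z1 z1 (pdecay_weaken rs (leqnn _) e1 s1) s2.
have := mul _ _ _ _ _ _ hd s3.
rewrite !mulr1 (_ : (_ + _ + _ = 3 * b + 2 * q + 56)%N); last by lia.
by apply: pdecay_eq => i j k; rewrite /sub_grid /cube; ring.
Qed.

Lemma increment2_step n i j k :
  3 / 2 * increment2 n.+1 i j k - increment2 n i j k / 2 =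
  dt * lap (sub_grid (mu n.+1) (mu n)) i j k.
Proof.
rewrite lap4_diff [dt * _]mulrBr -!increment_step /increment2 /sub_grid; ring.
Qed.

Lemma increment2_start i j k :
  3 / 2 * increment2 0 i j k = dt * lap (sub_grid (mu 0) (mu0 K L eps X)) i j k.
Proof.
rewrite lap4_diff [dt * _]mulrBr -increment_step -(first_increment rs) /increment2 /sub_grid.
by rewrite /increment /sub_grid; field.
Qed.

Lemma mu_diffE n : sub_grid (mu n.+1) (mu n) =
  mu_form (sub_grid (cube (X n.+3)) (cube (X n.+2))) (increment n.+1) (increment n)
    (increment n.+2) (increment2 n.+1).
Proof.
apply: grid_ext => i j k; rewrite /mu_form /increment2 /increment !lap4_diff.
rewrite /sub_grid /mu /mu_next /cube.
have e f g : lap (fun i j k => f i j k - g i j k) i j k = lap f i j k - lap g i j k.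
  exact: lap4_diff.
by rewrite !e; ring.
Qed.

Lemma mu_diff0E : sub_grid (mu 0) (mu0 K L eps X) =
  mu_form (sub_grid (cube (X 2)) (cube (X 1))) (increment 0) (increment 0)
    (increment 1) (increment 1).
Proof.
apply: grid_ext => i j k; rewrite /mu_form /increment !lap4_diff.
rewrite /sub_grid /mu /mu_next /cube /mu0 /mu_init.
have e f g : lap (fun i j k => f i j k - g i j k) i j k = lap f i j k - lap g i j k.
  exact: lap4_diff.
by rewrite !e; ring.
Qed.

(** Twice eight powers are lost from q + 16: one factor for the outer Laplacian
    and one for the Laplacians inside mu.  The first step needs mu 0 - mu0 to be
    of order dt, which holds because mu_diff0E puts it in the same form as the
    later differences. *)
Lemma pdecay_increment2 q b : (7 <= q)%N ->
  (forall n, pdecay (q + 16) b 1 (X n)) -> (forall n, pdecay (q + 16) b dt (increment n)) ->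
  forall n, pdecay q (3 * b + 2 * q + 84) (dt * dt) (increment2 n).
Proof.
move=> q7 hX hd; have Z2 := rs_Z2 rs.
have q16 : (q + 16 = q + 8 + 8)%N by rewrite -addnA.
have q8 : (q + 8 <= q + 16)%N by rewrite leq_add2l.
have q15 : (15 <= q + 8)%N by rewrite (leq_add2r 8 7 q).
have b1 : (b <= 3 * b + 2 * q + 72)%N by lia.
have b2 : (b.+1 <= 3 * b + 2 * q + 72)%N by lia.
have hc n : pdecay (q + 8) (3 * b + 2 * q + 72) dt (sub_grid (cube (X n.+1)) (cube (X n))).
  rewrite (_ : (3 * b + 2 * q + 72 = 3 * b + 2 * (q + 8) + 56)%N); last by lia.
  by apply: pdecay_cube_diff => //; apply: (pdecay_weaken rs q8 (leqnn _)) => //; apply: hd.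
have hdq n : pdecay (q + 8) (3 * b + 2 * q + 72) dt (increment n).
  exact: (pdecay_weaken rs q8 b1 (hd _)).
have hdq' n : pdecay (q + 8 + 8) (3 * b + 2 * q + 72) dt (increment n).
  by rewrite -q16; exact: (pdecay_weaken rs (leqnn _) b1 (hd _)).
have hsq' n : pdecay (q + 8 + 8) (3 * b + 2 * q + 72) dt (increment2 n).
  rewrite -q16; apply: (pdecay_weaken rs (leqnn _) b2).
  exact: (pdecay_sub Z2 (hd n.+1) (hd n)).
have pd n : Vper K (increment n) by exact: Vper_increment.
have pc n : Vper K (sub_grid (cube (X n.+1)) (cube (X n))).
  by apply: Vper_sub_grid; exact: Vper_cube.
have p2 n : Vper K (increment2 n) by exact: Vper_sub_grid.
rewrite (_ : (3 * b + 2 * q + 84 = (3 * b + 2 * q + 72) + 12)%N); last by rewrite -[RHS]addnA.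
apply: (@contraction _ _ _ _ (fun n => lap (sub_grid (mu n.+1) (mu n)))) => [n i j k||n].
- exact: increment2_step.
- have h0 : pdecay q (3 * b + 2 * q + 72 + 12) dt (lap (sub_grid (mu 0) (mu0 K L eps X))).
    rewrite mu_diff0E; apply: (pdecay_lap4 (rs_L rs)); first exact: Vper_mu_form.
    exact: (pdecay_mu rs).
  have c0 : 0 <= 2 / 3 * dt by rewrite mulr_ge0 // ltW // (rs_dt rs).
  have e i j k : 2 / 3 * dt * lap (sub_grid (mu 0) (mu0 K L eps X)) i j k = increment2 0 i j k.
    by have := increment2_start i j k; lra.
  apply: (pdecay_del rs _ (pdecay_eq e (pdecay_scale c0 h0))).
  by have := mulr_gt0 (rs_dt rs) (rs_dt rs); lra.
- rewrite mu_diffE; apply: (pdecay_lap4 (rs_L rs)); first exact: Vper_mu_form.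
  exact: (pdecay_mu rs).
Qed.

End TimeDifferences.

Lemma second_difference_decay q : exists a P : nat,
  forall (R : realType) K (L A eps dt Z : R) (X : nat -> grid_fun R),
  regular_scheme K L A eps dt Z P X ->
  forall n, pdecay K L Z q a (dt * dt) (increment2 X n).
Proof.
pose r := (q + 7)%N.
have [a ha] := scheme_decay_all (r + 32).
pose b := (3 * a + 2 * (r + 16) + 83)%N.
exists (3 * b + 2 * r + 84)%N, (20 + 8 * (r + 32) + 24)%N => R K L A eps dt Z X rs n.
have hX m : pdecay K L Z (r + 32) a 1 (X m).
  by apply: (pdecay_weaken rs _ (leqnn _) (ha _ _ _ _ _ _ _ _ _ rs _ m)); lia.
have hd m : pdecay K L Z (r + 16) b dt (increment X m).
  apply: (pdecay_increment rs) => [||m'].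
  - by lia.
  - by lia.
  - by rewrite -addnA.
have h2 : pdecay K L Z r (3 * b + 2 * r + 84) (dt * dt) (increment2 X n).
  apply: (pdecay_increment2 rs) => // [|m].
    by lia.
  by apply: (pdecay_weaken rs _ _ (hX m)); rewrite /b; lia.
by apply: (pdecay_weaken rs _ (leqnn _) h2); rewrite leq_addr.
Qed.

(** * Iterated integrals of continuous functions *)

Section OneIntegral.
Local Open Scope classical_set_scope.
Variables (R : realType) (L : R).
Hypothesis L_gt0 : 0 < L.
Notation leb := (@lebesgue_measure R).
Implicit Types (f g F : R -> R) (a c x y z : R).

Definition int1 (f : R -> R) : R := \int[leb]_(z in `]0, L[) f z.

Lemma integrable_int1 f : continuous f -> leb.-integrable `]0, L[ (EFin \o f).
Proof.
move=> cf; apply: (@integrableS _ _ R leb `[0, L]%classic) => //.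
- by apply: subset_itv_oo_cc.
- apply: continuous_compact_integrable; first exact: segment_compact.
  exact: continuous_subspaceT.
Qed.

Lemma int1_cst c : int1 (fun=> c) = c * L.
Proof.
rewrite /int1 Rintegral_cst //= lebesgue_measure_itv /= lte_fin L_gt0.
by rewrite -EFinD subr0.
Qed.

Lemma int1_le f g : continuous f -> continuous g ->
  (forall z, 0 <= z <= L -> f z <= g z) -> int1 f <= int1 g.
Proof.
move=> cf cg fg; apply: le_Rintegral => //; try exact: integrable_int1.
by move=> z /=; rewrite in_itv /= => /andP[z0 z1]; apply: fg; rewrite !ltW.
Qed.

Lemma int1_norm f c : continuous f -> (forall z, 0 <= z <= L -> `|f z| <= c) ->
  `|int1 f| <= c * L.
Proof.
move=> cf fc; rewrite ler_norml; apply/andP; split.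
  rewrite -mulNr -int1_cst; apply: int1_le => // [z|z hz]; first exact: cst_continuous.
  by have := fc z hz; rewrite ler_norml => /andP[].
rewrite -int1_cst; apply: int1_le => // [z|z hz]; first exact: cst_continuous.
by have := fc z hz; rewrite ler_norml => /andP[].
Qed.

Lemma int1D f g : continuous f -> continuous g ->
  int1 (fun z => f z + g z) = int1 f + int1 g.
Proof. by move=> cf cg; apply: RintegralD => //; exact: integrable_int1. Qed.

Lemma int1B f g : continuous f -> continuous g ->
  int1 (fun z => f z - g z) = int1 f - int1 g.
Proof. by move=> cf cg; apply: RintegralB => //; exact: integrable_int1. Qed.

Lemma int1Z a f : continuous f -> int1 (fun z => a * f z) = a * int1 f.
Proof. by move=> cf; apply: RintegralZl => //; exact: integrable_int1. Qed.

Lemma int1_FTC (F f : R -> R) : (forall x, is_derive x 1 F (f x)) -> continuous f ->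
  int1 f = F L - F 0.
Proof.
move=> dF cf.
have cF : continuous F.
  by move=> x; apply: differentiable_continuous; apply/derivable1_diffP; have [] := dF x.
have := @continuous_FTC2 R f F 0 L L_gt0 (continuous_subspaceT cf).
rewrite /int1 /Rintegral -(@integral_itv_bndoo _ _ _ _ true false) //; last first.
  by have /integrableP[] := integrable_int1 cf.
move=> -> //.
- split => [x _||].
  + by have [] := dF x.
  + by apply: cvg_at_right_filter; exact: cF.
  + by apply: cvg_at_left_filter; exact: cF.
- by move=> x _; rewrite derive1E; have [_ ->] := dF x.
Qed.

(** Compactness of the segment makes the continuity in t uniform in z. *)
Lemma near_uniform (T : topologicalType) (f : T * R -> R) (t : T) (e : R) : 0 < e ->
  continuous f -> \forall t' \near t, forall z, 0 <= z <= L ->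
    `|f (t', z) - f (t, z)| <= e.
Proof.
move=> e0 cf.
have K : compact (`[0, L] : set R) by exact: segment_compact.
have : \forall t' \near t, (`[0, L] : set R) `<=` (fun z => `|f (t', z) - f (t, z)| <= e).
  apply: (@compact_near_coveringP R `[0, L]).1 K _ _ _ _ _.
  move=> z _.
  have e2 : 0 < e / 2 by rewrite divr_gt0.
  have /cvgrPdist_lt /(_ _ e2) [[A B] /= [At Bz] AB] := cf (t, z).
  exists (B, A) => //= -[z' t'] /= [Bz' At'].
  have h1 := AB (t', z') (conj At' Bz').
  have h2 := AB (t, z') (conj (nbhs_singleton At) Bz').
  rewrite -[f (t', z') - _](subrKA (f (t, z))) /= .
  rewrite /= in h1 h2; rewrite distrC in h1.
  apply: le_trans (ler_normD _ _) _; lra.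
by apply: filterS => t' h z hz; apply: (h z); rewrite /= in_itv.
Qed.

Lemma continuous_slice (T : topologicalType) (f : T * R -> R) (t : T) :
  continuous f -> continuous (fun z => f (t, z)).
Proof.
move=> cf z; apply: (@continuous_comp _ _ _ (fun z => (t, z)) f); last exact: cf.
apply: (@cvg_pair _ _ _ (nbhs z) (nbhs t) (nbhs z)); [exact: cvg_cst|exact: cvg_id].
Qed.

Lemma continuous_int1 (T : topologicalType) (f : T * R -> R) :
  continuous f -> continuous (fun t => int1 (fun z => f (t, z))).
Proof.
move=> cf t; apply/cvgrPdist_le => e e0.
have eL : 0 < e / L by rewrite divr_gt0.
have cz t' : continuous (fun z => f (t', z)).
  exact: continuous_slice.
apply: filterS (near_uniform t eL cf) => t' h /=.
rewrite distrC -int1B // -[e](divfK (lt0r_neq0 L_gt0)).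
by apply: int1_norm => // z; apply: cvgB; exact: cz.
Qed.

Lemma is_derive_cvg (F : R -> R) (x d : R) :
  (fun h => h^-1 *: (F (h + x) - F x)) @ 0^' --> d -> is_derive x 1 F d.
Proof.
move=> h.
have e : (fun t : R => t^-1 *: ((F \o shift x) (t *: 1) - F x)) = (fun h => h^-1 *: (F (h + x) - F x)).
  by apply/funext => t /=; rewrite /shift /= [t *: 1]mulr1.
split; first by rewrite /derivable e; apply/cvg_ex; exists d.
by rewrite /derive e; exact: cvg_lim.
Qed.

(** Differentiation under the integral sign, from the mean value theorem and
    the uniformity of near_uniform. *)
Lemma is_derive_int1 (f g : R -> R -> R) (x : R) :
  (forall x y, is_derive x 1 (f ^~ y) (g x y)) ->
  (forall x, continuous (f x)) -> continuous (fun p : R * R => g p.1 p.2) ->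
  is_derive x 1 (fun x => int1 (f x)) (int1 (g x)).
Proof.
move=> fg cf cg.
have cgy x' : continuous (g x').
  have h := @continuous_slice R (fun p : R * R => g p.1 p.2) x' cg.
  exact: h.
apply: is_derive_cvg; apply/cvgrPdist_le => e e0.
have eL : 0 < e / L by rewrite divr_gt0.
have /nbhs_ballP[r /= r0 hr] := near_uniform x eL cg.
near=> h.
have h0 : h != 0 by near: h; exact: nbhs_dnbhs_neq.
have hr' : `|h| < r by near: h; exact: dnbhs0_lt.
have hz z : 0 <= z <= L -> `|h * g x z - (f (h + x) z - f x z)| <= `|h| * (e / L).
  move=> zL.
  have mvt (a b : R) : a < b -> exists2 c, a < c < b & f b z - f a z = g c z * (b - a).
    move=> ab; have cfz : {within `[a, b], continuous (f ^~ z)}.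
      apply: continuous_subspaceT => y; apply: differentiable_continuous.
      by apply/derivable1_diffP; have [] := fg y z.
    have [c] := MVT ab (fun y _ => fg y z) cfz.
    by rewrite in_itv /= => hc ec; exists c.
  have [c hc ->] : exists2 c, `|c - x| < r & f (h + x) z - f x z = g c z * h.
    have [h1|h1|h1] := ltgtP h 0; last by rewrite h1 eqxx in h0.
      have [c /andP[c1 c2] ec] := mvt (h + x) x ltac:(lra).
      exists c; last by apply: oppr_inj; rewrite opprB ec; ring.
      by move: hr'; rewrite ltr0_norm // ltr0_norm; lra.
    have [c /andP[c1 c2] ec] := mvt x (h + x) ltac:(lra).
    exists c; last by rewrite ec; ring.
    by move: hr'; rewrite gtr0_norm // gtr0_norm; lra.
  rewrite [g c z * h]mulrC -mulrBr normrM ler_wpM2l // distrC.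
  by apply: (hr c _ z zL); rewrite /ball /= distrC.
have -> : int1 (g x) - h^-1 *: (int1 (f (h + x)) - int1 (f x)) =
    h^-1 * int1 (fun z => h * g x z - (f (h + x) z - f x z)).
  rewrite int1B; first by rewrite int1Z // int1B // mulrBr mulKf.
    by move=> z; apply: cvgM; [exact: cvg_cst|exact: cgy].
  by move=> z; apply: cvgB; exact: cf.
rewrite normrM normfV ler_pdivrMl ?normr_gt0 //.
have -> : `|h| * e = `|h| * (e / L) * L by rewrite -mulrA divfK // lt0r_neq0.
apply: int1_norm => // z; apply: cvgB; last by apply: cvgB; exact: cf.
by apply: cvgM; [exact: cvg_cst|exact: cgy].
Unshelve. all: by end_near. Qed.

End OneIntegral.

Section ThreeIntegrals.
Variables (R : realType) (L : R).
Hypothesis L_gt0 : 0 < L.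
Implicit Types (f g F G : R -> R -> R -> R) (a c x y z : R).
Notation int1 := (int1 L).

Lemma integral3E f : integral3 L f =
  int1 (fun x => int1 (fun y => int1 (fun z => f x y z))).
Proof. by []. Qed.

Lemma continuous3_z f x y : continuous3 f -> continuous (f x y).
Proof. exact: (@continuous_slice R _ (fun p : R * R * R => f p.1.1 p.1.2 p.2) (x, y)). Qed.

Lemma continuous_int1_z f : continuous3 f ->
  continuous (fun p : R * R => int1 (fun z => f p.1 p.2 z)).
Proof. exact: (@continuous_int1 R L L_gt0 _ (fun p : R * R * R => f p.1.1 p.1.2 p.2)). Qed.

Lemma continuous_int1_y f x : continuous3 f ->
  continuous (fun y => int1 (fun z => f x y z)).
Proof.
move=> /continuous_int1_z.
exact: (@continuous_slice R _ (fun p : R * R => int1 (fun z => f p.1 p.2 z)) x).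
Qed.

Lemma continuous_int1_yz f : continuous3 f ->
  continuous (fun x => int1 (fun y => int1 (fun z => f x y z))).
Proof.
move=> /continuous_int1_z.
exact: (@continuous_int1 R L L_gt0 _ (fun p : R * R => int1 (fun z => f p.1 p.2 z))).
Qed.

Lemma continuous3D f g : continuous3 f -> continuous3 g ->
  continuous3 (fun x y z => f x y z + g x y z).
Proof. by move=> cf cg p; apply: cvgD; [exact: cf|exact: cg]. Qed.

Lemma continuous3M f g : continuous3 f -> continuous3 g ->
  continuous3 (fun x y z => f x y z * g x y z).
Proof. by move=> cf cg p; apply: cvgM; [exact: cf|exact: cg]. Qed.

Lemma continuous3_cst c : continuous3 (fun _ _ _ => c).
Proof. by move=> p; exact: cvg_cst. Qed.

Lemma integral3D f g : continuous3 f -> continuous3 g ->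
  integral3 L (fun x y z => f x y z + g x y z) = integral3 L f + integral3 L g.
Proof.
move=> cf cg; rewrite !integral3E -int1D; try exact: continuous_int1_yz.
congr int1; apply/funext => x; rewrite -int1D; try exact: continuous_int1_y.
by congr int1; apply/funext => y; rewrite -int1D //; exact: continuous3_z.
Qed.

Lemma integral3Z a f : continuous3 f ->
  integral3 L (fun x y z => a * f x y z) = a * integral3 L f.
Proof.
move=> cf; rewrite !integral3E -int1Z; try exact: continuous_int1_yz.
congr int1; apply/funext => x; rewrite -int1Z; try exact: continuous_int1_y.
by congr int1; apply/funext => y; rewrite -int1Z //; exact: continuous3_z.
Qed.

Lemma integral3_cst c : integral3 L (fun _ _ _ => c) = c * L ^+ 3.
Proof. by rewrite integral3E !int1_cst //; ring. Qed.

Lemma integral3_le f g : continuous3 f -> continuous3 g ->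
  (forall x y z, f x y z <= g x y z) -> integral3 L f <= integral3 L g.
Proof.
move=> cf cg fg; rewrite !integral3E.
apply: int1_le => [||x _]; try exact: continuous_int1_yz.
apply: int1_le => [||y _]; try exact: continuous_int1_y.
by apply: int1_le => [||z _]; try exact: continuous3_z.
Qed.

Lemma integral3_ge0 f : (forall x y z, 0 <= f x y z) -> 0 <= integral3 L f.
Proof.
move=> f0; apply: Rintegral_ge0 => x _; apply: Rintegral_ge0 => y _.
exact: Rintegral_ge0.
Qed.

Lemma continuous_xz G y : continuous3 G -> continuous (fun p : R * R => G p.1 y p.2).
Proof.
move=> cG p.
apply: (@continuous_comp _ _ _ (fun p : R * R => ((p.1, y), p.2)) (fun p : R * R * R => G p.1.1 p.1.2 p.2)); last exact: cG.
apply: (@cvg_pair _ _ _ (nbhs p) (nbhs (p.1, y)) (nbhs p.2)); last exact: cvg_snd.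
apply: (@cvg_pair _ _ _ (nbhs p) (nbhs p.1) (nbhs y)); [exact: cvg_fst|exact: cvg_cst].
Qed.

Lemma continuous_yz G x : continuous3 G -> continuous (fun p : R * R => G x p.1 p.2).
Proof.
move=> cG p.
apply: (@continuous_comp _ _ _ (fun p : R * R => ((x, p.1), p.2)) (fun p : R * R * R => G p.1.1 p.1.2 p.2)); last exact: cG.
apply: (@cvg_pair _ _ _ (nbhs p) (nbhs (x, p.1)) (nbhs p.2)); last exact: cvg_snd.
apply: (@cvg_pair _ _ _ (nbhs p) (nbhs x) (nbhs p.1)); [exact: cvg_cst|exact: cvg_fst].
Qed.

(** The two inner integrals are differentiated under the integral sign, which
    turns the outer one into a difference of boundary values. *)
Lemma integral3_dx F G : continuous3 F -> continuous3 G ->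
  (forall x y z, is_derive x 1 (fun t => F t y z) (G x y z)) ->
  (forall y z, F L y z = F 0 y z) -> integral3 L G = 0.
Proof.
move=> cF cG dF pF; rewrite integral3E.
have d1 x y : is_derive x 1 (fun t => int1 (fun z => F t y z)) (int1 (fun z => G x y z)).
  apply: (@is_derive_int1 R L L_gt0 (fun t z => F t y z) (fun t z => G t y z)) => //.
  - by move=> t; exact: continuous3_z.
  - exact: continuous_xz.
have d2 x : is_derive x 1 (fun t => int1 (fun y => int1 (fun z => F t y z)))
    (int1 (fun y => int1 (fun z => G x y z))).
  apply: (@is_derive_int1 R L L_gt0 (fun t y => int1 (fun z => F t y z))
    (fun t y => int1 (fun z => G t y z))) => //.
  - by move=> t; exact: continuous_int1_y.
  - exact: continuous_int1_z.
rewrite (int1_FTC L_gt0 d2); last exact: continuous_int1_yz.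
apply/eqP; rewrite subr_eq0; apply/eqP.
by congr int1; apply/funext => y; congr int1; apply/funext => z.
Qed.

Lemma integral3_dy F G : continuous3 F -> continuous3 G ->
  (forall x y z, is_derive y 1 (fun t => F x t z) (G x y z)) ->
  (forall x z, F x L z = F x 0 z) -> integral3 L G = 0.
Proof.
move=> cF cG dF pF; rewrite integral3E.
have d1 x y : is_derive y 1 (fun t => int1 (fun z => F x t z)) (int1 (fun z => G x y z)).
  apply: (@is_derive_int1 R L L_gt0 (fun t z => F x t z) (fun t z => G x t z)) => //.
  - by move=> t; exact: continuous3_z.
  - exact: continuous_yz.
transitivity (int1 (fun _ => 0)); last by rewrite int1_cst // mul0r.
congr int1; apply/funext => x.
rewrite (int1_FTC L_gt0 (d1 x)); last exact: continuous_int1_y.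
apply/eqP; rewrite subr_eq0; apply/eqP.
by congr int1; apply/funext => z.
Qed.

Lemma integral3_dz F G : continuous3 G ->
  (forall x y z, is_derive z 1 (fun t => F x y t) (G x y z)) ->
  (forall x y, F x y L = F x y 0) -> integral3 L G = 0.
Proof.
move=> cG dF pF; rewrite integral3E.
transitivity (int1 (fun _ => 0)); last by rewrite int1_cst // mul0r.
congr int1; apply/funext => x.
transitivity (int1 (fun _ => 0)); last by rewrite int1_cst // mul0r.
congr int1; apply/funext => y.
by rewrite (int1_FTC L_gt0 (dF x y)) ?pF ?subrr //; exact: continuous3_z.
Qed.

End ThreeIntegrals.

(** * Decay of the Fourier coefficients of a smooth periodic function *)

Lemma mul_le_half_sqr (R : realFieldType) (a b s : R) :
  b ^+ 2 <= 1 -> s ^+ 2 = 1 -> s * (a * b) <= 2^-1 * (a ^+ 2 + 1).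
Proof.
move=> b1 s1; have := sqr_ge0 (a - s * b).
have -> : (a - s * b) ^+ 2 = a ^+ 2 - 2 * (s * (a * b)) + s ^+ 2 * b ^+ 2 by ring.
by rewrite s1; lra.
Qed.

Lemma normr_le_sgn (R : realDomainType) (x c : R) : 1 * x <= c -> -1 * x <= c -> `|x| <= c.
Proof. by rewrite mul1r mulN1r => h1 h2; rewrite ler_norml lerNl h1 h2. Qed.

Lemma term_le_sum3 (R : realDomainType) (T : nat -> nat -> nat -> R) (s i j k : nat) :
  (i + j + k <= s)%N -> (forall i j k, 0 <= T i j k) ->
  T i j k <= \sum_(a < s.+1) \sum_(b < s.+1) \sum_(c < s.+1 | (a + b + c <= s)%N) T a b c.
Proof.
move=> ijk T0.
have si : (i < s.+1)%N by lia.
have sj : (j < s.+1)%N by lia.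
have sk : (k < s.+1)%N by lia.
have T1 a b : 0 <= \sum_(c < s.+1 | (a + b + c <= s)%N) T a b c by exact: sumr_ge0.
have T2 a : 0 <= \sum_(b < s.+1) \sum_(c < s.+1 | (a + b + c <= s)%N) T a b c.
  by apply: sumr_ge0 => b _; exact: T1.
rewrite (bigD1 (Ordinal si)) //= (bigD1 (Ordinal sj)) //= (bigD1 (Ordinal sk)) //=.
rewrite -!addrA lerDl; apply: addr_ge0; first exact: sumr_ge0.
by apply: addr_ge0; apply: sumr_ge0.
Qed.

Section FourierDecay.
Variables (R : realType) (L : R).
Hypothesis L_gt0 : 0 < L.
Implicit Types (f g F G : R -> R -> R -> R) (a b x y z : R) (l m n : int).
Notation normc := (@Normc.normc R).

(** The three coordinate directions are treated at once: the direction is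
    0, 1, and anything else for the third one. *)
Definition is_partial (e : nat) F G : Prop := forall x y z,
  match e with
  | 0%N => is_derive x 1 (fun t => F t y z) (G x y z)
  | 1%N => is_derive y 1 (fun t => F x t z) (G x y z)
  | _ => is_derive z 1 (fun t => F x y t) (G x y z)
  end.

Definition partial_dir (e : nat) F : R -> R -> R -> R :=
  match e with 0%N => partial_x F | 1%N => partial_y F | _ => partial_z F end.

Definition freq (l m n : int) (e : nat) : R :=
  2 * pi * (match e with 0%N => l | 1%N => m | _ => n end)%:~R / L.

Definition phase (l m n : int) : R -> R -> R -> R :=
  fun x y z => 2 * pi * (l%:~R * x + m%:~R * y + n%:~R * z) / L.

Lemma is_partialM e F F' G G' : is_partial e F F' -> is_partial e G G' ->
  is_partial e (fun x y z => F x y z * G x y z)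
    (fun x y z => F' x y z * G x y z + F x y z * G' x y z).
Proof.
have key (u v : R -> R) (t u' v' : R) : is_derive t 1 u u' -> is_derive t 1 v v' ->
    is_derive t 1 (fun t => u t * v t) (u' * v t + u t * v').
  move=> du dv; have h := is_deriveM du dv; apply: is_derive_eq h _.
  by rewrite addrC /= -![_ *: _]/(_ * _) mulrC.
by move=> dF dG x y z; have := dF x y z; have := dG x y z;
  case: e dF dG => [|[|e]] _ _ hG hF; apply: key.
Qed.

Lemma integral3_partial e F G : continuous3 F -> continuous3 G -> periodic3 L F ->
  is_partial e F G -> integral3 L G = 0.
Proof.
move=> cF cG pF; case: e => [|[|e]] dF.
- apply: (integral3_dx L_gt0 cF cG dF) => y z.
  by have [h _ _] := pF 0 y z; rewrite add0r in h.
- apply: (integral3_dy L_gt0 cF cG dF) => x z.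
  by have [_ h _] := pF x 0 z; rewrite add0r in h.
- apply: (integral3_dz L_gt0 cG dF) => x y.
  by have [_ _ h] := pF x y 0; rewrite add0r in h.
Qed.

Lemma is_derive_affine a b x : is_derive x 1 (fun t : R => a * t + b) a.
Proof.
have h : is_derive x 1 ((fun t : R => a * t) + cst b) (a + 0).
  apply: is_deriveD.
  have := @is_deriveZ _ _ _ (@id R) a x 1 1 (is_derive_id x 1).
  by rewrite -![_ *: _]/(_ * _) mulr1.
by rewrite addr0 in h.
Qed.

Lemma is_partial_comp e (u v : R -> R) l m n : (forall t : R, is_derive t 1 u (v t)) ->
  is_partial e (fun x y z => u (phase l m n x y z))
    (fun x y z => freq l m n e * v (phase l m n x y z)).
Proof.
move=> du x y z.
have key (w : R -> R) (t a b : R) : (forall t, w t = a * t + b) ->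
    is_derive t 1 (fun t => u (w t)) (a * v (w t)).
  move=> hw; have -> : w = (fun t => a * t + b) by apply/funext.
  have := @is_derive1_comp _ u (fun t => a * t + b) t _ _ (du _) (is_derive_affine a b t).
  by rewrite mulrC.
have L0 : L != 0 by rewrite gt_eqF.
case: e => [|[|e]]; rewrite /freq.
- by apply: (key _ _ _ (2 * pi * (m%:~R * y + n%:~R * z) / L)) => t; rewrite /phase; field.
- by apply: (key _ _ _ (2 * pi * (l%:~R * x + n%:~R * z) / L)) => t; rewrite /phase; field.
- by apply: (key _ _ _ (2 * pi * (l%:~R * x + m%:~R * y) / L)) => t; rewrite /phase; field.
Qed.

Lemma phase_continuous (u : R -> R) l m n : continuous u ->
  continuous3 (fun x y z => u (phase l m n x y z)).
Proof.
move=> cu p; apply: (@continuous_comp _ _ _ (fun p : R * R * R => phase l m n p.1.1 p.1.2 p.2) u); last exact: cu.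
apply: cvgM; last exact: cvg_cst.
apply: cvgM; first exact: cvg_cst.
apply: cvgD; first (apply: cvgD); apply: cvgM; try exact: cvg_cst.
- by apply: (@continuous_comp _ _ _ (fun p : R * R * R => p.1) (fun p => p.1)); exact: cvg_fst.
- by apply: (@continuous_comp _ _ _ (fun p : R * R * R => p.1) (fun p => p.2)); [exact: cvg_fst|exact: cvg_snd].
- exact: cvg_snd.
Qed.

Lemma expi_phase_periodic l m n : forall x y z,
  [/\ expi (phase l m n (x + L) y z) = expi (phase l m n x y z),
      expi (phase l m n x (y + L) z) = expi (phase l m n x y z)
    & expi (phase l m n x y (z + L)) = expi (phase l m n x y z)].
Proof.
move=> x y z; have L0 : L != 0 by rewrite gt_eqF.
split.
- by rewrite -[RHS]mulr1 -(expi_2piz R l) -expiD; congr expi; rewrite /phase; field.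
- by rewrite -[RHS]mulr1 -(expi_2piz R m) -expiD; congr expi; rewrite /phase; field.
- by rewrite -[RHS]mulr1 -(expi_2piz R n) -expiD; congr expi; rewrite /phase; field.
Qed.

Lemma cos_phase_periodic l m n : periodic3 L (fun x y z => cos (phase l m n x y z)).
Proof.
move=> x y z; have [e1 e2 e3] := expi_phase_periodic l m n x y z.
by split; [move: e1|move: e2|move: e3] => /(congr1 (@complex.Re R)).
Qed.

Lemma sin_phase_periodic l m n : periodic3 L (fun x y z => sin (phase l m n x y z)).
Proof.
move=> x y z; have [e1 e2 e3] := expi_phase_periodic l m n x y z.
by split; [move: e1|move: e2|move: e3] => /(congr1 (@complex.Im R)).
Qed.

Lemma periodic3M f g : periodic3 L f -> periodic3 L g ->
  periodic3 L (fun x y z => f x y z * g x y z).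
Proof. by move=> hf hg x y z; have [-> -> ->] := hf x y z; have [-> -> ->] := hg x y z. Qed.

Definition cos_coef f l m n := integral3 L (fun x y z => f x y z * cos (phase l m n x y z)).
Definition sin_coef f l m n := integral3 L (fun x y z => f x y z * sin (phase l m n x y z)).

Lemma fourier_coefE f l m n : continuous3 f ->
  fourier_coef L f l m n = Complex (L ^- 3 * cos_coef f l m n) (L ^- 3 * - sin_coef f l m n).
Proof.
move=> cf; rewrite /fourier_coef; congr (Complex _ (_ * _)).
have cs : continuous3 (fun x y z => f x y z * sin (phase l m n x y z)).
  by apply: continuous3M => //; apply: phase_continuous; exact: continuous_sin.
rewrite -[RHS]mulN1r /sin_coef -(integral3Z L_gt0 (-1) cs).
apply: (f_equal (integral3 L)); apply/funext => x; apply/funext => y; apply/funext => z.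
by rewrite mulN1r -mulrN.
Qed.

Lemma normc_fourier_coef f l m n : continuous3 f ->
  normc (fourier_coef L f l m n) = L ^- 3 * Num.sqrt (cos_coef f l m n ^+ 2 + sin_coef f l m n ^+ 2).
Proof.
move=> cf; rewrite fourier_coefE // normcE /= !exprMn sqrrN -mulrDr sqrtrM ?sqr_ge0 //.
by rewrite sqrtr_sqr ger0_norm // invr_ge0 exprn_ge0 // ltW.
Qed.

(** Integration by parts against the cosine and the sine. *)
Lemma fourier_coef_partial e f f' l m n : continuous3 f -> continuous3 f' ->
  periodic3 L f -> is_partial e f f' ->
  normc (fourier_coef L f' l m n) = `|freq l m n e| * normc (fourier_coef L f l m n).
Proof.
move=> cf cf' pf df; suff e0 : Num.sqrt (cos_coef f' l m n ^+ 2 + sin_coef f' l m n ^+ 2) =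
    `|freq l m n e| * Num.sqrt (cos_coef f l m n ^+ 2 + sin_coef f l m n ^+ 2).
  apply: (etrans (normc_fourier_coef l m n cf')); apply: (etrans (congr1 _ e0)).
  apply: esym; apply: (etrans (congr1 _ (normc_fourier_coef l m n cf))).
  exact: mulrCA.
have cc : continuous3 (fun x y z => cos (phase l m n x y z)).
  by apply: phase_continuous; exact: continuous_cos.
have cs : continuous3 (fun x y z => sin (phase l m n x y z)).
  by apply: phase_continuous; exact: continuous_sin.
have i1 := is_partialM df (@is_partial_comp e (@cos R) (fun t => - sin t) l m n (@is_derive_cos R)).
have i2 := is_partialM df (@is_partial_comp e (@sin R) (@cos R) l m n (@is_derive_sin R)).
have comb u v a : continuous3 u -> continuous3 v ->
    integral3 L (fun x y z => u x y z + a * v x y z) = integral3 L u + a * integral3 L v.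
  move=> cu cv; have cav := continuous3M (@continuous3_cst R a) cv.
  exact: (etrans (integral3D L_gt0 cu cav) (congr1 _ (integral3Z L_gt0 a cv))).
have cfc := continuous3M cf cc; have cfs := continuous3M cf cs.
have cfc' := continuous3M cf' cc; have cfs' := continuous3M cf' cs.
have ck a u : continuous3 u -> continuous3 (fun x y z => a * u x y z).
  exact: continuous3M (@continuous3_cst R a).
have h1 : cos_coef f' l m n = freq l m n e * sin_coef f l m n.
  have e1 : integral3 L (fun x y z => f' x y z * cos (phase l m n x y z) +
      - freq l m n e * (f x y z * sin (phase l m n x y z))) = 0.
    apply: (integral3_partial cfc (continuous3D cfc' (ck _ _ cfs))).
      exact: periodic3M pf (cos_phase_periodic l m n).
    have -> : (fun x y z => f' x y z * cos (phase l m n x y z) +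
      - freq l m n e * (f x y z * sin (phase l m n x y z))) = (fun x y z =>
      f' x y z * cos (phase l m n x y z) + f x y z * (freq l m n e * - sin (phase l m n x y z))).
      by apply/funext => x; apply/funext => y; apply/funext => z; ring.
    exact: i1.
  have : cos_coef f' l m n + - freq l m n e * sin_coef f l m n = 0.
    exact: (etrans (esym (comb _ _ _ cfc' cfs)) e1).
  by move: (cos_coef f' l m n) (sin_coef f l m n) => u v; lra.
have h2 : sin_coef f' l m n = - freq l m n e * cos_coef f l m n.
  have e2 : integral3 L (fun x y z => f' x y z * sin (phase l m n x y z) +
      freq l m n e * (f x y z * cos (phase l m n x y z))) = 0.
    apply: (integral3_partial cfs (continuous3D cfs' (ck _ _ cfc))).
      exact: periodic3M pf (sin_phase_periodic l m n).
    have -> : (fun x y z => f' x y z * sin (phase l m n x y z) +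
      freq l m n e * (f x y z * cos (phase l m n x y z))) = (fun x y z =>
      f' x y z * sin (phase l m n x y z) + f x y z * (freq l m n e * cos (phase l m n x y z))).
      by apply/funext => x; apply/funext => y; apply/funext => z; ring.
    exact: i2.
  have : sin_coef f' l m n + freq l m n e * cos_coef f l m n = 0.
    exact: (etrans (esym (comb _ _ _ cfs' cfc)) e2).
  by move: (sin_coef f' l m n) (cos_coef f l m n) => u v; lra.
rewrite h1 h2; move: (sin_coef f l m n) (cos_coef f l m n) (freq l m n e) => u v w.
rewrite !exprMn sqrrN -mulrDr sqrtrM ?sqr_ge0 // sqrtr_sqr.
by rewrite [in LHS]addrC.
Qed.

Lemma partial_dir_periodic e f : periodic3 L f -> periodic3 L (partial_dir e f).
Proof.
move=> pf.
have tr (u : R -> R) t : (forall t, u (t + L) = u t) -> derive1 u (t + L) = derive1 u t.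
  move=> hu; rewrite /derive1.
  have -> // : (fun h : R => h^-1 *: (u (h + (t + L)) - u (t + L))) =
      (fun h => h^-1 *: (u (h + t) - u t)).
  by apply/funext => h; rewrite addrA !hu.
have h1 x y z : f (x + L) y z = f x y z by case: (pf x y z).
have h2 x y z : f x (y + L) z = f x y z by case: (pf x y z).
have h3 x y z : f x y (z + L) = f x y z by case: (pf x y z).
move=> x y z; case: e => [|[|e]]; rewrite /= /partial_x /partial_y /partial_z; split.
- by apply: tr.
- by congr derive1; apply/funext => t.
- by congr derive1; apply/funext => t.
- by congr derive1; apply/funext => t.
- by apply: tr.
- by congr derive1; apply/funext => t.
- by congr derive1; apply/funext => t.
- by congr derive1; apply/funext => t.
- by apply: tr.
Qed.

Lemma class_C_continuous s f : class_C s f -> continuous3 f.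
Proof. by case: s => [//|s] []. Qed.

Lemma is_derive_derive1 (u : R -> R) (t : R) : derivable u t 1 ->
  is_derive t 1 u (derive1 u t).
Proof. by move=> h; rewrite derive1E; exact: DeriveDef. Qed.

Lemma class_C_partial e s f : class_C s.+1 f ->
  class_C s (partial_dir e f) /\ is_partial e f (partial_dir e f).
Proof.
move=> [cf df fx fy fz]; case: e => [|[|e]];
  (split; first by []) => x y z; have [hx hy hz] := df x y z.
- exact: (is_derive_derive1 hx).
- exact: (is_derive_derive1 hy).
- exact: (is_derive_derive1 hz).
Qed.

Lemma fourier_coef_iter e s f l m n : class_C s f -> periodic3 L f ->
  `|freq l m n e| ^+ s * normc (fourier_coef L f l m n) =
  normc (fourier_coef L (iter s (partial_dir e) f) l m n) /\
  continuous3 (iter s (partial_dir e) f).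
Proof.
elim: s f => [|s IH] f cf pf; first by rewrite expr0 mul1r; split=> //; exact: cf.
have [cf' df] := class_C_partial e cf.
have pf' := partial_dir_periodic e pf.
have [e1 h] := IH _ cf' pf'; rewrite iterSr; split; last exact: h.
apply: (etrans _ e1); rewrite exprSr -mulrA.
exact: (congr1 _ (esym (fourier_coef_partial l m n (class_C_continuous cf)
  (class_C_continuous cf') pf df))).
Qed.

(** From |g u| <= (g ^ 2 + 1) / 2, valid for |u| <= 1. *)
Lemma fourier_coef_le g l m n M : continuous3 g ->
  integral3 L (fun x y z => g x y z ^+ 2) <= M ->
  normc (fourier_coef L g l m n) <= L ^- 3 * (M + L ^+ 3).
Proof.
move=> cg hM; rewrite (normc_fourier_coef l m n cg).
apply: ler_wpM2l; first by rewrite invr_ge0 exprn_ge0 // ltW.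
have cg2 : continuous3 (fun x y z => g x y z ^+ 2).
  by have -> : (fun x y z => g x y z ^+ 2) = (fun x y z => g x y z * g x y z) by []; exact: continuous3M.
have bound (u : R -> R -> R -> R) : continuous3 u -> (forall x y z, `|u x y z| <= 1) ->
    `|integral3 L (fun x y z => g x y z * u x y z)| <= (M + L ^+ 3) / 2.
  move=> cu u1.
  pose w x y z := 2^-1 * (g x y z ^+ 2 + 1).
  have cw : continuous3 w.
    apply: (continuous3M (@continuous3_cst R _)).
    exact: continuous3D cg2 (@continuous3_cst R 1).
  have cgu := continuous3M cg cu.
  have iw : integral3 L w <= (M + L ^+ 3) / 2.
    rewrite integral3Z //; last exact: continuous3D cg2 (@continuous3_cst R 1).
    rewrite (integral3D L_gt0 cg2 (@continuous3_cst R 1)) integral3_cst // mul1r.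
    by rewrite [leRHS]mulrC ler_wpM2l // lerD2r.
  have pw x y z (s : R) : s ^+ 2 = 1 -> s * (g x y z * u x y z) <= w x y z.
    move=> s1; apply: mul_le_half_sqr => //.
    by rewrite -real_normK ?num_real // expr_le1.
  have sgn (s : R) : s ^+ 2 = 1 ->
      s * integral3 L (fun x y z => g x y z * u x y z) <= (M + L ^+ 3) / 2.
    move=> s1; apply: le_trans iw; rewrite -(integral3Z L_gt0 s cgu).
    apply: (integral3_le L_gt0 _ cw) => [|x y z]; last exact: pw.
    exact: continuous3M (@continuous3_cst R _) cgu.
  apply: normr_le_sgn; apply: sgn; first exact: expr1n.
  by rewrite sqrrN expr1n.
have hc : `|cos_coef g l m n| <= (M + L ^+ 3) / 2.
  apply: bound; last by move=> x y z; exact: cos_max.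
  apply: phase_continuous; exact: continuous_cos.
have hs : `|sin_coef g l m n| <= (M + L ^+ 3) / 2.
  apply: bound; last by move=> x y z; exact: sin_max.
  apply: phase_continuous; exact: continuous_sin.
have := normc_le_ReIm (Complex (cos_coef g l m n) (sin_coef g l m n)).
rewrite normcE /= => h; apply: (le_trans h); apply: (le_trans (lerD hc hs)).
by rewrite -splitr.
Qed.

Lemma sobolev_norm_partial s f B (i j k : nat) : (i + j + k <= s)%N ->
  sobolev_norm L s f <= B ->
  integral3 L (fun x y z => partial i j k f x y z ^+ 2) <= B ^+ 2.
Proof.
move=> ijk; rewrite /sobolev_norm; set S := \sum_(_ < _) _ => hS.
pose T (i j k : nat) := integral3 L (fun x y z => partial i j k f x y z ^+ 2).
have T0 i' j' k' : 0 <= T i' j' k' by apply: integral3_ge0 => x y z; exact: sqr_ge0.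
have TS : T i j k <= S := term_le_sum3 ijk T0.
have S0 : 0 <= S := le_trans (T0 i j k) TS.
apply: le_trans TS _; rewrite -(sqr_sqrtr S0) lerXn2r // nnegrE ?sqrtr_ge0 //.
exact: le_trans (sqrtr_ge0 _) hS.
Qed.

End FourierDecay.

(** * Decay of the initial grid function *)

(** The largest of 1, a, b and d dominates the sum up to a constant. *)
Lemma expr_max4_bound (R : realFieldType) (a b d S c D : R) (j : nat) :
  0 <= a -> 0 <= b -> 0 <= d -> 0 <= S -> S <= 4 / 3 * (a + b + d) -> 0 <= c -> c <= D ->
  a ^+ j * c <= D -> b ^+ j * c <= D -> d ^+ j * c <= D ->
  (1 + S) ^+ j * c <= 6 ^+ j * D.
Proof.
move=> a0 b0 d0 S0 hS c0 hc ha hb hd.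
pose M := Num.max (Num.max 1 a) (Num.max b d).
have h1 : 1 <= M by rewrite /M !le_max lexx.
have h2 : a <= M by rewrite /M !le_max lexx orbT.
have h3 : b <= M by rewrite /M !le_max lexx !orbT.
have h4 : d <= M by rewrite /M !le_max lexx !orbT.
have hM : M ^+ j * c <= D.
  have [] : M = 1 \/ M = a \/ M = b \/ M = d.
    by rewrite /M /Num.max; do ![case: ifP => _]; tauto.
  - by move=> ->; rewrite expr1n mul1r.
  - by case=> [->|[]->].
have : (1 + S) ^+ j <= (6 * M) ^+ j by apply: lerXn2r; rewrite ?nnegrE; lra.
move=> /(ler_wpM2r c0) /le_trans; apply.
by rewrite exprMn -mulrA ler_wpM2l // exprn_ge0.
Qed.

Section InitialGrid.
Variables (R : realType) (K : nat) (L : R).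
Hypothesis L_gt0 : 0 < L.
Notation N := (2 * K + 1)%N.
Notation h := (mesh K L).
Notation normc := (@Normc.normc R).
Notation dft := (dft_coef K L).
Notation weight := (weight K L).
Notation symb := (symb K L).
Implicit Types (l m n : int) (a b c : int).

Lemma mu1_le_freq l : mu1 K L l <= freq L l 0 0 0 ^+ 2.
Proof.
have Np : 0 < N%:R :> R by rewrite ltr0n addn1.
have L0 := L_gt0.
rewrite /mu1 ler_pdivrMr; last by rewrite exprn_gt0 // mesh_gt0.
apply: le_trans (two_sub_cos_le _) _; rewrite /freq /mesh.
move: (N%:R) Np => q q0; rewrite le_eqVlt; apply/orP; left; apply/eqP; field.
by rewrite !lt0r_neq0.
Qed.

Lemma symb_le_freq l m n : symb l m n <=
  4 / 3 * (freq L l m n 0 ^+ 2 + freq L l m n 1 ^+ 2 + freq L l m n 2 ^+ 2).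
Proof.
have h1 := mu1_le_freq l; have h2 := mu1_le_freq m; have h3 := mu1_le_freq n.
have := sym1_le K L_gt0 l; have := sym1_le K L_gt0 m; have := sym1_le K L_gt0 n.
rewrite /symb /freq in h1 h2 h3 *; lra.
Qed.

(** Since 1 + symb is comparable to the largest of 1 and the three squared
    frequencies, it is enough to integrate by parts 2 j times in one direction. *)
Lemma fourier_coef_weight j f B l m n : class_C (2 * j) f -> periodic3 L f ->
  sobolev_norm L (2 * j) f <= B ->
  normc (fourier_coef L f l m n) * weight l m n ^+ (8 * j) <=
  6 ^+ j * (L ^- 3 * (B ^+ 2 + L ^+ 3)).
Proof.
move=> cf pf hB.
have it e : integral3 L (fun x y z => iter (2 * j) (partial_dir e) f x y z ^+ 2) <= B ^+ 2 ->
    (freq L l m n e ^+ 2) ^+ j * normc (fourier_coef L f l m n) <= L ^- 3 * (B ^+ 2 + L ^+ 3).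
  move=> hI; have [h1 h2] := fourier_coef_iter L_gt0 e l m n cf pf.
  have -> : (freq L l m n e ^+ 2) ^+ j = `|freq L l m n e| ^+ (2 * j).
    by rewrite exprM real_normK ?num_real.
  apply: (le_trans _ (fourier_coef_le L_gt0 l m n h2 hI)).
  by rewrite le_eqVlt; apply/orP; left; apply/eqP; exact: h1.
have j1 : (2 * j + 0 + 0 <= 2 * j)%N by rewrite !addn0.
have j2 : (0 + 2 * j + 0 <= 2 * j)%N by rewrite addn0.
have j3 : (0 + 0 + 2 * j <= 2 * j)%N by [].
have j0 : (0 + 0 + 0 <= 2 * j)%N by [].
have b1 := it 0 (sobolev_norm_partial j1 hB).
have b2 := it 1 (sobolev_norm_partial j2 hB).
have b3 := it 2 (sobolev_norm_partial j3 hB).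
have b0 := fourier_coef_le L_gt0 l m n (class_C_continuous cf) (sobolev_norm_partial j0 hB).
rewrite mulrC exprM weight8.
apply: (expr_max4_bound (sqr_ge0 _) (sqr_ge0 _) (sqr_ge0 _) _ (symb_le_freq l m n) _ b0 b1 b2 b3).
  exact: symb_ge0.
exact: normc_ge0.
Qed.

Definition mode_wave (c : R[i]) l m n : grid_fun R := fun i j k =>
  complex.Re (c * wave L l m n (node K L i) (node K L j) (node K L k)).

Lemma wave_node_shift l m n a b c i j k :
  wave L l m n (node K L (i + a)) (node K L (j + b)) (node K L (k + c)) =
  expi (angle R K (l * a + m * b + n * c)) *
  wave L l m n (node K L i) (node K L j) (node K L k).
Proof.
have L0 : L != 0 by rewrite gt_eqF.
have : N%:R != 0 :> R by rewrite pnatr_eq0 addn1.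
rewrite /wave -expiD => q0; congr expi.
rewrite /angle /node !intrD !intrM; move: q0; rewrite /mesh; move: (N%:R) => q q0; field.
by rewrite L0 q0.
Qed.

Lemma Re_expi_sum (z : R[i]) (t : R) :
  complex.Re (expi t * z) - 2 * complex.Re z + complex.Re (expi (- t) * z) =
  - (2 - 2 * cos t) * complex.Re z.
Proof. by case: z => p r; rewrite /expi cosN sinN /=; ring. Qed.

Lemma second_diff_mode cc l m n a b c : second_diff K L a b c (mode_wave cc l m n) =
  fun i j k => - mu1 K L (l * a + m * b + n * c) * mode_wave cc l m n i j k.
Proof.
apply/funext => i; apply/funext => j; apply/funext => k.
rewrite /second_diff /translate /mode_wave !wave_node_shift !(mulrCA cc).
rewrite (_ : l * - a + m * - b + n * - c = - (l * a + m * b + n * c)); last by ring.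
have -> q : angle R K (- q) = - angle R K q by rewrite /angle intrN mulrN mulNr.
by rewrite Re_expi_sum /mu1 -/(angle R K _); ring.
Qed.

Lemma second_diffZ a b c (x : R) (f : grid_fun R) i j k :
  second_diff K L a b c (fun i j k => x * f i j k) i j k = x * second_diff K L a b c f i j k.
Proof. by rewrite /second_diff /translate; ring. Qed.

Lemma stencil4_mode cc l m n a b c i j k : stencil4 K L a b c (mode_wave cc l m n) i j k =
  - sym1 K L (l * a + m * b + n * c) * mode_wave cc l m n i j k.
Proof.
rewrite /stencil4 second_diff_mode; set q := l * a + m * b + n * c.
have -> : (fun i j k => mode_wave cc l m n i j k - h ^+ 2 / 12 * (- mu1 K L q * mode_wave cc l m n i j k))
  = (fun i j k => (1 + h ^+ 2 / 12 * mu1 K L q) * mode_wave cc l m n i j k).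
  by apply/funext => i'; apply/funext => j'; apply/funext => k'; ring.
by rewrite second_diffZ second_diff_mode /sym1 -/q; ring.
Qed.

Lemma lap4_mode cc l m n i j k : lap4 K L (mode_wave cc l m n) i j k =
  - symb l m n * mode_wave cc l m n i j k.
Proof.
rewrite lap4E !stencil4_mode !mulr0 !mulr1 !addr0 !add0r /symb; ring.
Qed.

Lemma Vper_mode cc l m n : Vper K (mode_wave cc l m n).
Proof.
rewrite VperE => i j k.
have e q : expi (angle R K (q * N%:Z)) = 1.
  rewrite -(expi_angle_period R K (- q)); congr expi.
  by rewrite /angle mulNr intrN mulrN mulNr opprK.
rewrite /mode_wave; split; congr (complex.Re (_ * _)).
- have := wave_node_shift l m n N%:Z 0 0 i j k.
  by rewrite !addr0 !mulr0 !addr0 e mul1r.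
- have := wave_node_shift l m n 0 N%:Z 0 i j k.
  by rewrite !addr0 !mulr0 !addr0 add0r e mul1r.
- have := wave_node_shift l m n 0 0 N%:Z i j k.
  by rewrite !addr0 !mulr0 !add0r e mul1r.
Qed.

(** A single wave is an eigenfunction of the grid Laplacian, so its coefficients
    vanish at the frequencies with another symbol, and all the others carry the
    same weight.  This covers the aliased copies of the frequency. *)
Lemma dft_mode_weight cc l m n l' m' n' q :
  normc (dft (mode_wave cc l m n) l' m' n') * weight l' m' n' ^+ q <=
  normc cc * weight l m n ^+ q.
Proof.
set e := mode_wave cc l m n.
have w0 a b c : 0 <= weight a b c ^+ q.
  by rewrite exprn_ge0 // ltW // weight_gt0.
have h1 := dft_lap4 L_gt0 l' m' n' (Vper_mode cc l m n).
have h2 : dft (lap4 K L e) l' m' n' = Complex (- symb l m n) 0 * dft e l' m' n'.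
  rewrite (@eq_dft _ K L _ (fun i j k => - symb l m n * e i j k + 0 * e i j k)).
    rewrite dft_lin -[X in _ + X](_ : 0 = _) ?addr0 //.
    by rewrite -[Complex 0 0]/(0 : R[i]) mul0r.
  by move=> i j k; rewrite lap4_mode -/e; ring.
have [es|ns] := eqVneq (symb l' m' n') (symb l m n).
  have -> : weight l' m' n' = weight l m n by rewrite /weight es.
  apply: ler_wpM2r => //; apply: le_trans (normc_dft_le _ _ _ _ _ _) _.
  have N3 : N%:R ^+ 3 != 0 :> R by rewrite expf_neq0 // pnatr_eq0 addn1.
  apply: (@le_trans _ _ (N%:R ^- 3 * total K (fun _ _ _ => normc cc))); last first.
    by rewrite total_cst mulKf.
  apply: ler_wpM2l; first by rewrite invr_ge0 exprn_ge0.
  apply: ler_total => i j k; apply: le_trans (normr_Re_le _) _.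
  by rewrite Normc.normcM /wave normc_expi mulr1.
have -> : dft e l' m' n' = 0.
  have : (Complex (- symb l' m' n') 0 - Complex (- symb l m n) 0) * dft e l' m' n' = 0.
    by rewrite mulrBl -h2 -h1 subrr.
  move/eqP; rewrite mulf_eq0 => /orP[|/eqP //].
  by rewrite subr_eq0 => /eqP[/oppr_inj ez]; rewrite ez eqxx in ns.
by rewrite Normc.normc0 mul0r mulr_ge0 ?normc_ge0.
Qed.

Lemma trig_sumE (c : int -> int -> int -> R[i]) x y z :
  trig_sum K L c x y z = mode_total K (fun l m n => c l m n * wave L l m n x y z).
Proof. by []. Qed.

Lemma Re_mode_total (F : int -> int -> int -> R[i]) :
  complex.Re (mode_total K F) = mode_total K (fun l m n => complex.Re (F l m n)).
Proof.
have ReD (z w : R[i]) : complex.Re (z + w) = complex.Re z + complex.Re w by case: z; case: w.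
have Re0 : complex.Re (0 : R[i]) = 0 by [].
rewrite /mode_total (big_morph _ ReD Re0); apply: eq_bigr => l _.
rewrite (big_morph _ ReD Re0); apply: eq_bigr => m _.
by rewrite (big_morph _ ReD Re0).
Qed.

Lemma dft_mode_total (F : int -> int -> int -> grid_fun R) l m n :
  dft (fun i j k => mode_total K (fun l' m' n' => F l' m' n' i j k)) l m n =
  mode_total K (fun l' m' n' => dft (F l' m' n') l m n).
Proof.
have C0 : Complex (0 : R) 0 = 0 by [].
have CS (G : int -> int -> int -> R) : Complex (mode_total K G) 0 =
    mode_total K (fun l m n => Complex (G l m n) 0) :> R[i].
  have CD x y : Complex (x + y) 0 = Complex x 0 + Complex y 0 :> R[i] by exact: ComplexD.
  rewrite /mode_total (big_morph (fun x => Complex x 0) CD C0); apply: eq_bigr => i _.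
  rewrite (big_morph (fun x => Complex x 0) CD C0); apply: eq_bigr => j _.
  by rewrite (big_morph (fun x => Complex x 0) CD C0).
rewrite dftE.
transitivity (N%:R ^- 3 * total K (fun i j k => mode_total K (fun l' m' n' =>
    gwave K L l m n i j k * Complex (F l' m' n' i j k) 0))).
  congr (_ * _); apply: eq_total => i j k.
  by rewrite CS mulrC -mode_totalZ.
rewrite total_exchange -mode_totalZ.
apply: eq_bigr => l' _; apply: eq_bigr => m' _; apply: eq_bigr => n' _.
rewrite dftE; congr (_ * _); apply: eq_total => i j k; exact: mulrC.
Qed.

(** The initial grid function is the sum of the sampled waves of the truncated
    Fourier series; fifteen of the 8 j powers pay for the summation. *)
Lemma decay_initial_grid (j q : nat) f B Z0 : (q + 15 <= 8 * j)%N ->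
  2 <= Z0 -> L ^+ 2 <= 2 * Z0 ->
  class_C (2 * j) f -> periodic3 L f -> sobolev_norm L (2 * j) f <= B ->
  decay K L q (6 ^+ j * (L ^- 3 * (B ^+ 2 + L ^+ 3)) * Z0 ^+ 25) (initial_grid K L f).
Proof.
move=> qj Z2 ZL cf pf hB l m n; set D := 6 ^+ j * _.
pose c l m n := fourier_coef L f l m n.
have -> : initial_grid K L f = fun i j k =>
    mode_total K (fun l m n => mode_wave (c l m n) l m n i j k).
  apply/funext => i; apply/funext => i'; apply/funext => k.
  by rewrite /initial_grid /fourier_truncation trig_sumE Re_mode_total.
rewrite dft_mode_total.
have w0 := ltW (weightX_gt0 K L l m n q).
apply: le_trans (ler_wpM2r w0 (ler_normc_mode_total _ _)) _.
rewrite mulrC -mode_totalZ.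
have D0 : 0 <= D.
  apply: mulr_ge0; first exact: exprn_ge0.
  apply: mulr_ge0; first by rewrite invr_ge0 exprn_ge0 // ltW.
  by rewrite addr_ge0 ?sqr_ge0 // exprn_ge0 // ltW.
apply: (@le_trans _ _ (mode_total K (fun l' m' n' => D * weight l' m' n' ^- 15))).
  apply: ler_mode_total => l' m' n'; rewrite mulrC.
  apply: le_trans (dft_mode_weight _ _ _ _ _ _ _ _) _.
  rewrite ler_pdivlMr ?exprn_gt0 ?weight_gt0 //.
  rewrite -mulrA -exprD; apply: le_trans (fourier_coef_weight l' m' n' cf pf hB).
  by rewrite ler_wpM2l ?normc_ge0 // ler_weXn2l // weight_ge1.
by rewrite mode_totalZ ler_wpM2l //; exact: weight_sum.
Qed.

End InitialGrid.

(** * Sobolev norms of trigonometric sums *)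

Section TrigonometricSums.
Variables (R : realType) (K : nat) (L Z : R).
Hypotheses (L_gt0 : 0 < L) (Z_ge2 : 2 <= Z) (Z_L2 : L ^+ 2 <= 2 * Z).
Notation N := (2 * K + 1)%N.
Notation normc := (@Normc.normc R).
Notation weight := (weight K L).
Implicit Types (c : int -> int -> int -> R[i]) (F G : R -> R -> R -> R) (l m n : int).

Definition re_trig_sum c : R -> R -> R -> R :=
  fun x y z => complex.Re (trig_sum K L c x y z).

Definition re_wave (a : R[i]) l m n : R -> R -> R -> R := fun x y z =>
  complex.Re (a * wave L l m n x y z).

(** Multiplier of the Fourier coefficients for the derivative in direction e. *)
Definition diff_coef (e : nat) c : int -> int -> int -> R[i] := fun l m n =>
  Complex 0 (freq L l m n e) * c l m n.

Lemma re_waveE a l m n : re_wave a l m n = fun x y z =>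
  complex.Re a * cos (phase L l m n x y z) + - complex.Im a * sin (phase L l m n x y z).
Proof.
apply/funext => x; apply/funext => y; apply/funext => z.
by rewrite /re_wave /wave /expi; case: a => p r /=; rewrite /phase mulNr.
Qed.

Lemma re_trig_sumE c : re_trig_sum c = fun x y z =>
  mode_total K (fun l m n => re_wave (c l m n) l m n x y z).
Proof.
apply/funext => x; apply/funext => y; apply/funext => z.
by rewrite /re_trig_sum trig_sumE Re_mode_total.
Qed.

(** Used with a property of one function, such as continuity, and with the
    relation between a function and its derivative. *)
Lemma sum_closed (Pr : (R -> R -> R -> R) -> (R -> R -> R -> R) -> Prop)
    (I : Type) (r : seq I) (F G : I -> R -> R -> R -> R) :
  Pr (fun _ _ _ => 0) (fun _ _ _ => 0) ->
  (forall f g f' g' : R -> R -> R -> R, Pr f g -> Pr f' g' ->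
     Pr (fun x y z => f x y z + f' x y z) (fun x y z => g x y z + g' x y z)) ->
  (forall i, Pr (F i) (G i)) ->
  Pr (fun x y z => \sum_(i <- r) F i x y z) (fun x y z => \sum_(i <- r) G i x y z).
Proof.
move=> P0 PD PF.
have ext (H : I -> R -> R -> R -> R) s : (fun x y z => \sum_(i <- s) H i x y z) =
    if s is i :: s' then fun x y z => H i x y z + \sum_(i <- s') H i x y z
    else fun _ _ _ => 0.
  apply/funext => x; apply/funext => y; apply/funext => z.
  by case: s => [|i s]; rewrite ?big_nil ?big_cons.
elim: r => [|i r IH]; first by rewrite !ext.
by rewrite (ext F) (ext G); apply: PD.
Qed.

Lemma mode_total_closed (Pr : (R -> R -> R -> R) -> (R -> R -> R -> R) -> Prop)
    (F G : int -> int -> int -> R -> R -> R -> R) :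
  Pr (fun _ _ _ => 0) (fun _ _ _ => 0) ->
  (forall f g f' g' : R -> R -> R -> R, Pr f g -> Pr f' g' ->
     Pr (fun x y z => f x y z + f' x y z) (fun x y z => g x y z + g' x y z)) ->
  (forall l m n, Pr (F l m n) (G l m n)) ->
  Pr (fun x y z => mode_total K (fun l m n => F l m n x y z))
     (fun x y z => mode_total K (fun l m n => G l m n x y z)).
Proof. by move=> P0 PD PF; do 3![apply: sum_closed => // ?]. Qed.

Lemma continuous_re_wave a l m n : continuous3 (re_wave a l m n).
Proof.
rewrite re_waveE; apply: continuous3D; apply: continuous3M; try exact: continuous3_cst.
  by apply: phase_continuous; exact: continuous_cos.
by apply: phase_continuous; exact: continuous_sin.
Qed.

Lemma continuous_re_trig_sum c : continuous3 (re_trig_sum c).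
Proof.
rewrite re_trig_sumE; pose F l m n := re_wave (c l m n) l m n.
apply: (@mode_total_closed (fun f _ => continuous3 f) F F) => [|f _ g _|l m n].
- exact: continuous3_cst.
- exact: continuous3D.
- exact: continuous_re_wave.
Qed.

Lemma is_partialD e F F' G G' : is_partial e F F' -> is_partial e G G' ->
  is_partial e (fun x y z => F x y z + G x y z) (fun x y z => F' x y z + G' x y z).
Proof.
have key (u v : R -> R) (t u' v' : R) : is_derive t 1 u u' -> is_derive t 1 v v' ->
    is_derive t 1 (fun t => u t + v t) (u' + v').
  by move=> du dv; exact: is_deriveD.
by move=> dF dG x y z; have := dF x y z; have := dG x y z;
  case: e dF dG => [|[|e]] _ _ hG hF; apply: key.
Qed.

Lemma is_partial_cst e (a : R) : is_partial e (fun _ _ _ => a) (fun _ _ _ => 0).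
Proof. by case: e => [|[|e]] x y z; exact: is_derive_cst. Qed.

Lemma is_partial_re_wave e c l m n :
  is_partial e (re_wave (c l m n) l m n) (re_wave (diff_coef e c l m n) l m n).
Proof.
set a := c l m n.
have scale (b : R) u v : is_partial e u v ->
    is_partial e (fun x y z => b * u x y z) (fun x y z => b * v x y z).
  move=> h; have := is_partialM (is_partial_cst e b) h.
  by rewrite (_ : (fun x y z => 0 * u x y z + b * v x y z) = (fun x y z => b * v x y z)) //;
    apply/funext => x; apply/funext => y; apply/funext => z; rewrite mul0r add0r.
have h1 := is_partial_comp L_gt0 e l m n (@is_derive_cos R).
have h2 := is_partial_comp L_gt0 e l m n (@is_derive_sin R).
have := is_partialD (scale (complex.Re a) _ _ h1) (scale (- complex.Im a) _ _ h2).
rewrite -re_waveE; set G := fun x y z : R => _ + _.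
suff -> : re_wave (diff_coef e c l m n) l m n = G by [].
rewrite re_waveE /diff_coef /G -/a; apply/funext => x; apply/funext => y; apply/funext => z.
by case: (a) => p r /=; ring.
Qed.

Lemma partial_re_trig_sum e c : partial_dir e (re_trig_sum c) = re_trig_sum (diff_coef e c).
Proof.
have : is_partial e (re_trig_sum c) (re_trig_sum (diff_coef e c)).
  rewrite !re_trig_sumE.
  apply: (@mode_total_closed (is_partial e) (fun l m n => re_wave (c l m n) l m n)
    (fun l m n => re_wave (diff_coef e c l m n) l m n)) => [|F F' G G'|l m n].
  - exact: is_partial_cst.
  - exact: is_partialD.
  - exact: is_partial_re_wave.
move=> h; apply/funext => x; apply/funext => y; apply/funext => z.
by have := h x y z; case: e {h} => [|[|e]] h; rewrite /partial_dir /partial_x /partial_y /partial_z derive1E; exact: derive_val.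
Qed.

Lemma iter_partial_re_trig_sum e s c :
  iter s (partial_dir e) (re_trig_sum c) = re_trig_sum (iter s (diff_coef e) c).
Proof. by elim: s => //= s ->; rewrite partial_re_trig_sum. Qed.

Lemma mixed_partial_re_trig_sum i j p c : partial i j p (re_trig_sum c) =
  re_trig_sum (iter i (diff_coef 0) (iter j (diff_coef 1) (iter p (diff_coef 2) c))).
Proof.
rewrite /partial (iter_partial_re_trig_sum 2 p) (iter_partial_re_trig_sum 1 j).
exact: (iter_partial_re_trig_sum 0 i).
Qed.

(** On the retained modes the symbol is comparable to the squared frequency,
    so each derivative costs four powers of the weight. *)
Lemma freq_le_weight e (l m n : 'I_N) :
  `|freq L (mode l) (mode m) (mode n) e| <= 4 * weight (mode l) (mode m) (mode n) ^+ 4.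
Proof.
set w := weight _ _ _; have w0 : 0 <= w ^+ 4 by rewrite exprn_ge0 // ltW // weight_gt0.
have L0 := L_gt0.
have bound (i : 'I_N) : mu1 K L (mode i) <= symb K L (mode l) (mode m) (mode n) ->
    `|2 * pi * (mode i)%:~R / L| <= 4 * w ^+ 4.
  move=> hi; have w4 : 0 <= 4 * w ^+ 4 by exact: mulr_ge0.
  rewrite -(@ler_pXn2r _ 2) ?nnegrE // real_normK ?num_real //.
  rewrite [leRHS]exprMn -exprM weight8.
  have hp : (pi : R) ^+ 2 <= 4 ^+ 2.
    have p0 := pi_gt0 R; have p4 := pihalf_lt2 R.
    by apply: lerXn2r; rewrite ?nnegrE //; lra.
  have -> : (2 * pi * (mode i)%:~R / L) ^+ 2 = pi ^+ 2 * (4 / L ^+ 2 * (mode i)%:~R ^+ 2).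
    by field; exact: lt0r_neq0.
  apply: (@le_trans _ _ (4 ^+ 2 * mu1 K L (mode i))); last first.
    by apply: ler_wpM2l => //; apply: (le_trans hi); rewrite lerDr.
  apply: ler_pM => //; first exact: sqr_ge0.
    by apply: mulr_ge0; rewrite ?sqr_ge0 // divr_ge0 ?sqr_ge0.
  exact: mu1_mode_ge.
have a1 := sym1_ge0 K L (mode l); have a2 := sym1_ge0 K L (mode m).
have a3 := sym1_ge0 K L (mode n).
have b1 := sym1_ge K L (mode l); have b2 := sym1_ge K L (mode m).
have b3 := sym1_ge K L (mode n).
by case: e => [|[|e]]; rewrite /freq; apply: bound; rewrite /symb; lra.
Qed.

Lemma normc_diff_coef e s c (l m n : 'I_N) :
  normc (iter s (diff_coef e) c (mode l) (mode m) (mode n)) <=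
  4 ^+ s * weight (mode l) (mode m) (mode n) ^+ (4 * s) * normc (c (mode l) (mode m) (mode n)).
Proof.
set w := weight _ _ _.
elim: s => [|s IH]; first by rewrite muln0 !expr0 !mul1r.
rewrite iterS {1}/diff_coef Normc.normcM mulnS exprD exprS.
have -> : normc (Complex 0 (freq L (mode l) (mode m) (mode n) e)) =
    `|freq L (mode l) (mode m) (mode n) e|.
  by rewrite normcE /= expr0n add0r sqrtr_sqr.
rewrite (_ : 4 * 4 ^+ s * (w ^+ 4 * w ^+ (4 * s)) * _ = (4 * w ^+ 4) *
  (4 ^+ s * w ^+ (4 * s) * normc (c (mode l) (mode m) (mode n)))); last by ring.
by apply: ler_pM => //; [exact: normc_ge0|exact: freq_le_weight].
Qed.

Lemma sum3_le_cst (T : nat -> nat -> nat -> R) (k : nat) (D : R) : 0 <= D ->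
  (forall i j p, (i + j + p <= k)%N -> T i j p <= D) ->
  \sum_(a < k.+1) \sum_(b < k.+1) \sum_(d < k.+1 | (a + b + d <= k)%N) T a b d <=
  k.+1%:R ^+ 3 * D.
Proof.
move=> D0 hT.
have cst (E : R) : k.+1%:R * E = \sum_(a < k.+1) E by rewrite sumr_const card_ord mulr_natl.
rewrite !exprS expr0 mulr1 -!mulrA cst; apply: ler_sum => a _.
rewrite cst; apply: ler_sum => b _.
rewrite cst big_mkcond; apply: ler_sum => d _.
by case: ifP => // hd; exact: hT.
Qed.

Lemma re_trig_sum_partial_le c (k i j p : nat) (M : R) x y z : (i + j + p <= k)%N -> 0 <= M ->
  (forall l m n, normc (c l m n) * weight l m n ^+ (4 * k + 15) <= M) ->
  `|partial i j p (re_trig_sum c) x y z| <= 4 ^+ k * Z ^+ 25 * M.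
Proof.
move=> ijp M0 hc.
rewrite mixed_partial_re_trig_sum; set d := iter i _ _.
apply: le_trans (normr_Re_le _) _; rewrite trig_sumE.
apply: le_trans (ler_normc_mode_total _ _) _.
apply: (@le_trans _ _ (mode_total K (fun l m n => 4 ^+ k * M * weight l m n ^- 15))); last first.
  have -> : 4 ^+ k * Z ^+ 25 * M = 4 ^+ k * M * Z ^+ 25 by ring.
  rewrite mode_totalZ; apply: ler_wpM2l; last exact: weight_sum.
  by apply: mulr_ge0 => //; exact: exprn_ge0.
apply: ler_sum => l _; apply: ler_sum => m _; apply: ler_sum => n _.
rewrite Normc.normcM /wave normc_expi mulr1.
set w := weight _ _ _; have w1 : 1 <= w by exact: weight_ge1.
have w0 : 0 < w by exact: weight_gt0.
rewrite ler_pdivlMr ?exprn_gt0 //.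
set a := normc (c (mode l) (mode m) (mode n)).
have a0 : 0 <= a by exact: normc_ge0.
have hd : normc (d (mode l) (mode m) (mode n)) <= 4 ^+ (i + j + p) * w ^+ (4 * (i + j + p)) * a.
  have nn s : 0 <= 4 ^+ s * w ^+ (4 * s).
    by apply: mulr_ge0; apply: exprn_ge0 => //; exact: ltW.
  apply: le_trans (normc_diff_coef _ _ _ _ _ _) _.
  apply: le_trans (ler_wpM2l (nn i) (normc_diff_coef _ _ _ _ _ _)) _.
  apply: le_trans (ler_wpM2l (nn i) (ler_wpM2l (nn j) (normc_diff_coef _ _ _ _ _ _))) _.
  by rewrite -/w -/a !mulnDr !exprD le_eqVlt; apply/orP; left; apply/eqP; ring.
apply: le_trans (ler_wpM2r _ hd) _; first by rewrite exprn_ge0 // ltW.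
have -> : 4 ^+ (i + j + p) * w ^+ (4 * (i + j + p)) * a * w ^+ 15 =
  4 ^+ (i + j + p) * (a * w ^+ (4 * (i + j + p) + 15)) by rewrite [w ^+ (_ + 15)]exprD; ring.
apply: ler_pM.
- exact: exprn_ge0.
- by apply: mulr_ge0 => //; rewrite exprn_ge0 // ltW.
- by apply: ler_weXn2l => //; rewrite ler1n.
- apply: le_trans (hc (mode l) (mode m) (mode n)).
  by apply: ler_wpM2l => //; apply: ler_weXn2l => //; rewrite leq_add2r leq_mul2l ijp orbT.
Qed.

Lemma sobolev_re_trig_sum c (k : nat) (M : R) : 0 <= M ->
  (forall l m n, normc (c l m n) * weight l m n ^+ (4 * k + 15) <= M) ->
  sobolev_norm L k (re_trig_sum c) <= Num.sqrt (k.+1%:R ^+ 3 * L ^+ 3) * (4 ^+ k * Z ^+ 25 * M).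
Proof.
move=> M0 hc; set D := 4 ^+ k * Z ^+ 25 * M.
have Z2 := Z_ge2.
have D0 : 0 <= D.
  by apply: mulr_ge0 => //; apply: mulr_ge0; apply: exprn_ge0 => //; lra.
have L3 : 0 <= L ^+ 3 by rewrite exprn_ge0 // ltW.
rewrite -[X in _ * X](ger0_norm D0) -sqrtr_sqr -sqrtrM; last first.
  by apply: mulr_ge0 => //; exact: exprn_ge0.
apply: ler_wsqrtr; rewrite -mulrA.
apply: (@sum3_le_cst (fun i j p => integral3 L (fun x y z => partial i j p (re_trig_sum c) x y z ^+ 2))).
  by apply: mulr_ge0 => //; exact: sqr_ge0.
move=> i j p ijp.
apply: (@le_trans _ _ (integral3 L (fun _ _ _ => D ^+ 2))); last first.
  by rewrite (integral3_cst L_gt0 (D ^+ 2)) mulrC.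
apply: (integral3_le L_gt0 _ (@continuous3_cst R _)) => [|x y z].
  rewrite mixed_partial_re_trig_sum.
  exact: continuous3M (@continuous_re_trig_sum _) (@continuous_re_trig_sum _).
rewrite -[leLHS]real_normK ?num_real //; apply: lerXn2r; rewrite ?nnegrE //.
exact: re_trig_sum_partial_le.
Qed.

Lemma extension_lin (f g : grid_fun R) (a b : R) x y z :
  extension K L (fun i j k => a * f i j k + b * g i j k) x y z =
  a * extension K L f x y z + b * extension K L g x y z.
Proof.
rewrite /extension !trig_sumE !Re_mode_total -!mode_totalZ -mode_totalD.
apply: eq_bigr => l _; apply: eq_bigr => m _; apply: eq_bigr => n _.
by rewrite dft_lin mulrDl -!mulrA Re_lin.
Qed.

(** The right side is grouped as in increment2. *)
Lemma extension_second_difference (u v w : grid_fun R) :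
  (fun x y z => extension K L u x y z - 2 * extension K L v x y z + extension K L w x y z) =
  extension K L (sub_grid (sub_grid u v) (sub_grid v w)).
Proof.
have -> : sub_grid (sub_grid u v) (sub_grid v w) =
    fun i j k => 1 * (fun i j k => 1 * u i j k + (- 2) * v i j k) i j k + 1 * w i j k.
  by apply/funext => i; apply/funext => j; apply/funext => k; rewrite /sub_grid; ring.
apply/funext => x; apply/funext => y; apply/funext => z.
by rewrite !extension_lin; ring.
Qed.

Lemma sobolev_extension (f : grid_fun R) (k : nat) (M : R) : decay K L (4 * k + 15) M f ->
  sobolev_norm L k (extension K L f) <=
  Num.sqrt (k.+1%:R ^+ 3 * L ^+ 3) * (4 ^+ k * Z ^+ 25 * M).
Proof. by move=> hf; exact: sobolev_re_trig_sum (decay_ge0 hf) hf. Qed.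

End TrigonometricSums.

(** * From the scheme to the Sobolev estimate *)

Section Levels.
Variables (R : realType).
Implicit Types (phi : int -> grid_fun R).

(** Time levels are shifted by one, so that the ghost level - 1 is number 0. *)
Definition level phi (n : nat) : grid_fun R := if n is n'.+1 then phi n'%:Z else phi (-1).

Lemma levelE phi (n : nat) : phi (n%:Z - 1) = level phi n.
Proof. by case: n => [|n] //=; rewrite -addn1 PoszD addrK. Qed.

Lemma regular_scheme_of_solution K (L A C0 eps dt Z : R) (P j : nat)
    (phi0 : R -> R -> R -> R) phi (B Z0 : R) :
  0 < L -> 16^-1 <= A -> 0 < eps -> eps < 1 -> 0 < dt -> dt <= 1 ->
  2 <= Z -> A <= Z -> C0 <= Z -> eps^-1 <= Z -> L ^+ 2 <= 2 * Z -> L ^+ 3 <= Z -> L ^- 3 <= Z ->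
  (P + 15 <= 8 * j)%N -> 2 <= Z0 -> L ^+ 2 <= 2 * Z0 ->
  6 ^+ j * (L ^- 3 * (B ^+ 2 + L ^+ 3)) * Z0 ^+ 25 <= Z ->
  class_C (2 * j) phi0 -> periodic3 L phi0 -> sobolev_norm L (2 * j) phi0 <= B ->
  numerical_solution K L A eps dt phi0 phi ->
  initial_energy K L eps dt (phi 0) <= C0 ->
  regular_scheme K L A eps dt Z P (level phi).
Proof.
move=> L0 A16 ep0 ep1 dt0 dt1 Z2 ZA ZC Ze ZL2 ZL3 ZLV Pj Z02 Z0L ZY cf pf hB sol E0.
have est := energy_estimates L0 A16 ep0 ep1 dt0 sol E0 Z2 ZC ZL3 Ze.
have A0 : 0 <= A by apply: le_trans A16; rewrite invr_ge0.
split=> //.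
- by move=> n; rewrite -levelE; exact: (Vper_sol sol).
- exact: sol_ghost sol.
- move=> n i i' k; have := sol_step sol n i i' k.
  by rewrite levelE -PoszD addn1.
- by move=> n; case: (est n).
- by move=> n; case: (est n).
- rewrite /pdecay expr1 mulr1; apply: decay_le ZY _.
  apply: (decay_eq _ (decay_initial_grid K L0 Pj Z02 Z0L cf pf hB)) => i i' k.
  by rewrite -(sol_init sol).
Qed.

End Levels.

(** The exponents a and P of second_difference_decay depend on k only, and P
    fixes the smoothness asked from the initial datum.  All bounds on the data
    are collected in a constant Zc, independent of eps; with Z = Zc / eps the
    constant Z ^ (25 + a) is a power of 1 / eps times a constant. *)
Lemma second_difference_bound (R : realType) (k : nat) :
  exists s m : nat, (0 < m)%N /\
  forall L A C0 B : R, 0 < L -> 16^-1 <= A ->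
  exists C : R, 0 < C /\
  forall (phi0 : R -> R -> R -> R) (eps dt : R) (K : nat) (phi : int -> grid_fun R),
  periodic3 L phi0 -> class_C s phi0 -> sobolev_norm L s phi0 <= B ->
  0 < eps -> eps < 1 -> 0 < dt -> dt <= 1 ->
  numerical_solution K L A eps dt phi0 phi ->
  initial_energy K L eps dt (phi 0) <= C0 ->
  forall n : nat,
  sobolev_norm L k (fun x y z =>
      extension K L (phi (n%:Z + 1)) x y z - 2 * extension K L (phi n%:Z) x y z
      + extension K L (phi (n%:Z - 1)) x y z)
    <= C * eps ^- m * dt ^+ 2.
Proof.
have [a [P hP]] := second_difference_decay (4 * k + 15).
pose j := (P + 15)%N.
exists (2 * j)%N, (25 + a)%N; split=> // L A C0 B L0 A16.
pose Z0 := 2 + L ^+ 2; pose Y := 6 ^+ j * (L ^- 3 * (B ^+ 2 + L ^+ 3)) * Z0 ^+ 25.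
pose Zc := 2 + A + `|C0| + L ^+ 2 + L ^+ 3 + L ^- 3 + Y.
have L2 : 0 <= L ^+ 2 by exact: sqr_ge0.
have L3 : 0 < L ^+ 3 by exact: exprn_gt0.
have LV : 0 < L ^- 3 by rewrite invr_gt0.
have A0 : 0 < A by apply: lt_le_trans A16; rewrite invr_gt0.
have Z02 : 2 <= Z0 by rewrite /Z0 lerDl.
have Z0L : L ^+ 2 <= 2 * Z0 by rewrite /Z0; lra.
have Y0 : 0 <= Y.
  apply: mulr_ge0; last by apply: exprn_ge0; lra.
  apply: mulr_ge0; first exact: exprn_ge0.
  by apply: mulr_ge0 (ltW LV) _; have := sqr_ge0 B; lra.
have c0 : 0 <= `|C0| by exact: normr_ge0.
have cC : C0 <= `|C0| by exact: ler_norm.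
pose S := Num.sqrt (k.+1%:R ^+ 3 * L ^+ 3).
have S0 : 0 < S by rewrite sqrtr_gt0; apply: mulr_gt0 => //; rewrite exprn_gt0.
have [Zc2 [ZcA [ZcC [ZcL2 [ZcL3 [ZcLV ZcY]]]]]] : 2 <= Zc /\ A <= Zc /\ C0 <= Zc /\
    L ^+ 2 <= 2 * Zc /\ L ^+ 3 <= Zc /\ L ^- 3 <= Zc /\ Y <= Zc.
  by rewrite /Zc; do !split; lra.
have Zc0 : 0 < Zc by lra.
exists (S * (4 ^+ k * Zc ^+ (25 + a))); split.
  by apply: mulr_gt0 => //; apply: mulr_gt0; rewrite exprn_gt0.
move=> phi0 eps dt K phi pf cf hB ep0 ep1 dt0 dt1 sol E0 n.
pose Z := Zc / eps.
have ei : 1 <= eps^-1 by rewrite invf_ge1 // ltW.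
have ZcZ : Zc <= Z by rewrite /Z ler_peMr // ltW.
have Ze : eps^-1 <= Z by rewrite /Z ler_peMl ?invr_ge0 ?(ltW ep0) //; lra.
have rs : regular_scheme K L A eps dt Z P (level phi).
  have Pj : (P + 15 <= 8 * j)%N by rewrite /j leq_pmull.
  have ZL : L ^+ 2 <= 2 * Z by apply: le_trans ZcL2 _; rewrite ler_pM2l.
  exact: (regular_scheme_of_solution L0 A16 ep0 ep1 dt0 dt1 (le_trans Zc2 ZcZ)
    (le_trans ZcA ZcZ) (le_trans ZcC ZcZ) Ze ZL (le_trans ZcL3 ZcZ) (le_trans ZcLV ZcZ)
    Pj Z02 Z0L (le_trans ZcY ZcZ) cf pf hB sol E0).
have Z2 := rs_Z2 rs; have ZL2 := rs_ZL2 rs.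
rewrite extension_second_difference levelE -PoszD addn1.
have hd := hP R K L A eps dt Z (level phi) rs n.
apply: le_trans (sobolev_extension L0 Z2 ZL2 hd) _.
rewrite -/S le_eqVlt; apply/orP; left; apply/eqP.
rewrite -[eps ^- _]exprVn /Z !exprD !exprMn; ring.
Qed.

Theorem theorem3p4 (R : realType) (k : nat) :
  exists s m : nat, (0 < m)%N /\
  forall L A C0 B : R, 0 < L -> 16^-1 <= A ->
  exists c C : R, 0 < c /\ 0 < C /\
  forall (phi0 : R -> R -> R -> R) (T eps dt : R) (K : nat)
         (phi : int -> grid_fun R),
  periodic3 L phi0 -> class_C s phi0 -> sobolev_norm L s phi0 <= B ->
  0 < T -> 0 < eps -> eps < 1 -> 0 < dt ->
  numerical_solution K L A eps dt phi0 phi ->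
  initial_energy K L eps dt (phi 0) <= C0 ->
  dt <= c * Num.sqrt eps ->
  forall n : nat, (1 <= n)%N -> n%:Z <= Num.floor (T / dt) - 1 ->
  sobolev_norm L k (fun x y z =>
      extension K L (phi (n%:Z + 1)) x y z - 2 * extension K L (phi n%:Z) x y z
      + extension K L (phi (n%:Z - 1)) x y z)
    <= C * eps ^- m * dt ^+ 2.
Proof.
have [s [m [m0 H]]] := second_difference_bound R k.
exists s, m; split=> // L A C0 B L0 A16.
have [C [C_gt0 HC]] := H L A C0 B L0 A16.
exists 1, C; split=> //; split=> // phi0 T eps dt K phi pf cf hB _ e0 e1 dt0 sol E0 hdt n _ _.
have dt1 : dt <= 1.
  by apply: le_trans hdt _; rewrite mul1r -[leRHS]sqrtr1; exact: (ler_wsqrtr (ltW e1)).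
exact: (HC phi0 eps dt K phi pf cf hB e0 e1 dt0 dt1 sol E0 n).
Qed.
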